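(* For every $\eta,q>0$ there is an $n_0\in\mathbb N$ such that for every graph $G$ on $n\geq n_0$ vertices and every $k\in\mathbb N$ with $k\geq qn$ the following is true. If at least $n/2$ vertices of $G$ have degree at least $(1+\eta)k$, then $G$ contains every tree with at most $k$ edges as a subgraph.
   Context: Graphs are finite and simple. Subgraphs are not necessarily induced. *)

(* Defs.v *)
(* MathComp, with the real numbers of MathComp-Analysis (realType). *)
From mathcomp Require Import all_boot all_order all_algebra.
From mathcomp Require Import reals.

Set Implicit Arguments.
Unset Strict Implicit.
Unset Printing Implicit Defensive.

Record sgraph := SGraph {
  vertex :> finType;
  adj : rel vertex;
  adj_sym : symmetric adj;
  adj_irr : irreflexive adj }.

Definition neighbours (G : sgraph) (v : G) : {set G} := [set w | adj v w].

Definition degree (G : sgraph) (v : G) : nat := #|neighbours v|.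

Definition edges (G : sgraph) : {set {set G}} :=
  [set [set p.1; p.2] | p : G * G & adj p.1 p.2].

Definition connected_graph (G : sgraph) : Prop :=
  0 < #|G| /\ forall x y : G, connect (@adj G) x y.

(* A [ucycle] of size 2 is an edge traversed back and forth, not a cycle of
   the graph; irreflexivity excludes size 1. *)
Definition acyclic_graph (G : sgraph) : Prop :=
  forall c : seq G, ucycle (@adj G) c -> size c <= 2.

Definition is_tree (G : sgraph) : Prop := connected_graph G /\ acyclic_graph G.

(* G has a (not necessarily induced) subgraph isomorphic to H. *)
Definition contains_subgraph (G H : sgraph) : Prop :=
  exists f : H -> G,
    injective f /\ forall x y : H, adj x y -> adj (f x) (f y).

(* Main.v *)
(* The tree [T] is rooted and cut at a bounded number of seeds into small
   pieces, such that the seeds form two classes, the pieces below which there are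
   further seeds hang at the first class only, and the remaining pieces hanging
   at the second class have total size at most half of what is left of [T].  By
   Szemeredi's regularity lemma (proved by the energy increment) the graph is
   replaced by a reduced graph on clusters, at least about half of which have
   large degree.  A Gallai-Edmonds type decomposition of the reduced graph yields
   two adjacent clusters that are to receive the two seed classes: either both
   see enough room in a family of clusters with a perfect fractional matching, or
   the first sees enough room in one side of a matching and the second sees half
   as much in that matching together with further clusters of large degree.  The
   seeds are placed in subsets of the two clusters on which all vertices have
   nearly the same degrees into all clusters, so the room for each class does not
   depend on the order of the embedding, and the pieces are embedded greedily into
   matched pairs of clusters, whose two sides are kept balanced. *)

From mathcomp Require Import all_boot all_order all_algebra.
From mathcomp Require Import reals.
From mathcomp Require Import zify ring.
Require Import Defs.

Set Implicit Arguments.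
Unset Strict Implicit.
Unset Printing Implicit Defensive.

Import Order.TTheory GRing.Theory Num.Theory.

(** * Counting edges *)

(** The number of vertices of large degree is given without slack; all slack lies in the degree
    [(1 + eta) k], and it is linear in [n] because [k >= q n]. Regularisation costs a little of each
    degree and makes a few vertices of large degree atypical, so the counting in the reduced graph
    has to pay for these vertices with degree slack. Everything but the final theorem and the energy
    argument is over the natural numbers: [S0] stands for [1 / (eta q)], [D] for the required
    degree, [tau], about [n / (8 S0)], is the unit of slack, and [K = D - 2 tau] is the degree that
    survives. Losses are measured by [S], much larger than [S0], regularity by [E], much larger than
    [S], and [M] bounds the number of clusters. Pieces with further seeds and pieces hanging at the
    second class, of sizes [t0] and [t1], satisfy [t0 + 2 t1 <= |T|]. This is what allows the second
    seed cluster to see only half of the room. Regularity is asked for only from below: an embedding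
    needs edges, and a subpair that is too dense does no harm. *)

Lemma disjoint_setUl (V : finType) (X Y Z : {set V}) :
  [disjoint X :|: Y & Z] = [disjoint X & Z] && [disjoint Y & Z].
Proof. by rewrite -!setI_eq0 setIUl setU_eq0. Qed.

Section EdgeCount.
Variables (V : finType) (e : rel V).
Implicit Types (X Y : {set V}) (x y : V).

Definition deg_in x Y := #|[set y in Y | e x y]|.

Definition edge_count X Y := \sum_(x in X) deg_in x Y.

Lemma deg_inE x Y : deg_in x Y = \sum_(y in Y) e x y.
Proof.
rewrite /deg_in -sum1_card -big_mkcondr /=.
by apply: eq_bigl => y; rewrite inE.
Qed.

Lemma deg_in_sub x X Y : X \subset Y -> deg_in x X <= deg_in x Y.
Proof.
move=> /subsetP sXY; apply/subset_leq_card/subsetP => y.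
by rewrite !inE => /andP[/sXY -> ->].
Qed.

Lemma deg_in_card x Y : deg_in x Y <= #|Y|.
Proof. by apply/subset_leq_card/subsetP => y; rewrite inE => /andP[]. Qed.

Lemma deg_inU x X Y : [disjoint X & Y] ->
  deg_in x (X :|: Y) = deg_in x X + deg_in x Y.
Proof. by move=> dXY; rewrite !deg_inE -bigU //=; apply: eq_bigl => y; rewrite inE. Qed.

Lemma deg_in_leqU x X Y : deg_in x (X :|: Y) <= deg_in x X + deg_in x Y.
Proof.
apply: leq_trans (leq_card_setU _ _); apply/subset_leq_card/subsetP => y.
by rewrite !inE => /andP[/orP[] -> ->]; rewrite ?orbT.
Qed.

Lemma edge_count_sym X Y : symmetric e -> edge_count X Y = edge_count Y X.
Proof.
move=> se; rewrite /edge_count.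
under eq_bigr do rewrite deg_inE.
rewrite exchange_big; apply: eq_bigr => y _.
by rewrite deg_inE; apply: eq_bigr => x _; rewrite se.
Qed.

Lemma edge_count_card X Y : edge_count X Y <= #|X| * #|Y|.
Proof.
rewrite /edge_count -sum_nat_const; apply: leq_sum => x _; exact: deg_in_card.
Qed.

(** Deleting a vertex with at most [l] neighbours on the other side loses at most [l] edges and
    lowers [l * (#|X| + #|Y|)] by [l], so the strict inequality survives. It fails once a side is
    empty, hence the deletion stops earlier. *)
Lemma min_degree_subpair l X Y : symmetric e ->
  l * (#|X| + #|Y|) < edge_count X Y ->
  exists X', exists Y', [/\ X' \subset X, Y' \subset Y,
    (exists x, x \in X') /\ (exists y, y \in Y'),
    {in X', forall x, l < deg_in x Y'} & {in Y', forall y, l < deg_in y X'}].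
Proof.
move=> se; have [n] := ubnP (#|X| + #|Y|).
elim: n X Y => // n IHn X Y ltn hXY.
have [/exists_inP[x xX hx]|/exists_inPn noX] :=
    boolP [exists x in X, deg_in x Y <= l].
  case: (IHn (X :\ x) Y).
  - by rewrite (cardsD1 x X) xX in ltn; lia.
  - move: hXY; rewrite /edge_count (big_setD1 x) //= (cardsD1 x X) xX; nia.
  move=> X' [Y' [sX sY nz h1 h2]]; exists X', Y'; split=> //.
  exact: subset_trans sX (subsetDl _ _).
have [/exists_inP[y yY hy]|/exists_inPn noY] :=
    boolP [exists y in Y, deg_in y X <= l].
  case: (IHn X (Y :\ y)).
  - by rewrite (cardsD1 y Y) yY in ltn; lia.
  - move: hXY; rewrite edge_count_sym // [in X in _ -> X]edge_count_sym //.
    rewrite /edge_count (big_setD1 y) //= (cardsD1 y Y) yY; nia.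
  move=> X' [Y' [sX sY nz h1 h2]]; exists X', Y'; split=> //.
  exact: subset_trans sY (subsetDl _ _).
have [X0|[x xX]] := set_0Vmem X.
  by move: hXY; rewrite /edge_count X0 big_set0.
have [Y0|[y yY]] := set_0Vmem Y.
  by move: hXY; rewrite edge_count_sym // /edge_count Y0 big_set0.
exists X, Y; split=> //.
- by split; [exists x | exists y].
- by move=> z zX; rewrite ltnNge noX.
- by move=> z zX; rewrite ltnNge noY.
Qed.

End EdgeCount.

Lemma sum_setI_le (V I : finType) (S : {set I}) (D : I -> {set V}) (U : {set V}) :
  {in S &, forall i j, i != j -> [disjoint D i & D j]} ->
  \sum_(i in S) #|U :&: D i| <= #|U|.
Proof.
move=> dD; rewrite -[leqRHS]sum1_card.
have -> : \sum_(i in S) #|U :&: D i| = \sum_(x in U) \sum_(i in S) (x \in D i).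
  rewrite exchange_big; apply: eq_bigr => i _.
  by rewrite -sum1_card -big_mkcondr; apply: eq_bigl => x; rewrite inE.
apply: leq_sum => x _.
have [/exists_inP[i iS xi]|/exists_inPn H] := boolP [exists i in S, x \in D i].
  rewrite (bigD1 i) //= xi big1 // => j /andP[jS nji].
  by rewrite (disjointFr (dD i j iS jS _) xi) // eq_sym.
by rewrite big1 // => i iS; rewrite (negPf (H i iS)).
Qed.

(** * Rooted trees *)

Section TreeParent.
Variable T : sgraph.

(** A rooted tree on [Z], given by parents and depths. The last clause says that [Z] spans only
    parent edges, so a map that respects parents respects all adjacencies. *)
Definition rooted_on (Z : {set T}) (r : T) (p : T -> T) (d : T -> nat) :=
  [/\ [/\ r \in Z, p r = r & d r = 0],
      {in Z, forall x, x != r -> [/\ p x \in Z, adj x (p x) & d x = (d (p x)).+1]}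
    & {in Z &, forall x y, adj x y -> x != r /\ p x = y \/ y != r /\ p y = x}].

Lemma rooted_on_connect (Z : {set T}) r p d : rooted_on Z r p d ->
  {in Z &, forall y z,
    connect [rel a b : T | [&& adj a b, a \in Z & b \in Z]] y z}.
Proof.
move=> [[rZ pr dr] pZ _].
set eZ := [rel a b : T | _].
have sZ : symmetric eZ by move=> a b /=; rewrite adj_sym [in RHS]andbCA andbA andbC; case: (a \in Z); case: (b \in Z); rewrite ?andbF ?andbT.
have conr y : y \in Z -> connect eZ y r.
  have [n] := ubnP (d y); elim: n y => // n IHn y ltd yZ.
  have [->//|nyr] := eqVneq y r.
  have [pyZ apy dpy] := pZ y yZ nyr.
  apply: (@connect_trans _ _ (p y)); first by apply: connect1; rewrite /= apy yZ.
  by apply: IHn => //; rewrite dpy in ltd.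
move=> y z yZ zZ; apply: connect_trans (conr y yZ) _.
rewrite (sym_connect_sym sZ); exact: conr.
Qed.

(** A second neighbour [y] of [x] in [Z] would give a cycle: a repetition-free path inside [Z] from
    [y] to [z], closed through [x]. So [z] is the only neighbour and can serve as the parent. *)
Lemma rooted_on_extend (Z : {set T}) r p d x z :
  acyclic_graph T -> rooted_on Z r p d -> x \notin Z -> z \in Z -> adj z x ->
  exists p' d', rooted_on (x |: Z) r p' d'.
Proof.
move=> acT rZ xZ zZ azx; have con := rooted_on_connect rZ.
case: rZ => [[rZ pr dr] pZ aZ].
have uniq_nb y : y \in Z -> adj y x -> y = z.
  move=> yZ ayx; apply/eqP/negPn/negP => nyz.
  have /connectP[s0 ps0 ls0] := con y z yZ zZ.
  case/shortenP: ps0 ls0 => s ps us _ ls.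
  have sZ : {subset y :: s <= Z}.
    move=> a; rewrite inE => /orP[/eqP->//|].
    elim: s y {ls us nyz yZ ayx} ps => //= b s IHs y /andP[/and3P[_ _ bZ] ps].
    by rewrite inE => /orP[/eqP->//|]; apply: IHs ps.
  have := acT [:: x, y & s]; rewrite /ucycle /=.
  have -> : path (@adj T) y (rcons s x).
    rewrite rcons_path -ls azx andbT.
    by apply: sub_path ps => a b /= /andP[].
  rewrite adj_sym ayx /=.
  have -> : x \notin y :: s by apply: contra xZ => /sZ.
  move: us => /= -> /(_ isT).
  by case: s ls {ps sZ} => //= lzy; rewrite lzy eqxx in nyz.
have nxr : x != r by apply: contraNneq xZ => ->.
exists (fun y => if y == x then z else p y), (fun y => if y == x then (d z).+1 else d y).
have nzx : (z == x) = false by apply: contraNF xZ => /eqP <-.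
split.
- by rewrite !inE rZ orbT (negPf (_ : r != x)) // eq_sym.
- move=> y; rewrite in_setU1 => /orP[/eqP->|yZ] nyr.
    by rewrite eqxx in_setU1 zZ orbT adj_sym azx nzx.
  have nyx : (y == x) = false by apply: contraNF xZ => /eqP <-.
  have [pyZ apy dpy] := pZ y yZ nyr.
  have npx : (p y == x) = false by apply: contraNF xZ => /eqP <-.
  by rewrite nyx in_setU1 pyZ orbT npx.
- move=> a b; rewrite !in_setU1 => /orP[/eqP->|aZ'] /orP[/eqP->|bZ'].
  + by rewrite adj_irr.
  + by move=> axb; left; split=> //; rewrite eqxx (uniq_nb b) // adj_sym.
  + by move=> axb; right; split=> //; rewrite eqxx (uniq_nb a).
  + have -> : (a == x) = false by apply: contraNF xZ => /eqP <-.
    have -> : (b == x) = false by apply: contraNF xZ => /eqP <-.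
    exact: aZ.
Qed.

Lemma tree_parent : is_tree T -> exists r p d, rooted_on setT r p d.
Proof.
move=> [[/card_gt0P[r _] conT] acT].
suff [Z [p [d [rZ ZT]]]] : exists Z p d, rooted_on Z r p d /\ Z = [set: T].
  by exists r, p, d; rewrite -ZT.
have H n : n < #|T| -> exists Z p d, rooted_on Z r p d /\ n < #|Z|.
  elim: n => [|n IHn] ltn.
    exists [set r], id, (fun=> 0); rewrite cards1; split=> //.
    split; first by rewrite !inE.
      by move=> x; rewrite inE => /eqP->; rewrite eqxx.
    by move=> x y /set1P -> /set1P ->; rewrite adj_irr.
  have [Z [p [d [rZ ltZ]]]] := IHn (ltnW ltn).
  have [lt'|] := ltnP n.+1 #|Z|; first by exists Z, p, d.
  move=> leZ; have rinZ : r \in Z by case: rZ => [[]].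
  have [y yZ] : exists y, y \notin Z.
    apply/existsP; rewrite -negb_forall; apply/negP => /forallP aZ.
    have : #|[set: T]| <= #|Z| by apply: subset_leq_card; apply/subsetP => x _.
    by rewrite cardsT; lia.
  have [/exists_inP[z zZ /exists_inP[x xZ azx]]|] :=
      boolP [exists z in Z, [exists x in ~: Z, adj z x]].
    rewrite inE in xZ; have [p' [d' rZ']] := rooted_on_extend acT rZ xZ zZ azx.
    by exists (x |: Z), p', d'; split=> //; rewrite cardsU1 xZ.
  move=> /exists_inPn noedge.
  have cl : closed (@adj T) (mem Z).
    suff cl1 a b : adj a b -> a \in Z -> b \in Z.
      by move=> a b ab; apply/idP/idP; apply: cl1 => //; rewrite adj_sym.
    move=> ab aZ; have /exists_inPn/(_ b) := noedge a aZ.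
    by rewrite inE ab => /contraTT; apply.
  by have := closed_connect cl (conT r y); rewrite rinZ (negPf yZ).
have T0 : 0 < #|T| by apply/card_gt0P; exists r.
have [Z [p [d [rZ ltZ]]]] := H #|T|.-1 ltac:(lia).
exists Z, p, d; split=> //; apply/eqP; rewrite eqEcard subsetT cardsT; lia.
Qed.

(** The edges from non-root vertices to their parents are distinct: two vertices with the same edge
    would be each other's parents, which the depths forbid. *)
Lemma rooted_card r p d : rooted_on setT r p d -> #|T| <= #|edges T|.+1.
Proof.
move=> [_ pZ _]; rewrite -cardsT (cardsD1 r) inE add1n ltnS.
have inj : {in [set: T] :\ r &, injective (fun x => [set x; p x])}.
  move=> x y; rewrite !inE !andbT => nx ny exy.
  have [_ _ dx] := pZ x (in_setT _) nx; have [_ _ dy] := pZ y (in_setT _) ny.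
  move/setP: exy => exy; move: (exy y) (exy x); rewrite !inE !eqxx /=.
  have [->//|nyx] := eqVneq y x => /= e1 /esym e2.
  by move: dx dy; rewrite -(eqP e1) -(eqP e2); lia.
have <- := card_in_imset inj.
apply/subset_leq_card/subsetP => E /imsetP[x].
rewrite !inE andbT => nx ->; have [_ ax _] := pZ x (in_setT _) nx.
by apply/imsetP; exists (x, p x); rewrite ?inE.
Qed.

End TreeParent.

(** * Cutting a rooted tree into small pieces *)

Section Cutting.
Variables (T : finType) (r : T) (p : T -> T) (d : T -> nat).
Hypotheses (pr : p r = r) (dr : d r = 0).
Hypothesis dp : forall x, x != r -> d x = (d (p x)).+1.
Implicit Types (W Z : {set T}) (u v w t : T).

Fixpoint top_below W n u :=
  if n is n'.+1 then if p u \in W then u else top_below W n' (p u) else u.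

(* The components of [~: W] are the fibres of [piece_top W] on [~: W]. *)
Definition piece_top W u := top_below W (d u) u.

Lemma piece_top_in W u : p u \in W -> piece_top W u = u.
Proof. by rewrite /piece_top; case: (d u) => //= n ->. Qed.

Lemma piece_top_out W u : r \in W -> u \notin W -> p u \notin W ->
  piece_top W u = piece_top W (p u).
Proof.
move=> rW uW puW; have nur : u != r by apply: contraNneq uW => ->.
by rewrite /piece_top (dp nur) /= (negPf puW).
Qed.

Lemma parent_ind (P : T -> Prop) :
  P r -> (forall u, u != r -> P (p u) -> P u) -> forall u, P u.
Proof.
move=> P0 PS u; have [n] := ubnP (d u); elim: n u => // n IHn u ltu.
have [->//|nur] := eqVneq u r; apply: PS => //; apply: IHn.
by rewrite dp in ltu.
Qed.

Lemma piece_topP W u : r \in W -> u \notin W ->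
  [/\ fconnect p u (piece_top W u), piece_top W u \notin W
    & p (piece_top W u) \in W].
Proof.
move=> rW; elim/parent_ind: u => [|u nur IHu] uW; first by rewrite rW in uW.
have [puW|puW] := boolP (p u \in W); first by rewrite piece_top_in.
rewrite piece_top_out //; have [h1 h2 h3] := IHu puW; split=> //.
exact: connect_trans (fconnect1 p u) h1.
Qed.

(** Climbing from [u] to the top of its piece for [W2] is an initial part of the climb for [W1]:
    enlarging the cut set refines the pieces. *)
Lemma piece_top_sub W1 W2 u : r \in W1 -> W1 \subset W2 -> u \notin W2 ->
  piece_top W1 u = piece_top W1 (piece_top W2 u).
Proof.
move=> rW /subsetP sW; elim/parent_ind: u => [|u nur IHu] uW.
  by rewrite sW in uW.
have [puW|puW] := boolP (p u \in W2); first by rewrite (piece_top_in puW).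
have uW1 : u \notin W1 by apply: contra uW => /sW.
have puW1 : p u \notin W1 by apply: contra puW => /sW.
by rewrite (piece_top_out (sW r rW) uW puW) -IHu // piece_top_out.
Qed.

Lemma ancestor_closed Z u t :
  {in Z, forall u, p u \in Z} -> u \in Z -> fconnect p u t -> t \in Z.
Proof.
move=> cZ uZ /iter_findex <-.
by elim: (findex _ _ _) => //= n; apply: cZ.
Qed.

Lemma ancestor_depth u v : fconnect p u v -> v != u -> d v < d u.
Proof.
elim/parent_ind: u v => [|u nur IHu] v /iter_findex <-.
  by elim: (findex p r v) => [|n IHn]; [rewrite /= eqxx | rewrite iterSr pr].
case: (findex p u v) => [|n]; first by rewrite eqxx.
rewrite iterSr (dp nur) ltnS => _.
have [->//|ne] := eqVneq (iter n p (p u)) (p u).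
by apply/ltnW/IHu => //; apply: fconnect_iter.
Qed.

Lemma ancestor_parent u v : fconnect p u v -> v != u -> fconnect p (p u) v.
Proof.
move=> /iter_findex; case: (findex p u v) => [|n] /=; first by move->; rewrite eqxx.
by rewrite -iterS iterSr => <- _; apply: fconnect_iter.
Qed.

(** As long as some vertex other than the root has at least [l] descendants in [Z], a deepest such
    vertex becomes a seed and all its descendants leave [Z]. Each seed pays for [l] vertices, which
    bounds [#|W|], and the pieces below it lie in subtrees with fewer than [l] vertices. *)
Lemma small_pieces_cut l Z : 0 < l -> r \in Z -> {in Z, forall u, p u \in Z} ->
  exists W, [/\ r \in W, W \subset Z, #|W| * l <= #|Z| + l &
    forall t, #|[set u in Z :\: W | piece_top W u == t]| <= l].
Proof.
move=> l0; have [n] := ubnP #|Z|; elim: n Z => // n IHn Z ltn rZ cZ.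
pose desc v := [set u in Z | fconnect p u v].
pose big v := [&& v \in Z, v != r & l <= #|desc v|].
have [v0 bv0|nobig] := pickP big; last first.
  exists [set r]; split; rewrite ?inE ?sub1set ?cards1 ?mul1n ?leq_addl // => t.
  have [->|[u0]] := set_0Vmem [set u in Z :\: [set r] | piece_top [set r] u == t].
    by rewrite cards0.
  rewrite !inE => /andP[/andP[nu0 u0Z] /eqP tu0].
  have := @piece_topP [set r] u0; rewrite !inE eqxx tu0 => /(_ isT nu0) [fu0 ntr _].
  have := nobig t; rewrite /big ntr (ancestor_closed cZ u0Z fu0) /= leqNgt.
  move/negbFE/ltnW => le; apply: leq_trans le; apply/subset_leq_card/subsetP => u.
  rewrite !inE => /andP[/andP[nu uZ] /eqP tu]; rewrite uZ /=.
  by have := @piece_topP [set r] u; rewrite !inE eqxx tu => /(_ isT nu) [].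
case: (arg_maxnP d bv0) => v /and3P[vZ nvr lv] vmax.
have rd : r \notin desc v.
  rewrite inE rZ /=; apply: contra nvr => /iter_findex <-.
  by elim: (findex p r v) => [|m IHm]; rewrite ?iterSr /= ?pr //.
have cZd : #|Z| = #|desc v| + #|Z :\: desc v|.
  rewrite -(cardsID (desc v) Z); congr (#|pred_of_set _| + _).
  by apply/setIidPr/subsetP => u; rewrite inE => /andP[].
have [||u|W' [rW' sW' cW' pW']] := IHn (Z :\: desc v).
- by move: ltn; rewrite cZd; lia.
- by rewrite inE rd.
- rewrite !inE => /andP[nu uZ]; rewrite cZ // uZ /= andbT in nu *.
  by apply: contra nu; apply: connect_trans; apply: fconnect1.
have vd : v \in desc v by rewrite inE vZ connect0.
have vW' : v \notin W' by apply/negP => /(subsetP sW'); rewrite inE vd.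
exists (v |: W'); split.
- by rewrite in_setU1 rW' orbT.
- by rewrite subUset sub1set vZ (subset_trans sW') ?subsetDl.
- rewrite cardsU1 vW' mulnDl mul1n.
  lia.
have inner u : u \in Z -> u \notin desc v -> u \notin W' ->
    piece_top (v |: W') u = piece_top W' u /\ piece_top W' u \notin desc v.
  elim/parent_ind: u => [|u nur IHu] uZ ud uW; first by rewrite rW' in uW.
  have pud : p u \notin desc v.
    apply: contra ud; rewrite !inE uZ => /andP[_]; apply: connect_trans; exact: fconnect1.
  have npv : (p u == v) = false by apply: contraNF pud => /eqP->.
  have nuv : (u == v) = false by apply: contraNF ud => /eqP->.
  have [puW|puW] := boolP (p u \in W').
    by rewrite !piece_top_in // in_setU1 puW orbT.
  have -> : piece_top (v |: W') u = piece_top (v |: W') (p u).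
    by apply: piece_top_out; rewrite in_setU1 ?npv ?nuv ?rW' ?orbT.
  by rewrite (piece_top_out rW' uW puW); apply: IHu => //; apply: cZ.
have outer u : u \in desc v -> u != v -> piece_top (v |: W') u \in desc v /\
    piece_top (v |: W') u != v.
  elim/parent_ind: u => [|u nur IHu] ud nuv; first by rewrite ud in rd.
  have uW : u \notin v |: W'.
    rewrite in_setU1 (negPf nuv) /=; apply/negP => /(subsetP sW').
    by rewrite inE ud.
  have [epv|npv] := eqVneq (p u) v.
    by rewrite piece_top_in ?epv ?setU11.
  have pud : p u \in desc v.
    move: ud; rewrite !inE => /andP[uZ fu]; rewrite cZ //=.
    by apply: ancestor_parent; rewrite // eq_sym.
  have puW : p u \notin v |: W'.
    rewrite in_setU1 (negPf npv) /=; apply/negP => /(subsetP sW').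
    by rewrite inE pud.
  have rW : r \in v |: W' by rewrite in_setU1 rW' orbT.
  by rewrite (piece_top_out rW uW puW); apply: IHu.
move=> t; have [td|td] := boolP (t \in desc v); last first.
  apply: leq_trans (pW' t); apply/subset_leq_card/subsetP => u.
  rewrite !in_set !negb_or -!andbA => /and4P[nuv uW uZ /eqP tu]; rewrite in_set1 in nuv.
  have ud : u \notin desc v.
    by apply: contra td => ud; rewrite -tu; case: (outer u ud nuv).
  have [e1 _] := inner u uZ ud uW.
  by move: ud; rewrite inE uZ uW => -> /=; rewrite -e1 tu.
have [->|[u0]] := set_0Vmem [set u in Z :\: (v |: W') | piece_top (v |: W') u == t].
  by rewrite cards0.
have memd u : u \in [set u in Z :\: (v |: W') | piece_top (v |: W') u == t] ->
    [/\ u \in desc v, u != v & fconnect p u t].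
  rewrite !in_set !negb_or -!andbA => /and4P[nuv uW uZ /eqP tu]; rewrite in_set1 in nuv.
  have ud : u \in desc v.
    apply/negPn/negP => ud; have [e1 e2] := inner u uZ ud uW.
    by rewrite -e1 tu td in e2.
  split=> //; first by rewrite inE in ud.
  rewrite -tu; case: (@piece_topP (v |: W') u); rewrite ?in_setU1 ?rW' ?orbT //.
  by rewrite (negPf nuv).
move=> u0s; have [u0d nu0 _] := memd u0 u0s.
have tv : t != v.
  by move: u0s; rewrite inE => /andP[_ /eqP <-]; case: (outer u0 u0d nu0).
have ltd : #|desc t| < l.
  rewrite ltnNge; apply/negP => bt.
  have tZ : t \in Z by move: td; rewrite inE => /andP[].
  have ntr : t != r by apply: contraNneq rd => <-.
  have := vmax t; rewrite /big tZ ntr bt => /(_ isT) /=; rewrite leqNgt.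
  rewrite ancestor_depth //; first by move: td; rewrite inE => /andP[].
  by rewrite eq_sym.
apply: leq_trans (ltnW ltd); apply/subset_leq_card/subsetP => u us.
have [ud nu ft] := memd u us; rewrite inE ft andbT.
by move: ud; rewrite inE => /andP[].
Qed.

Definition has_child_seed W t :=
  [exists w in W, [&& w != r, p w \notin W & piece_top W (p w) == t]].

(** The colour classes of the tree are the parities of the depth; [c] selects the first class. *)
Definition in_class c u := odd (d u) == c.

Lemma in_class_parent c u : u != r -> in_class c u = ~~ in_class c (p u).
Proof. by move=> nur; rewrite /in_class (dp nur) /=; case: odd; case: c. Qed.

(** The pieces without seeds below them form two groups according to the class they hang at. The
    lighter group takes at most half of what the other pieces leave; the class of the heavier group
    is made the first one. *)
Lemma lighter_class (W : {set T}) : exists c,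
  #|[set u in ~: W | has_child_seed W (piece_top W u)]| +
  2 * #|[set u in ~: W | ~~ has_child_seed W (piece_top W u)
                         && ~~ in_class c (p (piece_top W u))]| <= #|T|.
Proof.
set I := [set u in ~: W | has_child_seed _ _].
pose E c := [set u in ~: W | ~~ has_child_seed W (piece_top W u)
                             && ~~ in_class c (p (piece_top W u))].
have H : #|I| + (#|E true| + #|E false|) <= #|T|.
  rewrite -(cardsC I) leq_add2l.
  have dE : E true :&: E false = set0.
    apply/setP => u; rewrite !inE /in_class; case: (u \in W) => //=.
    by case: has_child_seed => //=; case: odd.
  have : #|E true :|: E false| = #|E true| + #|E false| by rewrite cardsU dE cards0 subn0.
  move=> <-; apply/subset_leq_card/subsetP => u.
  by rewrite !inE; case: (u \in W) => //=; case: has_child_seed.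
have [le|lt] := leqP #|E true| #|E false|.
  by exists true; rewrite -/(E true); lia.
by exists false; rewrite -/(E false); lia.
Qed.

(** A first cut is repaired in two ways, each adding at most one seed per old seed, and only seeds
    of the first class. The parent of a second-class seed becomes a seed, so seeds below pieces are
    first-class. If a piece with a seed below hangs at a second-class vertex, its top becomes a
    seed, so what remains of it hangs at the first class. *)
Lemma tree_decomposition l : 0 < l -> exists W c,
  [/\ r \in W, #|W| * l <= 3 * (#|T| + l),
      forall t, #|[set u in ~: W | piece_top W u == t]| <= l,
      {in W, forall w, w != r -> p w \notin W ->
        in_class c w /\ in_class c (p (piece_top W (p w)))} &
      #|[set u in ~: W | has_child_seed W (piece_top W u)]| +
      2 * #|[set u in ~: W | ~~ in_class c (p (piece_top W u))]| <= #|T|].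
Proof.
move=> l0.
have [W1 [rW1 _ cW1 pW1]] := small_pieces_cut l0 (in_setT r) (fun _ _ => in_setT _).
have [c hc] := lighter_class W1.
pose isA := in_class c.
pose Wb := [set p w | w in W1 & (w != r) && ~~ isA w].
pose Wt := [set piece_top W1 (p w) | w in W1
             & [&& w != r, p w \notin W1 & ~~ isA (p (piece_top W1 (p w)))]].
pose W := W1 :|: Wb :|: Wt.
have sW : W1 \subset W by rewrite /W -setUA subsetUl.
have subW u : u \notin W -> u \notin W1 by apply: contra; apply: (subsetP sW).
have rW : r \in W by apply: (subsetP sW).
have newA w : w \in W -> w \notin W1 -> isA w.
  rewrite /W !in_setU => /orP[/orP[->//|]|].
    move=> /imsetP[v]; rewrite inE => /and3P[_ nvr nA] -> _.
    by rewrite -[isA _]negbK /isA -in_class_parent.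
  move=> /imsetP[v]; rewrite inE => /and4P[_ nvr nW nA] -> ntW.
  rewrite /isA in_class_parent //.
  by apply: contraNneq ntW => ->.
(* A piece of [W] hanging at the other class is a piece of [W1]. *)
have old_top u : u \notin W -> ~~ isA (p (piece_top W u)) ->
    piece_top W1 u = piece_top W u /\ ~~ has_child_seed W1 (piece_top W1 u).
  move=> uW nA; have [_ tW ptW] := piece_topP rW uW.
  have ptW1 : p (piece_top W u) \in W1 by apply: contraNT nA => /newA ->.
  have e : piece_top W1 u = piece_top W u.
    by rewrite (piece_top_sub rW1 sW uW) (piece_top_in ptW1).
  split=> //; rewrite e; apply: contra tW => /exists_inP[w wW1 /and3P[nwr pw /eqP tw]].
  rewrite /W in_setU; apply/orP; right; apply/imsetP; exists w => //.
  by rewrite inE wW1 nwr pw tw.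
have seedsA w : w \in W -> w != r -> p w \notin W ->
    isA w /\ (w \in W1 \/ exists2 v, v \in W1 & [/\ v != r, w = p v & w \notin W1]).
  move=> wW nwr npw; have [w1|w1] := boolP (w \in W1).
    split; last by left.
    apply: contraNT npw => nA; rewrite /W !in_setU; apply/orP; left; apply/orP; right.
    by apply/imsetP; exists w => //; rewrite inE w1 nwr.
  split; first exact: newA.
  move: wW; rewrite /W !in_setU (negPf w1) /= => /orP[] /imsetP[v]; rewrite inE.
    by move=> /and3P[vW1 nvr _] e; right; exists v => //; split=> //; rewrite -e.
  move=> /and4P[vW1 nvr nv _] e; case/negP: npw; apply: (subsetP sW).
  by rewrite e; case: (piece_topP rW1 nv).
have child_old w : w \in W -> w != r -> p w \notin W ->
    has_child_seed W1 (piece_top W1 (p w)).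
  move=> wW nwr npw; apply/exists_inP.
  have [_ [w1|[v v1 [nvr e nw1]]]] := seedsA w wW nwr npw.
    by exists w => //; rewrite nwr eqxx subW.
  exists v => //; rewrite nvr -e nw1 /=.
  by rewrite (piece_top_out rW1 nw1) ?subW.
have cW : #|W| <= 3 * #|W1|.
  have c1 : #|Wb| <= #|W1|.
    apply: leq_trans (leq_imset_card _ _) _; apply/subset_leq_card/subsetP => w.
    by rewrite inE => /andP[].
  have c2 : #|Wt| <= #|W1|.
    apply: leq_trans (leq_imset_card _ _) _; apply/subset_leq_card/subsetP => w.
    by rewrite inE => /andP[].
  apply: leq_trans (leq_card_setU _ _) _.
  have [cU _] := leq_card_setU W1 Wb; lia.
clearbody W; exists W, c; split=> //.
- apply: leq_trans (leq_mul cW (leqnn l)) _.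
  by rewrite -mulnA leq_mul2l -cardsT.
- move=> t; apply: leq_trans (pW1 (piece_top W1 t)).
  apply/subset_leq_card/subsetP => u; rewrite !inE andbT => /andP[uW /eqP <-].
  by rewrite subW //= (piece_top_sub rW1 sW uW).
- move=> w wW nwr npw; have [wA _] := seedsA w wW nwr npw; split=> //.
  apply/negPn/negP => nA; have [e /negP[]] := old_top _ npw nA.
  exact: child_old.
- apply: leq_trans hc; apply: leq_add; last rewrite leq_mul2l /=.
    apply/subset_leq_card/subsetP => u; rewrite !inE => /andP[uW].
    move=> /exists_inP[w wW /and3P[nwr npw /eqP e]]; rewrite subW //=.
    by rewrite (piece_top_sub rW1 sW uW) -e -(piece_top_sub rW1 sW npw) child_old.
  apply/subset_leq_card/subsetP => u; rewrite !inE => /andP[uW nA].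
  by have [E nc] := old_top u uW nA; rewrite nc E subW.
Qed.

End Cutting.

(** * Embedding a decomposed tree piece by piece *)

Lemma fresh_neighbour (V : finType) (e : rel V) x (Y S : {set V}) :
  #|S| < deg_in e x Y -> exists y, [/\ y \in Y, e x y & y \notin S].
Proof.
move=> lt; have [/exists_inP[y]|/exists_inPn H] :=
  boolP [exists y in [set y in Y | e x y], y \notin S].
  by rewrite inE => /andP[yY exy] yS; exists y.
suff : deg_in e x Y <= #|S| by rewrite leqNgt lt.
by apply/subset_leq_card/subsetP => y /H /negPn.
Qed.

Section Embedding.
Variables (T : finType) (r : T) (p : T -> T) (d : T -> nat).
Hypotheses (pr : p r = r) (dr : d r = 0).
Hypothesis dp : forall x, x != r -> d x = (d (p x)).+1.
Variables (V : finType) (e : rel V).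
Hypothesis e_sym : symmetric e.
Implicit Types (U X Y : {set V}) (Z F : {set T}) (u v w : T).

Lemma embed_piece l F t X Y :
  t \in F -> (forall v, v \in F -> v != t -> v != r /\ p v \in F) ->
  #|F| <= l -> [disjoint X & Y] -> (exists x, x \in X) ->
  {in X, forall x, l < deg_in e x Y} -> {in Y, forall y, l < deg_in e y X} ->
  exists g : T -> V,
    [/\ {in F &, injective g},
        {in F, forall v, v != t -> e (g (p v)) (g v)} &
        {in F, forall v, g v \in if odd (d v) == odd (d t) then X else Y}].
Proof.
move=> tF pF lF dXY [x0 x0X] dX dY.
pose side v := if odd (d v) == odd (d t) then X else Y.
suff H n : n < #|F| -> exists F' g,
    [/\ t \in F' /\ F' \subset F, n < #|F'|, {in F', forall v, v != t -> p v \in F'}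
      & [/\ {in F' &, injective g}, {in F', forall v, v != t -> e (g (p v)) (g v)} &
        {in F', forall v, g v \in side v}]].
  have F0 : 0 < #|F| by apply/card_gt0P; exists t.
  have [F' [g [[_ sF] cF _ hg]]] := H #|F|.-1 ltac:(lia).
  have <- : F' = F by apply/eqP; rewrite eqEcard sF; lia.
  by exists g.
elim: n => [|n IHn] ltn.
  exists [set t], (fun=> x0); rewrite cards1 sub1set; split=> //.
  - by rewrite !inE.
  - by move=> v /set1P->; rewrite eqxx.
  split.
  - by move=> v w /set1P-> /set1P->.
  - by move=> v /set1P->; rewrite eqxx.
  - by move=> v /set1P->; rewrite /side eqxx.
have [F' [g [[tF' sF] cF pF' [ig eg sg]]]] := IHn (ltnW ltn).
have [lt|le] := ltnP n.+1 #|F'|; first by exists F', g.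
have [v0 v0F] : exists v, v \in F :\: F'.
  apply/set0Pn; apply: contraTneq ltn => E; rewrite -leqNgt; apply: leq_trans le.
  by apply: subset_leq_card; rewrite -setD_eq0 E.
case: (arg_minnP d v0F) => v /setDP[vF vF'] vmin.
have nvt : v != t by apply: contraNneq vF' => ->.
have [nvr pvF] := pF v vF nvt.
have pvF' : p v \in F'.
  apply: contraT => npv; have pvD : p v \in F :\: F' by rewrite in_setD npv.
  have := vmin _ pvD.
  by rewrite (dp nvr) ltnn.
have [y [yS ey yg]] : exists y, [/\ y \in side v, e (g (p v)) y & y \notin g @: F'].
  apply: fresh_neighbour; apply: leq_ltn_trans (leq_imset_card _ _) _.
  have : #|F'| <= l by apply: leq_trans lF; apply: subset_leq_card.
  move/leq_ltn_trans; apply; have := sg _ pvF'.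
  rewrite /side (dp nvr) /=; case: (odd (d (p v))); case: (odd (d t)) => /=;
  by [apply: dX | apply: dY].
have upd w : w \in F' -> (if w == v then y else g w) = g w.
  by move=> wF'; case: eqP => // e1; rewrite -e1 wF' in vF'.
exists (v |: F'), (fun w => if w == v then y else g w); split.
- by rewrite in_setU1 tF' orbT subUset sub1set vF.
- by rewrite cardsU1 vF' add1n ltnS.
- move=> w; rewrite in_setU1 => /orP[/eqP-> _|wF nw]; first by rewrite setU1r.
  by rewrite setU1r // pF'.
split.
- move=> w1 w2; rewrite !in_setU1 => /orP[/eqP->|w1F] /orP[/eqP->|w2F] //;
    rewrite ?eqxx ?upd //.
  + by move=> E; rewrite E imset_f in yg.
  + by move=> E; rewrite -E imset_f in yg.
  + exact: ig.
- move=> w; rewrite in_setU1 => /orP[/eqP-> _|wF nw].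
    by rewrite eqxx upd.
  by rewrite !upd ?pF' // eg.
- move=> w; rewrite in_setU1 => /orP[/eqP->|wF]; first by rewrite eqxx.
  by rewrite upd // sg.
Qed.

(** A place for one piece: free of the occupied set [U], and with enough edges to contain a subpair
    of minimum degree above [l]. *)
Definition site l (U X Y : {set V}) :=
  [/\ [disjoint X & U], [disjoint Y & U], [disjoint X & Y] &
      l * (#|X| + #|Y|) < edge_count e X Y].

Variables (l cap : nat) (W : {set T}) (c : bool) (A B : {set V}).
Notation top := (piece_top p d W).
Notation is_A := (in_class d c).
Notation child := (has_child_seed r p d W).
Hypotheses (rW : r \in W) (W_cap : #|W| <= cap).
Hypothesis piece_small : forall t, #|[set u in ~: W | top u == t]| <= l.
Hypothesis seeds_A : {in W, forall w, w != r -> p w \notin W ->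
  is_A w /\ is_A (p (top (p w)))}.
Hypotheses (a0 : exists a, a \in A).
Hypothesis degA : {in A, forall a, cap <= deg_in e a B}.
Hypothesis degB : {in B, forall b, cap <= deg_in e b A}.

(* [St U r0 r1 r2]: the pieces embedded so far occupy [U], and the pieces still
   to come have total size [r0] (pieces below which there are further seeds),
   [r1] (other pieces hanging at [B]) and [r2] (other pieces hanging at [A]);
   they are embedded in this order. *)
Definition strategy (St : {set V} -> nat -> nat -> nat -> Prop) :=
  [/\ forall U f0 f1 r0 r1 r2 a,
        0 < f0 + f1 <= l -> St U (f0 + f1 + r0) r1 r2 -> a \in A ->
        exists X Y, [/\ site l (U :|: (A :|: B)) X Y,
          {in X, forall x, e a x /\ cap <= deg_in e x A} &
          forall X0 Y0, X0 \subset X -> Y0 \subset Y -> #|X0| = f0 -> #|Y0| = f1 ->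
            St (U :|: (X0 :|: Y0)) r0 r1 r2],
      forall U f0 f1 r1 r2 b,
        0 < f0 + f1 <= l -> St U 0 (f0 + f1 + r1) r2 -> b \in B ->
        exists X Y, [/\ site l (U :|: (A :|: B)) X Y, {in X, forall x, e b x} &
          forall X0 Y0, X0 \subset X -> Y0 \subset Y -> #|X0| = f0 -> #|Y0| = f1 ->
            St (U :|: (X0 :|: Y0)) 0 r1 r2] &
      forall U f0 f1 r2 a,
        0 < f0 + f1 <= l -> St U 0 0 (f0 + f1 + r2) -> a \in A ->
        exists X Y, [/\ site l (U :|: (A :|: B)) X Y, {in X, forall x, e a x} &
          forall X0 Y0, X0 \subset X -> Y0 \subset Y -> #|X0| = f0 -> #|Y0| = f1 ->
            St (U :|: (X0 :|: Y0)) 0 0 r2]].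

Variable St : {set V} -> nat -> nat -> nat -> Prop.
Hypothesis St_strategy : strategy St.

(** The phases number the three groups of pieces in the order of embedding. Seeds belong to phase 0,
    together with the pieces leading to further seeds, so that no vertex has an earlier phase than
    its parent. *)
Definition phase u :=
  if (u \in W) || child (top u) then 0 else if is_A (p (top u)) then 2 else 1.

Definition rest Z (i : nat) := #|[set u in ~: W | (u \notin Z) && (phase u == i)]|.

Lemma phase_parent u : u != r -> phase (p u) <= phase u.
Proof.
move=> nur; rewrite /phase.
have [puW|puW] := boolP (p u \in W) => //=.
have [uW|uW] := boolP (u \in W) => /=; last by rewrite -(piece_top_out dp).
suff -> : child (top (p u)) by [].
by apply/exists_inP; exists u => //; rewrite nur puW /=.
Qed.

(** By [pe_full], [Z] contains pieces only as a whole. Seeds live in [A] and [B] and pieces avoid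
    both, so the two kinds never compete for vertices. [pe_return] secures that a seed below an
    embedded piece finds its place in [A]. *)
Record partial_embedding Z (f : T -> V) : Prop := PartialEmbedding {
  pe_root : r \in Z;
  pe_closed : {in Z, forall u, p u \in Z};
  pe_edge : {in Z, forall u, u != r -> e (f (p u)) (f u)};
  pe_inj : {in Z &, injective f};
  pe_seed : {in Z, forall u, u \in W -> f u \in if is_A u then A else B};
  pe_piece : {in Z, forall u, u \notin W -> f u \notin A :|: B};
  pe_full : {in Z, forall u, u \notin W -> forall v, v \notin W ->
    top v = top u -> v \in Z};
  pe_return : {in W, forall w, w != r -> p w \in Z -> p w \notin W ->
    cap <= deg_in e (f (p w)) A};
  pe_state : St (f @: (Z :\: W)) (rest Z 0) (rest Z 1) (rest Z 2)
}.

(** Fewer than [cap] vertices hold seeds so far, and the image of the parent has at least [cap]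
    neighbours in the required set: by the degrees between [A] and [B] if the parent is a seed, by
    [pe_return] otherwise. *)
Lemma extend_seed Z f u : partial_embedding Z f -> u \notin Z -> u \in W ->
  p u \in Z -> exists f', partial_embedding (u |: Z) f'.
Proof.
move=> [rZ cZ eZ iZ sZ nZ fZ retZ stZ] uZ uW puZ.
have nur : u != r by apply: contraNneq uZ => ->.
have [y [ytarget ey yf]] : exists y, [/\ y \in (if is_A u then A else B),
    e (f (p u)) y & y \notin f @: (Z :&: W)].
  apply: fresh_neighbour; apply: leq_ltn_trans (leq_imset_card _ _) _.
  apply: (@leq_trans cap).
    apply: leq_trans W_cap; rewrite (cardsD1 u W) uW add1n ltnS.
    apply/subset_leq_card/subsetP => v; rewrite !inE => /andP[vZ ->].
    by rewrite andbT; apply: contraNneq uZ => <-.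
  have [puW|puW] := boolP (p u \in W).
    have := sZ _ puZ puW; rewrite (in_class_parent dp c nur).
    by case: (is_A (p u)) => /= h; [apply: degA | apply: degB].
  by have [-> _] := seeds_A uW nur puW; apply: retZ.
have yAB : y \in A :|: B by rewrite inE; move: ytarget; case: ifP => _ ->; rewrite ?orbT.
have yfZ : y \notin f @: Z.
  apply/negP => /imsetP[v vZ E]; have [vW|vW] := boolP (v \in W).
    by case/negP: yf; rewrite E imset_f // inE vZ.
  by have := nZ v vZ vW; rewrite -E yAB.
pose f' v := if v == u then y else f v.
have upd v : v \in Z -> f' v = f v.
  by move=> vZ; rewrite /f'; case: eqP => // E; rewrite -E vZ in uZ.
have updu : f' u = y by rewrite /f' eqxx.
exists f'; split.
- by rewrite setU1r.
- by move=> v; rewrite !in_setU1 => /orP[/eqP->|vZ]; rewrite ?puZ ?cZ ?orbT.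
- move=> v; rewrite in_setU1 => /orP[/eqP-> _|vZ nv].
    by rewrite updu upd.
  by rewrite !upd ?cZ // eZ.
- move=> v w; rewrite !in_setU1 => /orP[/eqP->|vZ] /orP[/eqP->|wZ] //;
    rewrite ?updu ?upd //.
  + by move=> E; rewrite E imset_f in yfZ.
  + by move=> E; rewrite -E imset_f in yfZ.
  + exact: iZ.
- move=> v; rewrite in_setU1 => /orP[/eqP->|vZ] vW; first by rewrite updu.
  by rewrite upd // sZ.
- move=> v; rewrite in_setU1 => /orP[/eqP->|vZ] vW; first by rewrite uW in vW.
  by rewrite upd // nZ.
- move=> v; rewrite in_setU1 => /orP[/eqP->|vZ] vW w wW; first by rewrite uW in vW.
  by move=> tvw; rewrite setU1r // (fZ v vZ vW).
- move=> w wW nwr; rewrite in_setU1 => /orP[/eqP->|pwZ] pwW; first by rewrite uW in pwW.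
  by rewrite upd // retZ.
have -> : (u |: Z) :\: W = Z :\: W.
  by apply/setP => v; rewrite !inE; case: eqP => // ->; rewrite uW.
have -> : f' @: (Z :\: W) = f @: (Z :\: W).
  by apply: eq_in_imset => v; rewrite inE => /andP[_ /upd].
have rE i : rest (u |: Z) i = rest Z i.
  by apply: eq_card => v; rewrite !inE; case: eqP => // ->; rewrite uW.
by rewrite !rE.
Qed.

(** Since [Z] contains only whole pieces, [u] is the top of a new piece hanging at a seed. The piece
    is embedded at once into a site offered by the strategy; [prev] brings the state into the form
    that the strategy expects in the phase of [u]. *)
Lemma extend_piece Z f u : partial_embedding Z f -> u \notin Z -> u \notin W ->
  p u \in Z -> (forall i, i < phase u -> rest Z i = 0) ->
  exists Z' f', partial_embedding Z' f' /\ Z \proper Z'.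
Proof.
move=> [rZ cZ eZ iZ sZ nZ fZ retZ stZ] uZ uW puZ prev.
have nur : u != r by apply: contraNneq uZ => ->.
have puW : p u \in W.
  apply: contraT => puW; case/negP: uZ; apply: (fZ (p u)) => //.
  by rewrite (piece_top_out dp).
have tu : top u = u by rewrite piece_top_in.
set F := [set v in ~: W | top v == u].
have uF : u \in F by rewrite !inE uW tu eqxx.
have FZ v : v \in F -> v \notin Z.
  rewrite !inE => /andP[vW /eqP tv]; apply: contra uZ => vZ.
  by apply: (fZ v) => //; rewrite tu.
have pF v : v \in F -> v != u -> v != r /\ p v \in F.
  rewrite !inE => /andP[vW /eqP tv] nvu; split.
    by apply: contraNneq vW => ->.
  have pvW : p v \notin W by apply: contra nvu => pvW; rewrite -tv piece_top_in.
  by rewrite pvW /= -tv (piece_top_out dp rW vW pvW).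
have phF v : v \in F -> phase v = phase u.
  by rewrite !inE => /andP[vW /eqP tv]; rewrite /phase tu tv (negPf vW) (negPf uW).
have restF i : rest Z i = (if i == phase u then #|F| else 0) + rest (Z :|: F) i.
  rewrite /rest -(cardsID F [set _ in _ | (_ \notin Z) && _]); congr (_ + _).
    case: eqP => [->|/eqP ni].
      apply: eq_card => v; rewrite in_setI andbC; case: (boolP (v \in F)) => //= vF.
      rewrite inE FZ // phF // eqxx.
      by move: vF; rewrite !inE => /andP[->].
    apply/eqP; rewrite cards_eq0; apply/eqP/setP => v; rewrite in_set0 in_setI andbC.
    case: (boolP (v \in F)) => //= vF; rewrite inE phF // eq_sym (negPf ni).
    by rewrite !andbF.
  apply: eq_card => v; rewrite in_setD [in RHS]inE [in LHS]inE in_setU negb_or.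
  by case: (v \in F); case: (v \in Z); rewrite ?andbF ?andbT.
pose F0 := [set v in F | odd (d v) == odd (d u)].
pose F1 := [set v in F | odd (d v) != odd (d u)].
have cF : #|F0| + #|F1| = #|F|.
  rewrite -(cardsID F0 F); congr (_ + _); apply: eq_card => v; rewrite !inE.
    by rewrite -!andbA; case: (v \in W); case: eqP; rewrite ?andbF.
  by rewrite -!andbA; case: (v \in W); case: eqP; rewrite ?andbF ?andbT.
have F_l : 0 < #|F0| + #|F1| <= l.
  by rewrite cF piece_small andbT; apply/card_gt0P; exists u.
set U := f @: (Z :\: W) in stZ *.
have [X [Y [sXY eX retX stX]]] : exists X Y, [/\ site l (U :|: (A :|: B)) X Y,
    {in X, forall x, e (f (p u)) x},
    phase u = 0 -> {in X, forall x, cap <= deg_in e x A} &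
    forall X0 Y0, X0 \subset X -> Y0 \subset Y -> #|X0| = #|F0| -> #|Y0| = #|F1| ->
      St (U :|: (X0 :|: Y0)) (rest (Z :|: F) 0) (rest (Z :|: F) 1) (rest (Z :|: F) 2)].
  have [step0 step1 step2] := St_strategy.
  have fpu := sZ _ puZ puW; move: stZ; rewrite !restF -cF.
  have := restF 0; have := restF 1; move: prev.
  rewrite /phase (negPf uW) tu /=; case: ifPn => [/exists_inP[w wW /and3P[nwr pwW /eqP tw]] _|_].
    move=> _ _ stZ; have [_] := seeds_A wW nwr pwW; rewrite tw => Apu.
    rewrite Apu in fpu.
    have [X [Y [h1 h2 h3]]] := step0 _ _ _ _ _ _ _ F_l stZ fpu.
    by exists X, Y; split=> // [x /h2[]|_ x /h2[]].
  case: ifPn => Apu prev; rewrite ?Apu ?(negPf Apu) in fpu.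
    rewrite !prev //= ?add0n => <- <- stZ.
    have [X [Y [h1 h2 h3]]] := step2 _ _ _ _ _ F_l stZ fpu.
    by exists X, Y; split.
  rewrite (prev 0) //= !add0n => _ <- stZ.
  have [X [Y [h1 h2 h3]]] := step1 _ _ _ _ _ _ F_l stZ fpu.
  by exists X, Y; split.
case: sXY => dX dY dXY dense.
have [X' [Y' [sX sY [nX _] mX mY]]] := min_degree_subpair e_sym dense.
have dXY' : [disjoint X' & Y'] by apply: disjointWl sX _; apply: disjointWr sY _.
have [g [ig eg sg]] := embed_piece uF pF (piece_small u) dXY' nX mX mY.
have gX v : v \in F -> g v \in X :|: Y.
  move=> vF; have := sg v vF; rewrite inE.
  by case: ifP => _ => [/(subsetP sX)|/(subsetP sY)] ->; rewrite ?orbT.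
have gU v : v \in F -> g v \notin U :|: (A :|: B).
  move=> vF; have := gX v vF; rewrite in_setU => /orP[gx|gy].
    by rewrite (disjointFr dX gx).
  by rewrite (disjointFr dY gy).
have gfZ v w : v \in F -> w \in Z -> g v <> f w.
  move=> vF wZ E; have := gU v vF; rewrite E.
  have [wW|wW] := boolP (w \in W).
    by have := sZ w wZ wW; case: ifP => _ h; rewrite !in_setU h !orbT.
  by rewrite in_setU imset_f // inE wW.
pose f' v := if v \in F then g v else f v.
have updZ v : v \in Z -> f' v = f v.
  by move=> vZ; rewrite /f'; case: ifP => // /FZ; rewrite vZ.
have updF v : v \in F -> f' v = g v by rewrite /f' => ->.
exists (Z :|: F), f'; split; last first.
  by apply/properP; split; [apply: subsetUl | exists u; rewrite // inE uF orbT].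
split.
- by rewrite inE rZ.
- move=> v; rewrite !in_setU => /orP[vZ|vF]; first by rewrite cZ.
  by have [->|/(pF v vF)[_ ->]] := eqVneq v u; rewrite ?puZ ?orbT.
- move=> v; rewrite in_setU => /orP[vZ|vF] nvr; first by rewrite !updZ ?cZ // eZ.
  have [->|nvu] := eqVneq v u.
    rewrite updZ // updF // eX // (subsetP sX) //.
    by have := sg u uF; rewrite eqxx.
  by rewrite !updF ?(pF v vF nvu).2 // eg.
- move=> v w; rewrite !in_setU => /orP[vZ|vF] /orP[wZ|wF].
  + by rewrite !updZ //; apply: iZ.
  + by rewrite updZ // updF // => /esym /(gfZ w v wF vZ).
  + by rewrite updF // updZ // => /(gfZ v w vF wZ).
  + by rewrite !updF //; apply: ig.
- move=> v; rewrite in_setU => /orP[vZ|vF] vW; first by rewrite updZ // sZ.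
  by move: vF; rewrite !inE vW.
- move=> v; rewrite in_setU => /orP[vZ|vF] vW; first by rewrite updZ // nZ.
  by rewrite updF //; have := gU v vF; rewrite in_setU negb_or => /andP[].
- move=> v; rewrite in_setU => /orP[vZ|vF] vW w wW tvw; rewrite in_setU.
    by rewrite (fZ v vZ vW w wW tvw).
  by move: vF; rewrite !inE wW tvw vW /= => ->; rewrite orbT.
- move=> w wW nwr; rewrite in_setU => /orP[pwZ|pwF] pwW; first by rewrite updZ // retZ.
  have tpw : top (p w) = u by move: pwF; rewrite !inE => /andP[_ /eqP].
  have ph0 : phase u = 0.
    rewrite /phase (negPf uW) tu /=.
    suff -> : child u by [].
    by apply/exists_inP; exists w => //; rewrite nwr pwW tpw eqxx.
  rewrite updF //; apply: retX => //; apply: (subsetP sX).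
  (* Both [w] and the seed [p u] are in the first class, so [p w] and the top [u] have equal parity.
     Hence [p w] is placed in [X], whose vertices have [cap] neighbours in [A]. *)
  have := sg _ pwF; have [Aw Au] := seeds_A wW nwr pwW.
  rewrite tpw in Au; move: Aw Au; rewrite (in_class_parent dp c nwr).
  move: (in_class_parent dp c nur); rewrite /in_class.
  by case: (odd (d (p w))); case: (odd (d u)); case: (odd (d (p u))); case: c.
have -> : f' @: ((Z :|: F) :\: W) = U :|: (g @: F0 :|: g @: F1).
  apply/setP => y; apply/imsetP/idP => [[v]|].
    rewrite in_setD in_setU => /andP[vW /orP[vZ|vF]] ->.
      by rewrite updZ // in_setU imset_f // inE vW.
    rewrite updF // !in_setU; have [Ev|nEv] := boolP (odd (d v) == odd (d u)).
      by rewrite [g v \in g @: F0]imset_f ?orbT // inE vF.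
    by rewrite [g v \in g @: F1]imset_f ?orbT // inE vF.
  rewrite !in_setU => /or3P[] /imsetP[v].
  - by rewrite inE => /andP[vW vZ] ->; exists v; rewrite ?updZ // !inE vZ vW.
  - rewrite inE => /andP[vF _] ->; exists v; rewrite ?updF // in_setD in_setU vF orbT.
    by move: vF; rewrite !inE => /andP[->].
  - rewrite inE => /andP[vF _] ->; exists v; rewrite ?updF // in_setD in_setU vF orbT.
    by move: vF; rewrite !inE => /andP[->].
apply: stX.
- apply/subsetP => y /imsetP[v]; rewrite inE => /andP[vF Ev] ->.
  by apply: (subsetP sX); have := sg v vF; rewrite Ev.
- apply/subsetP => y /imsetP[v]; rewrite inE => /andP[vF Ev] ->.
  by apply: (subsetP sY); have := sg v vF; rewrite (negPf Ev).
- apply: card_in_imset => v w; rewrite [in X in X -> _]inE => /andP[vF _].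
  by rewrite inE => /andP[wF _]; apply: ig.
- apply: card_in_imset => v w; rewrite [in X in X -> _]inE => /andP[vF _].
  by rewrite inE => /andP[wF _]; apply: ig.
Qed.

Lemma embed_decomposed :
  St set0 #|[set u in ~: W | child (top u)]|
          #|[set u in ~: W | ~~ child (top u) && ~~ is_A (p (top u))]|
          #|[set u in ~: W | ~~ child (top u) && is_A (p (top u))]| ->
  exists f : T -> V, injective f /\ forall u, u != r -> e (f (p u)) (f u).
Proof.
move=> st0.
suff H n : n < #|T| -> exists Z f, partial_embedding Z f /\ n < #|Z|.
  have T0 : 0 < #|T| by apply/card_gt0P; exists r.
  have [Z [f [peZ ltZ]]] := H #|T|.-1 ltac:(lia).
  have ZT u : u \in Z.
    suff -> : Z = [set: T] by rewrite inE.
    by apply/eqP; rewrite eqEcard subsetT cardsT; lia.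
  by exists f; split=> [u v|u]; [apply: (pe_inj peZ) | apply: (pe_edge peZ)].
elim: n => [|n IHn] ltn.
  have [y yAB] : exists y, y \in if is_A r then A else B.
    case: ifP => // _; have [a aA] := a0.
    have : 0 < deg_in e a B.
      apply: leq_trans (degA aA); apply: leq_trans W_cap.
      by apply/card_gt0P; exists r.
    by move=> /card_gt0P[b]; rewrite inE => /andP[bB _]; exists b.
  exists [set r], (fun=> y); rewrite cards1; split=> //; split.
  - by rewrite inE.
  - by move=> u /set1P->; rewrite pr inE.
  - by move=> u /set1P->; rewrite eqxx.
  - by move=> u v /set1P-> /set1P->.
  - by move=> u /set1P->.
  - by move=> u /set1P->; rewrite rW.
  - by move=> u /set1P->; rewrite rW.
  - by move=> w _ _ /set1P->; rewrite rW.
  have -> : [set r] :\: W = set0 by apply/eqP; rewrite setD_eq0 sub1set.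
  rewrite imset0; have rest0 i : rest [set r] i = #|[set u in ~: W | phase u == i]|.
    by apply: eq_card => u; rewrite !inE; case: eqP => // ->; rewrite rW.
  rewrite !rest0; move: st0; congr (St _ _ _ _); apply: eq_card => u; rewrite !inE /phase;
    by case: (u \in W) => //=; case: (child _) => //=; case: (is_A _).
have [Z [f [peZ ltZ]]] := IHn (ltnW ltn).
have [lt|le] := ltnP n.+1 #|Z|; first by exists Z, f.
have [u0 u0Z] : exists u, u \in ~: Z.
  apply/set0Pn; apply: contraTneq ltn => E; rewrite -leqNgt.
  by apply: leq_trans le; rewrite -cardsT -(setUCr Z) E setU0.
(* [key] orders the vertices by phase and then by depth. A missing vertex of least key has its
   parent embedded and all earlier phases complete. *)
pose M := (\max_v d v).+1; pose key u := phase u * M + d u.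
have dM u : d u < M by rewrite ltnS; apply: (leq_bigmax u).
case: (arg_minnP key u0Z) => u /setCP/negP uZ umin.
have nur : u != r by apply: contraNneq uZ => ->; apply: pe_root peZ.
have keyZ v : key v < key u -> v \in Z.
  rewrite ltnNge; apply: contraR => vZ; have vC : v \in ~: Z by rewrite inE.
  exact: umin vC.
have puZ : p u \in Z.
  apply: keyZ; rewrite /key (dp nur) addnS ltnS leq_add2r leq_mul2r.
  by rewrite phase_parent // orbT.
suff [Z' [f' [peZ' pZ]]] : exists Z' f', partial_embedding Z' f' /\ Z \proper Z'.
  by exists Z', f'; split=> //; have := proper_card pZ; lia.
have [uW|uW] := boolP (u \in W).
  have [f' peZ'] := extend_seed peZ uZ uW puZ.
  exists (u |: Z), f'; split=> //.
  by apply/properP; split; [apply: subsetUr | exists u; rewrite // setU11].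
apply: (extend_piece peZ uZ uW puZ) => i lti.
apply/eqP; rewrite cards_eq0; apply/eqP/setP => v; rewrite !inE.
apply/negP => /and3P[_ /negP vZ /eqP phv]; apply: vZ; apply: keyZ.
by rewrite /key phv; have := dM v; nia.
Qed.

End Embedding.

Lemma embed_tree (V : finType) (e : rel V) (T : finType) (r : T) (p : T -> T)
    (d : T -> nat) l cap (A B : {set V}) :
  p r = r -> d r = 0 -> (forall x, x != r -> d x = (d (p x)).+1) ->
  symmetric e -> 0 < l -> 3 * (#|T| + l) <= cap * l ->
  (exists a, a \in A) ->
  {in A, forall a, cap <= deg_in e a B} -> {in B, forall b, cap <= deg_in e b A} ->
  (forall t0 t1 t2, t0 + t1 + t2 <= #|T| -> t0 + 2 * t1 <= #|T| ->
    exists St, strategy e l cap A B St /\ St set0 t0 t1 t2) ->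
  exists f : T -> V, injective f /\ forall u, u != r -> e (f (p u)) (f u).
Proof.
move=> pr dr dp se l0 hcap a0 degA degB hSt.
have [W [c [rW cW pW sA vol]]] := tree_decomposition pr dr dp l0.
have Wcap : #|W| <= cap.
  by rewrite -(@leq_pmul2r l) //; apply: leq_trans hcap.
pose I0 := [set u in ~: W | has_child_seed r p d W (piece_top p d W u)].
pose I1 := [set u in ~: W | ~~ has_child_seed r p d W (piece_top p d W u)
                          && ~~ in_class d c (p (piece_top p d W u))].
pose I2 := [set u in ~: W | ~~ has_child_seed r p d W (piece_top p d W u)
                          && in_class d c (p (piece_top p d W u))].
have [||St [strat st]] := hSt #|I0| #|I1| #|I2|.
- have d1 : #|I1| + #|I2| <= #|~: I0|.
    have -> : #|I1| + #|I2| = #|I1 :|: I2|.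
      rewrite cardsU; suff -> : I1 :&: I2 = set0 by rewrite cards0 subn0.
      apply/setP => u; rewrite !inE.
      by case: (in_class _ _ _); rewrite !andbF.
    apply/subset_leq_card/subsetP => u; rewrite !inE negb_and.
    by case: (has_child_seed _ _ _ _ _); rewrite ?andbF ?orbT.
  by rewrite -(cardsC I0) -addnA leq_add2l.
- apply: leq_trans vol; rewrite leq_add2l leq_mul2l /=.
  by apply/subset_leq_card/subsetP => u; rewrite !inE => /and3P[-> _ ->].
exact: (embed_decomposed pr dr dp se rW Wcap pW sA a0 degA degB strat st).
Qed.

(** * Filling matched pairs of clusters *)

(* Repeatedly dropping the element with the worst ratio [be p / al p] keeps the
   ratio of the sums at most the initial one. *)
Lemma split_weights (P : finType) (S : {set P}) (al be : P -> nat) w t :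
  {in S, forall p, al p <= w} -> t <= \sum_(p in S) al p ->
  exists2 S1 : {set P}, S1 \subset S & t <= \sum_(p in S1) al p /\
    (\sum_(p in S1) be p) * (\sum_(p in S) al p)
      <= (\sum_(p in S) be p) * (t + w).
Proof.
move=> alw tS; pose a (Q : {set P}) := \sum_(p in Q) al p.
pose b (Q : {set P}) := \sum_(p in Q) be p.
rewrite -/(a S) -/(b S).
pose ok (Q : {set P}) := [&& Q \subset S, t <= a Q & b Q * a S <= b S * a Q].
have okS : ok S by rewrite /ok subxx tS leqnn.
case: (arg_minnP (fun Q : {set P} => #|Q|) okS) => Q /and3P[sQ tQ rQ] Qmin.
exists Q => //; split=> //; rewrite -/(a Q) -/(b Q).
have [leQ|ltQ] := leqP (a Q) (t + w).
  by apply: leq_trans rQ _; rewrite leq_mul2l leQ orbT.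
(* Averaging: the ratio [be / al] cannot be below that of the sums for every element of [Q]. *)
have [p pQ hp] : exists2 p, p \in Q & b Q * al p <= be p * a Q.
  apply/exists_inP; rewrite -[X in is_true X]negbK; apply/negP => /exists_inPn H.
  have [Q0|[q qQ]] := set_0Vmem Q; first by rewrite /a Q0 big_set0 in ltQ.
  have : \sum_(p in Q) be p * a Q < \sum_(p in Q) b Q * al p.
    rewrite (bigD1 q) //= [X in _ < X](bigD1 q) //= -addSn; apply: leq_add.
      by have := H q qQ; rewrite -ltnNge.
    by apply: leq_sum => p /andP[pQ _]; have := H p pQ; rewrite -ltnNge => /ltnW.
  by rewrite -big_distrl -big_distrr /= ltnn.
have aQ : a Q = al p + a (Q :\ p) by rewrite /a (big_setD1 p).
have bQ : b Q = be p + b (Q :\ p) by rewrite /b (big_setD1 p).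
have alp := alw p (subsetP sQ p pQ).
have okQ : ok (Q :\ p).
  rewrite /ok (subset_trans (subsetDl _ _) sQ) /=; apply/andP; split.
    by rewrite aQ in ltQ; lia.
  have aQ0 : 0 < a Q by apply: leq_trans ltQ.
  rewrite -(leq_pmul2r aQ0) mulnAC -[X in _ <= X]mulnA.
  apply: (@leq_trans (b Q * a (Q :\ p) * a S)).
    rewrite leq_mul2r; apply/orP; right; rewrite aQ bQ in hp *; nia.
  by rewrite mulnAC [a (Q :\ p) * _]mulnC mulnA leq_mul2r rQ orbT.
by have := Qmin _ okQ; rewrite (cardsD1 p Q) pQ ltnn.
Qed.

(* While the two sides of a pair are not nearly filled up to the smaller of the
   capacities [gt] and [gf], their loads [ut] and [uf] are kept balanced. *)
Definition balanced l w gt gf ut uf :=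
  ut <= uf + l /\ uf <= ut + l \/
  minn gt gf <= ut + w /\ minn gt gf <= uf + w.

(** A piece can be placed in two orientations. While the loads are within [l] of each other, putting
    its larger part on the lighter side keeps them so. If this finds too little room, both loads are
    within [om + l] of the smaller capacity, and the bound on the total load leaves room for the
    other orientation. *)
Lemma balanced_step l om s gt gf ut uf f0 f1 :
  gt <= s -> gf <= s -> balanced l (om + l) gt gf ut uf ->
  ut + uf + (2 * om + l) < gt + gf -> f0 + f1 <= l ->
  [/\ ut + om <= gt, uf + om <= s & balanced l (om + l) gt gf (ut + f0) (uf + f1)] \/
  [/\ uf + om <= gf, ut + om <= s & balanced l (om + l) gt gf (ut + f1) (uf + f0)].
Proof.
move=> h1 h2 h3 h4 h5.
suff: (ut + om <= gt /\ uf + om <= s /\ balanced l (om + l) gt gf (ut + f0) (uf + f1)) \/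
      (uf + om <= gf /\ ut + om <= s /\ balanced l (om + l) gt gf (ut + f1) (uf + f0)).
  by case=> -[? [? ?]]; [left | right].
by move: h3; rewrite /balanced; lia.
Qed.

Section Pairs.
Variables (V : finType) (e : rel V).
Variables (P : finType) (side : P -> bool -> {set V}) (PS : {set P}).
Variables (l om s : nat) (F : {set V}).
Implicit Types (U X Y N : {set V}) (p q : P) (Q : {set P}).

Definition dense_pair (C D : {set V}) := forall X Y,
  X \subset C -> Y \subset D -> om <= #|X| -> om <= #|Y| ->
  l * (#|X| + #|Y|) < edge_count e X Y.

Hypothesis side_card : {in PS, forall p b, #|side p b| = s}.
Hypothesis side_disj : {in PS &, forall p q b c, (p, b) != (q, c) ->
  [disjoint side p b & side q c]}.
Hypothesis sideF : {in PS, forall p b, [disjoint side p b & F]}.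
Hypothesis side_dense : {in PS, forall p b, dense_pair (side p b) (side p (~~ b))}.

Definition load U p b := #|U :&: side p b|.
Definition total_load Q U := \sum_(p in Q) (load U p true + load U p false).

Lemma loadU U X p b : [disjoint X & U] ->
  load (U :|: X) p b = load U p b + #|X :&: side p b|.
Proof.
move=> dXU; rewrite /load setIUl cardsU.
suff -> : (U :&: side p b) :&: (X :&: side p b) = set0 by rewrite cards0 subn0.
apply/setP => x; rewrite !inE; apply/negP => /andP[/andP[xU _] /andP[xX _]].
by have := disjointFr dXU xX; rewrite xU.
Qed.

Lemma total_load_le Q U : Q \subset PS -> total_load Q U <= #|U|.
Proof.
move=> sQ; rewrite /total_load.
have -> : \sum_(p in Q) (load U p true + load U p false) =
    \sum_(i in setX Q [set: bool]) #|U :&: side i.1 i.2|.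
  rewrite (eq_bigl (fun i : P * bool => (i.1 \in Q) && (i.2 \in predT))); last first.
    by move=> i; rewrite !inE.
  rewrite -(pair_big (mem Q) predT (fun p b => #|U :&: side p b|)) /=.
  by apply: eq_bigr => p _; rewrite big_bool.
apply: sum_setI_le => -[p b] [q c]; rewrite !inE !andbT /= => pQ qQ ne.
by apply: side_disj; rewrite ?(subsetP sQ).
Qed.

(** Only the side that receives the top of the piece is restricted to the neighbourhood [N]; on the
    opposite side all free vertices are available. *)
Lemma place_pair U N p b f0 f1 al :
  p \in PS -> al <= #|N :&: side p b| ->
  load U p b + om <= al -> load U p (~~ b) + om <= s ->
  exists X Y, [/\ site e l (U :|: F) X Y, X \subset N &
    forall X0 Y0, X0 \subset X -> Y0 \subset Y -> #|X0| = f0 -> #|Y0| = f1 ->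
    [/\ load (U :|: (X0 :|: Y0)) p b = load U p b + f0,
        load (U :|: (X0 :|: Y0)) p (~~ b) = load U p (~~ b) + f1,
        {in PS, forall q, q != p -> forall c, load (U :|: (X0 :|: Y0)) q c = load U q c},
        (X0 :|: Y0) \subset side p b :|: side p (~~ b) &
        #|U :|: (X0 :|: Y0)| = #|U| + f0 + f1]].
Proof.
move=> pS hal h0 h1; pose X := (N :&: side p b) :\: U; pose Y := side p (~~ b) :\: U.
have dXs : X \subset side p b by apply: subset_trans (subsetDl _ _) (subsetIr _ _).
have dYs : Y \subset side p (~~ b) by apply: subsetDl.
have dS : [disjoint side p b & side p (~~ b)].
  by apply: side_disj => //; rewrite xpair_eqE eqxx; case: b {h0 h1 hal X Y dXs dYs}.
have dXY : [disjoint X & Y] by apply: disjointWl dXs _; apply: disjointWr dYs _.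
have dXU : [disjoint X & U].
  by rewrite -setI_eq0; apply/eqP/setP => x; rewrite !inE; case: (x \in U); rewrite ?andbF.
have dYU : [disjoint Y & U].
  by rewrite -setI_eq0; apply/eqP/setP => x; rewrite !inE; case: (x \in U); rewrite ?andbF.
have cX : om <= #|X|.
  rewrite /X cardsD; have : #|N :&: side p b :&: U| <= load U p b.
    by apply: subset_leq_card; apply/subsetP => x; rewrite !inE => /andP[/andP[_ ->] ->].
  lia.
have cY : om <= #|Y|.
  rewrite /Y cardsD setIC -/(load U p (~~ b)) side_card //; lia.
have dUF (Z : {set V}) c : Z \subset side p c -> [disjoint Z & U] -> [disjoint Z & U :|: F].
  by move=> sZ dZ; rewrite disjoint_sym disjoint_setUl disjoint_sym dZ /= disjoint_sym; apply: disjointWl sZ _; apply: sideF.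
exists X, Y; split.
- split=> //; [exact: dUF dXs dXU | exact: dUF dYs dYU | exact: (@side_dense p pS b X Y)].
- by apply: subset_trans (subsetDl _ _) (subsetIl _ _).
move=> X0 Y0 sX sY cX0 cY0.
have sX0 := subset_trans sX dXs; have sY0 := subset_trans sY dYs.
have dXY0 : [disjoint X0 & Y0] by apply: disjointWl sX _; apply: disjointWr sY _.
have dXYU : [disjoint X0 :|: Y0 & U].
  by rewrite disjoint_setUl (disjointWl sX dXU) (disjointWl sY dYU).
have inter q c : (X0 :|: Y0) :&: side q c = (X0 :&: side q c) :|: (Y0 :&: side q c).
  by rewrite setIUl.
have int0 (Z : {set V}) q c q' c' : q \in PS -> q' \in PS -> (q, c) != (q', c') ->
    Z \subset side q c -> Z :&: side q' c' = set0.
  by move=> qS q'S ne sZ; apply/eqP; rewrite setI_eq0; apply: disjointWl sZ _; apply: side_disj.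
have nb c : (p, c) != (p, ~~ c) by rewrite xpair_eqE eqxx; case: c.
have nb' c : (p, ~~ c) != (p, c) by rewrite xpair_eqE eqxx; case: c.
split.
- by rewrite loadU // inter (setIidPl sX0) (int0 _ p (~~ b) p b) // setU0 cX0.
- by rewrite loadU // inter (setIidPl sY0) (int0 _ p b p (~~ b)) // set0U cY0.
- move=> q qS nqp c; rewrite loadU // inter.
  have ne c' : (p, c') != (q, c) by rewrite xpair_eqE eq_sym (negPf nqp).
  by rewrite (int0 _ p b) // (int0 _ p (~~ b)) // setU0 cards0 addn0.
- exact: setUSS.
have e1 : U :&: (X0 :|: Y0) = set0 by apply/eqP; rewrite setIC setI_eq0.
have e2 : X0 :&: Y0 = set0 by apply/eqP; rewrite setI_eq0.
by rewrite cardsU e1 cards0 subn0 cardsU e2 cards0 subn0 cX0 cY0 addnA.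
Qed.

Definition grows Q U U' f :=
  [/\ total_load Q U' = total_load Q U + f,
      {in PS, forall q, q \notin Q -> forall c, load U' q c = load U q c},
      U' :\: U \subset \bigcup_(p in Q) (side p true :|: side p false) &
      #|U'| = #|U| + f].

Lemma grows_total Q Q' U U' f : grows Q U U' f -> Q' \subset PS ->
  [disjoint Q' & Q] -> total_load Q' U' = total_load Q' U.
Proof.
move=> [_ H _ _] sQ' dQ; apply: eq_bigr => q qQ'.
by rewrite !H ?(subsetP sQ') // (disjointFr dQ qQ').
Qed.

Lemma place_grows Q U p b f0 f1 X0 Y0 : p \in Q -> Q \subset PS ->
  [/\ load (U :|: (X0 :|: Y0)) p b = load U p b + f0,
        load (U :|: (X0 :|: Y0)) p (~~ b) = load U p (~~ b) + f1,
        {in PS, forall q, q != p -> forall c, load (U :|: (X0 :|: Y0)) q c = load U q c},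
        (X0 :|: Y0) \subset side p b :|: side p (~~ b) &
        #|U :|: (X0 :|: Y0)| = #|U| + f0 + f1] ->
  grows Q U (U :|: (X0 :|: Y0)) (f0 + f1).
Proof.
move=> pQ sQ [h0 h1 hq sXY hU]; split.
- rewrite /total_load (bigD1 p) //= [in RHS](bigD1 p) //=.
  rewrite (eq_bigr (fun i => load U i true + load U i false)); last first.
    by move=> q /andP[qQ nqp]; rewrite !hq ?(subsetP sQ).
  by case: b h0 h1 {sXY} => /= -> ->; lia.
- by move=> q qS nqQ c; apply: hq => //; apply: contraNneq nqQ => ->.
- rewrite setDUl setDv set0U; apply: subset_trans (subsetDl _ _) _.
  apply: subset_trans sXY _; apply: subset_trans (bigcup_sup p pQ).
  by case: b {h0 h1}; rewrite // setUC.
- by rewrite hU addnA.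
Qed.

Lemma place_balanced Q U N ga f0 f1 :
  Q \subset PS -> {in Q, forall p b, ga p b <= #|N :&: side p b|} ->
  {in Q, forall p, balanced l (om + l) (ga p true) (ga p false)
                     (load U p true) (load U p false)} ->
  total_load Q U + #|Q| * (2 * om + l) < \sum_(p in Q) (ga p true + ga p false) ->
  f0 + f1 <= l ->
  exists X Y, [/\ site e l (U :|: F) X Y, X \subset N &
    forall X0 Y0, X0 \subset X -> Y0 \subset Y -> #|X0| = f0 -> #|Y0| = f1 ->
      grows Q U (U :|: (X0 :|: Y0)) (f0 + f1) /\
      {in Q, forall p, balanced l (om + l) (ga p true) (ga p false)
         (load (U :|: (X0 :|: Y0)) p true) (load (U :|: (X0 :|: Y0)) p false)}].
Proof.
move=> sQ gaN balQ room fl.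
have [p pQ hp] : exists2 p, p \in Q &
    load U p true + load U p false + (2 * om + l) < ga p true + ga p false.
  apply/exists_inP; apply: contraLR room => /exists_inPn H; rewrite -leqNgt.
  rewrite /total_load -sum_nat_const -big_split /=; apply: leq_sum => p pQ.
  by rewrite leqNgt H.
have pS := subsetP sQ p pQ.
have gs b : ga p b <= s.
  by apply: leq_trans (gaN p pQ b) _; rewrite -(side_card pS b); apply: subset_leq_card; apply: subsetIr.
have [[h0 h1 h2]|[h0 h1 h2]] := balanced_step (gs true) (gs false) (balQ p pQ) hp fl.
- have [X [Y [sXY sX place]]] := place_pair f0 f1 pS (gaN p pQ true) h0 h1.
  exists X, Y; split=> // X0 Y0 X0s Y0s cX cY.
  have H := place X0 Y0 X0s Y0s cX cY; split; first exact: place_grows H.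
  case: H => e0 e1 eq _ _ q qQ; have [->|nqp] := eqVneq q p; first by rewrite e0 e1.
  by rewrite !eq ?(subsetP sQ) //; apply: balQ.
- have [X [Y [sXY sX place]]] := place_pair f0 f1 pS (gaN p pQ false) h0 h1.
  exists X, Y; split=> // X0 Y0 X0s Y0s cX cY.
  have H := place X0 Y0 X0s Y0s cX cY; split; first exact: place_grows H.
  case: H => e0 e1 eq _ _ q qQ; have [->|nqp] := eqVneq q p; first by rewrite e0 e1.
  by rewrite !eq ?(subsetP sQ) //; apply: balQ.
Qed.

(** Some pair has a total load below [ga p - om]. As [ga p <= s], this leaves room on both of its
    sides at once, so comparing total loads takes the place of balancing. *)
Lemma place_one_sided Q U N ga f0 f1 :
  Q \subset PS -> {in Q, forall p, ga p <= #|N :&: side p true|} ->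
  total_load Q U + #|Q| * om < \sum_(p in Q) ga p ->
  exists X Y, [/\ site e l (U :|: F) X Y, X \subset N &
    forall X0 Y0, X0 \subset X -> Y0 \subset Y -> #|X0| = f0 -> #|Y0| = f1 ->
      grows Q U (U :|: (X0 :|: Y0)) (f0 + f1)].
Proof.
move=> sQ gaN room.
have [p pQ hp] : exists2 p, p \in Q & load U p true + load U p false + om < ga p.
  apply/exists_inP; apply: contraLR room => /exists_inPn H; rewrite -leqNgt.
  rewrite /total_load -sum_nat_const -big_split /=; apply: leq_sum => p pQ.
  by rewrite leqNgt H.
have pS := subsetP sQ p pQ.
have gs : ga p <= s.
  by apply: leq_trans (gaN p pQ) _; rewrite -(side_card pS true); apply: subset_leq_card; apply: subsetIr.
have h0 : load U p true + om <= ga p by lia.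
have h1 : load U p (~~ true) + om <= s by rewrite /=; lia.
have [X [Y [sXY sX place]]] := place_pair f0 f1 pS (gaN p pQ) h0 h1.
exists X, Y; split=> // X0 Y0 X0s Y0s cX cY.
exact: place_grows (place X0 Y0 X0s Y0s cX cY).
Qed.

End Pairs.

(** Here [a] is the room of [A], [bM] and [bE] the room of [B] inside and outside the pairs, and
    [b1] the part of it given away to the pieces of [A]. Since [b1 <= bM * tau / a], what remains
    satisfies [c * (b2 + bE) >= K * (1 - tau / a) >= K - tau]. The factor [c] is 2 when [B] sees
    only half of the room. *)
Lemma split_room c a bM bE b1 b2 K tau x :
  K <= a -> K <= c * (bM + bE) -> bM = b1 + b2 -> b1 * a <= bM * tau ->
  tau + c * x < K -> x < b2 + bE.
Proof.
move=> Ka + e1; rewrite {bM}e1 => Kb h1 h2; rewrite ltnNge; apply/negP => le.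
have h3 : c * (b1 + b2 + bE) * a <= c * (b1 + b2 + bE) * tau + c * x * a.
  have : c * (b1 * a) <= c * ((b1 + b2) * tau) by rewrite leq_mul2l h1 orbT.
  have : c * ((b2 + bE) * a) <= c * (x * a) by rewrite leq_mul2l leq_mul2r le !orbT.
  nia.
have h4 : K * (a - tau) <= c * (b1 + b2 + bE) * (a - tau) by rewrite leq_mul2r Kb orbT.
have h6 : a * (K - tau) <= K * (a - tau) by rewrite !mulnBr; nia.
have h7 : a * (K - tau) <= a * (c * x) by rewrite [a * (c * x)]mulnC; lia.
by rewrite leq_pmul2l in h7; lia.
Qed.

(** * The two embedding strategies *)

Section Strategies.
Variables (V : finType) (e : rel V).
Variables (P : finType) (side : P -> bool -> {set V}) (PS : {set P}).
Variables (l om s cap : nat) (A B : {set V}).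
Hypothesis side_card : {in PS, forall p b, #|side p b| = s}.
Hypothesis side_disj : {in PS &, forall p q b c, (p, b) != (q, c) ->
  [disjoint side p b & side q c]}.
Hypothesis sideF : {in PS, forall p b, [disjoint side p b & A :|: B]}.
Hypothesis side_dense : {in PS, forall p b, dense_pair e l om (side p b) (side p (~~ b))}.
Hypothesis a0 : exists a, a \in A.

Variable D : nat.
Hypothesis PS_D : #|PS| * (2 * om + l) <= D.
Implicit Types U X Y : {set V}.

(** The degree condition lets a piece that starts in [NA a] lead back to a seed in [A]. *)
Let NA a := [set x | e a x & cap <= deg_in e x A].
Let NB b := [set x | e b x].

Lemma load0 p b : load side set0 p b = 0.
Proof. by rewrite /load set0I cards0. Qed.

Lemma total_load0 (Q : {set P}) : total_load side Q set0 = 0.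
Proof. by rewrite /total_load big1 // => p _; rewrite !load0. Qed.

Lemma balanced0 w gt gf : balanced l w gt gf 0 0.
Proof. by left. Qed.

Lemma card_pairs (Q : {set P}) : Q \subset PS -> #|Q| * (2 * om + l) <= D.
Proof.
by move=> sQ; apply: leq_trans PS_D; rewrite leq_mul2r subset_leq_card ?orbT.
Qed.

(** The pairs are divided once and for all: [Q1] serves the pieces hanging at [A], [Q2] those
    hanging at [B]. [Q1] is just large enough for its pieces and takes about a proportional share of
    the room of [B], so [Q2] suffices for the rest. Both parts are filled in a balanced way. *)
Lemma strategy_covered (al be : P -> bool -> nat) K m t0 t1 t2 :
  {in A, forall a, {in PS, forall p b, al p b <= #|NA a :&: side p b|}} ->
  {in B, forall y, {in PS, forall p b, be p b <= #|NB y :&: side p b|}} ->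
  K <= \sum_(p in PS) (al p true + al p false) ->
  K <= \sum_(p in PS) (be p true + be p false) ->
  m + 2 * D + 2 * s + 2 <= K ->
  t0 + t1 + t2 <= m ->
  exists St, strategy e l cap A B St /\ St set0 t0 t1 t2.
Proof.
move=> hal hbe Kal Kbe hK ht.
pose t := t0 + t2 + D + 1.
have als : {in PS, forall p, al p true + al p false <= 2 * s}.
  move=> p pS; have [a aA] := a0.
  have le b : al p b <= s.
    apply: leq_trans (hal a aA p pS b) _; rewrite -(side_card pS b).
    exact: subset_leq_card (subsetIr _ _).
  by have := le true; have := le false; lia.
have [|Q1 sQ1 [tQ1 rQ1]] := @split_weights _ PS (fun p => al p true + al p false)
    (fun p => be p true + be p false) (2 * s) t als; first by rewrite /t; lia.
pose Q2 := PS :\: Q1; have sQ2 : Q2 \subset PS by apply: subsetDl.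
have dQ : [disjoint Q2 & Q1].
  by rewrite -setI_eq0; apply/eqP/setP => p; rewrite !inE; case: (p \in Q1); rewrite ?andbF.
have roomB : t1 + D < \sum_(p in Q2) (be p true + be p false).
  rewrite -[X in _ < X]addn0.
  apply: (@split_room 1 (\sum_(p in PS) (al p true + al p false)) (\sum_(p in PS) (be p true + be p false)) 0
            (\sum_(p in Q1) (be p true + be p false)) _ K (t + 2 * s)) => //.
  - by rewrite mul1n addn0.
  - by rewrite (big_setID Q1) /= (setIidPr sQ1).
  - by rewrite /t; lia.
pose St U r0 r1 r2 :=
  [/\ {in Q1, forall p, balanced l (om + l) (al p true) (al p false)
        (load side U p true) (load side U p false)},
      {in Q2, forall p, balanced l (om + l) (be p true) (be p false)
        (load side U p true) (load side U p false)},
      total_load side Q1 U + (r0 + r2) <= t0 + t2 &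
      total_load side Q2 U + r1 <= t1].
have stepA U f0 f1 r1 rA a : 0 < f0 + f1 <= l ->
    [/\ {in Q1, forall p, balanced l (om + l) (al p true) (al p false)
          (load side U p true) (load side U p false)},
        {in Q2, forall p, balanced l (om + l) (be p true) (be p false)
          (load side U p true) (load side U p false)},
        total_load side Q1 U + (f0 + f1 + rA) <= t0 + t2 &
        total_load side Q2 U + r1 <= t1] -> a \in A ->
    exists X Y, [/\ site e l (U :|: (A :|: B)) X Y, X \subset NA a &
      forall X0 Y0, X0 \subset X -> Y0 \subset Y -> #|X0| = f0 -> #|Y0| = f1 ->
      forall r0 r2, r0 + r2 = rA -> St (U :|: (X0 :|: Y0)) r0 r1 r2].
  move=> /andP[_ fl] [b1 b2 l1 l2] aA.
  have [||X [Y [sXY sX place]]] := place_balanced (F := A :|: B) (N := NA a) (ga := al)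
      (f0 := f0) (f1 := f1) (U := U) side_card side_disj sideF side_dense sQ1 _ b1 _ fl.
  - by move=> p pQ b; apply: hal => //; apply: (subsetP sQ1).
  - by move: tQ1 (card_pairs sQ1); rewrite /t; lia.
  exists X, Y; split=> // X0 Y0 sX0 sY0 cX cY r0 r2 er.
  have [gr b1'] := place X0 Y0 sX0 sY0 cX cY; split=> //.
  - move=> p pQ; have pS := subsetP sQ2 p pQ; case: gr => _ H _ _.
    by rewrite !H ?(disjointFr dQ pQ) //; apply: b2.
  - by case: gr => -> _ _ _; lia.
  - by rewrite (grows_total gr sQ2 dQ).
exists St; split; last first.
  by split; rewrite ?total_load0 //; move=> p _; rewrite !load0; apply: balanced0.
split.
- move=> U f0 f1 r0 r1 r2 a fl [b1 b2 l1 l2] aA.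
  have [|X [Y [h1 h2 h3]]] := stepA U f0 f1 r1 (r0 + r2) a fl _ aA.
    by split=> //; lia.
  exists X, Y; split=> // [x /(subsetP h2)|X0 Y0 sX sY cX cY]; first by rewrite inE => /andP[].
  exact: h3.
- move=> U f0 f1 r1 r2 b /andP[_ fl] [b1 b2 l1 l2] bB.
  have [||X [Y [sXY sX place]]] := place_balanced (F := A :|: B) (N := NB b) (ga := be)
      (f0 := f0) (f1 := f1) (U := U) side_card side_disj sideF side_dense sQ2 _ b2 _ fl.
  + by move=> p pQ c; apply: hbe => //; apply: (subsetP sQ2).
  + by move: roomB (card_pairs sQ2); lia.
  exists X, Y; split=> // [x /(subsetP sX)|X0 Y0 sX0 sY0 cX cY]; first by rewrite inE.
  have [gr b2'] := place X0 Y0 sX0 sY0 cX cY; split=> //.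
  + move=> p pQ; have pS := subsetP sQ1 p pQ; case: gr => _ H _ _.
    by rewrite !H ?(disjointFl dQ pQ) //; apply: b1.
  + by rewrite (grows_total gr sQ1) // disjoint_sym.
  + by case: gr => -> _ _ _; lia.
- move=> U f0 f1 r2 a fl [b1 b2 l1 l2] aA.
  have [|X [Y [h1 h2 h3]]] := stepA U f0 f1 0 r2 a fl _ aA; first by split=> //; lia.
  exists X, Y; split=> // [x /(subsetP h2)|X0 Y0 sX sY cX cY]; first by rewrite inE => /andP[].
  exact: h3.
Qed.

(** Only the pieces with further seeds get reserved pairs [Q1]. Those hanging at [B] fill [Q2] in a
    balanced way and then overflow into the clusters [E j]; [t0 + 2 * t1 <= m] makes up for [B]
    seeing half of the room. The remaining pieces come last and may use every pair: the room that
    [A] sees exceeds [m], so some pair always has space. *)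
Lemma strategy_one_sided (al : P -> nat) (be : P -> bool -> nat)
    (J : finType) (ES : {set J}) (E : J -> {set V}) (gE : J -> nat) K m t0 t1 t2 :
  {in A, forall a, {in PS, forall p, al p <= #|NA a :&: side p true|}} ->
  {in B, forall y, {in PS, forall p b, be p b <= #|NB y :&: side p b|}} ->
  {in B, forall y, {in ES, forall j, gE j <= #|NB y :&: E j|}} ->
  {in ES &, forall i j, i != j -> [disjoint E i & E j]} ->
  {in ES & PS, forall j p b, [disjoint E j & side p b]} ->
  {in ES, forall j, [disjoint E j & A :|: B]} ->
  {in ES, forall j (U : {set V}), #|U| <= m ->
    exists Y, [/\ [disjoint Y & U :|: (A :|: B)], [disjoint E j & Y] &
      forall X, X \subset E j -> om <= #|X| -> l * (#|X| + #|Y|) < edge_count e X Y]} ->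
  K <= \sum_(p in PS) al p ->
  K <= 2 * (\sum_(p in PS) (be p true + be p false) + \sum_(j in ES) gE j) ->
  m + 3 * D + 2 * (#|ES| * om) + s + 2 <= K ->
  t0 + t1 + t2 <= m -> t0 + 2 * t1 <= m ->
  exists St, strategy e l cap A B St /\ St set0 t0 t1 t2.
Proof.
move=> hal hbe hgE dE dES dEF room Kal Kbe hK ht ht'.
pose t := t0 + D + 1.
have als : {in PS, forall p, al p <= s}.
  move=> p pS; have [a aA] := a0.
  apply: leq_trans (hal a aA p pS) _; rewrite -(side_card pS true).
  exact: subset_leq_card (subsetIr _ _).
have [|Q1 sQ1 [tQ1 rQ1]] := @split_weights _ PS al
    (fun p => be p true + be p false) s t als; first by rewrite /t; lia.
pose Q2 := PS :\: Q1; have sQ2 : Q2 \subset PS by apply: subsetDl.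
have dQ : [disjoint Q2 & Q1].
  by rewrite -setI_eq0; apply/eqP/setP => p; rewrite !inE; case: (p \in Q1); rewrite ?andbF.
have roomB : t1 + D + #|ES| * om <
    \sum_(p in Q2) (be p true + be p false) + \sum_(j in ES) gE j.
  apply: (@split_room 2 (\sum_(p in PS) al p) (\sum_(p in PS) (be p true + be p false)) _
            (\sum_(p in Q1) (be p true + be p false)) _ K (t + s)) => //.
  - by rewrite (big_setID Q1) /= (setIidPr sQ1).
  - by rewrite /t; lia.
have oms (Q : {set P}) : Q \subset PS -> #|Q| * om <= D.
  move=> sQ; apply: leq_trans (card_pairs sQ); rewrite leq_mul2l; apply/orP; right; lia.
pose bal U := {in Q2, forall p, balanced l (om + l) (be p true) (be p false)
        (load side U p true) (load side U p false)}.
pose noE (U : {set V}) := {in ES, forall j, U :&: E j = set0}.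
(* In [ph1] neither [Q2] nor the clusters [E j] have been touched. The second alternative of [ph2]
   records that [Q2] is full up to the error term, so that from then on only the loads of the [E j]
   are tracked. *)
pose ph1 U r0 r1 r2 := [/\ total_load side Q1 U + r0 <= t0, r1 <= t1,
  {in Q2, forall p b, load side U p b = 0}, noE U & #|U| + r0 + r1 + r2 <= m].
pose ph2 U r1 r2 := #|U| + r1 + r2 <= m /\
  ([/\ bal U, noE U & total_load side Q2 U + r1 <= t1] \/
   \sum_(p in Q2) (be p true + be p false) + \sum_(j in ES) #|U :&: E j| + r1
     <= t1 + #|Q2| * (2 * om + l)).
pose St U r0 r1 r2 := ph1 U r0 r1 r2 \/ r0 = 0 /\ ph2 U r1 r2 \/
  [/\ r0 = 0, r1 = 0 & #|U| + r2 <= m].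
have grow_noE (Q : {set P}) U U' f : Q \subset PS -> grows side PS Q U U' f -> noE U -> noE U'.
  move=> sQ [_ _ sU _] hU j jE; apply/setP => x; rewrite in_set0.
  apply/negP; rewrite inE => /andP[xU' xE].
  have xU : x \notin U.
    by apply/negP => xU; move/setP/(_ x): (hU j jE); rewrite !inE xU xE.
  have /bigcupP[p pQ] : x \in \bigcup_(p in Q) (side p true :|: side p false).
    by apply: (subsetP sU); rewrite inE xU.
  have pS := subsetP sQ p pQ; rewrite inE.
  by rewrite !(disjointFr (dES j p jE pS _) xE).
have step1A U f0 f1 r1 r2 b : f0 + f1 <= l -> b \in B ->
    ph2 U (f0 + f1 + r1) r2 ->
    exists X Y, [/\ site e l (U :|: (A :|: B)) X Y, {in X, forall x, e b x} &
          forall X0 Y0, X0 \subset X -> Y0 \subset Y -> #|X0| = f0 -> #|Y0| = f1 ->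
            ph2 (U :|: (X0 :|: Y0)) r1 r2].
  move=> fl bB [cU ph].
  have [[bU nU lU lt]|full] : [/\ bal U, noE U, total_load side Q2 U + (f0 + f1 + r1) <= t1 &
      total_load side Q2 U + #|Q2| * (2 * om + l) < \sum_(p in Q2) (be p true + be p false)]
   \/ \sum_(p in Q2) (be p true + be p false) + \sum_(j in ES) #|U :&: E j| + (f0 + f1 + r1)
     <= t1 + #|Q2| * (2 * om + l).
  - case: ph => [[bU nU lU]|]; last by right.
    have [le|lt] := leqP (\sum_(p in Q2) (be p true + be p false))
        (total_load side Q2 U + #|Q2| * (2 * om + l)); last by left.
    right; rewrite [X in _ + X + _]big1; first lia.
    by move=> j jE; rewrite nU // cards0.
  - have [||X [Y [sXY sX place]]] := place_balanced (F := A :|: B) (N := NB b) (ga := be)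
      (f0 := f0) (f1 := f1) (U := U) side_card side_disj sideF side_dense sQ2 _ bU _ fl.
    + by move=> p pQ c; apply: hbe => //; apply: (subsetP sQ2).
    + exact: lt.
    exists X, Y; split=> // [x /(subsetP sX)|X0 Y0 sX0 sY0 cX cY]; first by rewrite inE.
    have [gr bU'] := place X0 Y0 sX0 sY0 cX cY; split.
      by case: gr => _ _ _ ->; lia.
    left; split=> //; first exact: grow_noE gr nU.
    by case: gr => -> _ _ _; lia.
  - have [j jE hj] : exists2 j, j \in ES & om <= #|(NB b :&: E j) :\: U|.
      apply/exists_inP; rewrite -[X in is_true X]negbK; apply/negP => /exists_inPn H.
      have : \sum_(j in ES) gE j <= \sum_(j in ES) (#|U :&: E j| + om).
        apply: leq_sum => j jE; apply: leq_trans (hgE b bB j jE) _.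
        have := H j jE; rewrite -ltnNge cardsD.
        have : #|NB b :&: E j :&: U| <= #|U :&: E j|.
          by apply: subset_leq_card; apply/subsetP => x; rewrite !inE => /andP[/andP[_ ->] ->].
        lia.
      rewrite big_split /= sum_nat_const.
      by move: full roomB (card_pairs sQ2); lia.
    have cU' : #|U| <= m by lia.
    have [Y [dY dEY dense]] := room j jE U cU'.
    have sXE : (NB b :&: E j) :\: U \subset E j.
      by apply: subset_trans (subsetDl _ _) (subsetIr _ _).
    exists ((NB b :&: E j) :\: U), Y; split.
    + split=> //.
      * rewrite disjoint_sym disjoint_setUl; apply/andP; split.
          by rewrite -setI_eq0; apply/eqP/setP => x; rewrite !inE; case: (x \in U).
        by rewrite disjoint_sym; apply: disjointWl sXE _; apply: dEF.
      * exact: disjointWl sXE dEY.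
      * exact: dense.
    + by move=> x; rewrite !inE => /andP[_ /andP[]].
    move=> X0 Y0 sX0 sY0 cX cY; have [cXY _] := leq_card_setU X0 Y0.
    split.
      by have [cUU _] := leq_card_setU U (X0 :|: Y0); move: cU cUU cXY; rewrite cX cY; clear; lia.
    right; have : \sum_(i in ES) #|(U :|: (X0 :|: Y0)) :&: E i| <=
        \sum_(i in ES) (#|U :&: E i| + #|(X0 :|: Y0) :&: E i|).
      apply: leq_sum => i _; rewrite setIUl.
      by have [] := leq_card_setU (U :&: E i) ((X0 :|: Y0) :&: E i).
    rewrite big_split /=; have := sum_setI_le (X0 :|: Y0) dE.
    by move: full cXY; rewrite cX cY; clear; lia.
exists St; split; last first.
  left; split; rewrite ?total_load0 ?cards0 //.
  - by move=> p _ b; rewrite load0.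
  - by move=> j _; rewrite set0I.
split.
- move=> U f0 f1 r0 r1 r2 a fl st aA; case: st => [[l1 r1t l2 nU cU]|]; last first.
    by case=> [[]|[]]; lia.
  have [||X [Y [sXY sX place]]] := place_one_sided (F := A :|: B) (N := NA a) (ga := al)
     (U := U) side_card side_disj sideF side_dense f0 f1 sQ1.
  + by move=> p pQ; apply: hal => //; apply: (subsetP sQ1).
  + by move: tQ1 (oms _ sQ1); rewrite /t; lia.
  exists X, Y; split=> // [x /(subsetP sX)|X0 Y0 sX0 sY0 cX cY]; first by rewrite inE => /andP[].
  have gr := place X0 Y0 sX0 sY0 cX cY; left; split=> //.
  + by case: gr => -> _ _ _; lia.
  + move=> p pQ c; have pS := subsetP sQ2 p pQ; case: gr => _ H _ _.
    by rewrite H ?(disjointFr dQ pQ) // l2.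
  + exact: grow_noE gr nU.
  + by case: gr => _ _ _ ->; lia.
- move=> U f0 f1 r1 r2 b /andP[f_gt fl] st bB.
  have [X [Y [h1 h2 h3]]] : exists X Y, [/\ site e l (U :|: (A :|: B)) X Y,
      {in X, forall x, e b x} &
          forall X0 Y0, X0 \subset X -> Y0 \subset Y -> #|X0| = f0 -> #|Y0| = f1 ->
            ph2 (U :|: (X0 :|: Y0)) r1 r2].
    apply: step1A => //; case: st => [[l1 r1t l2 nU cU]|[[_ //]|[]]]; last by lia.
    split; first by lia.
    left; split=> //; first by move=> p pQ; rewrite !l2 //; apply: balanced0.
    by rewrite /total_load big1 // => p pQ; rewrite !l2.
  by exists X, Y; split=> // X0 Y0 sX sY cX cY; right; left; split=> //; apply: h3.
- move=> U f0 f1 r2 a fl st aA.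
  have cU : #|U| + (f0 + f1 + r2) <= m.
    by case: st => [[_ _ _ _]|[[_ []]|[]]]; lia.
  have [||X [Y [sXY sX place]]] := place_one_sided (F := A :|: B) (N := NA a) (ga := al)
     (U := U) side_card side_disj sideF side_dense f0 f1 (subxx PS).
  + by move=> p pQ; apply: hal.
  + have := total_load_le side_disj U (subxx PS).
    by move: (oms _ (subxx PS)); lia.
  exists X, Y; split=> // [x /(subsetP sX)|X0 Y0 sX0 sY0 cX cY]; first by rewrite inE => /andP[].
  have [_ _ _ cU'] := place X0 Y0 sX0 sY0 cX cY.
  by right; right; split=> //; rewrite cU' -addnA.
Qed.

End Strategies.

(** * Choosing the two sets of seeds *)

Section Seeds.
Variables (V : finType) (e : rel V).
Hypothesis e_sym : symmetric e.
Implicit Types (A B X Y : {set V}).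

Lemma edge_count_fibers (K : finType) (f : V -> K) A B :
  edge_count e A B = \sum_k1 \sum_k2
    edge_count e [set x in A | f x == k1] [set y in B | f y == k2].
Proof.
rewrite /edge_count (partition_big f predT) //=; apply: eq_bigr => k1 _.
rewrite exchange_big /=; apply: eq_big => [x|x _]; first by rewrite inE.
rewrite deg_inE (partition_big f predT) //=; apply: eq_bigr => k2 _.
by rewrite deg_inE; apply: eq_bigl => y; rewrite inE.
Qed.

Lemma dense_fibers (K : finType) (f : V -> K) A B m :
  #|K| * #|K| * m < edge_count e A B ->
  exists k1 k2, m < edge_count e [set x in A | f x == k1] [set y in B | f y == k2].
Proof.
move=> lt; have [/existsP[k1 /existsP[k2 h]]|H] := boolP [exists k1, exists k2,
  m < edge_count e [set x in A | f x == k1] [set y in B | f y == k2]].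
  by exists k1, k2.
suff : edge_count e A B <= #|K| * #|K| * m by rewrite leqNgt lt.
rewrite (edge_count_fibers f) -mulnA -sum_nat_const; apply: leq_sum => k1 _.
rewrite -sum_nat_const; apply: leq_sum => k2 _; rewrite leqNgt; apply/negP => h.
by case/negP: H; apply/existsP; exists k1; apply/existsP; exists k2.
Qed.

(* Deleting in turn vertices [x] with fewer than [cap] neighbours in the current
   set, and vertices [a] of that set with at least [w] deleted neighbours. *)
Lemma clean_seeds A cap w : exists A' X,
  [/\ A' \subset A, #|A :\: A'| * w <= cap * #|V|,
      {in X, forall x, cap <= deg_in e x A'} &
      {in A', forall a, deg_in e a (~: X) < w}].
Proof.
(* A potential: each deleted [x] contributes fewer than [cap] edges to the current set, and deleting
   an [a] consumes at least [w] of these edges. *)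
pose ok (S : {set V} * {set V}) := (S.1 \subset A) &&
  (#|A :\: S.1| * w + edge_count e S.1 (~: S.2) <= cap * #|~: S.2|).
have ok0 : ok (A, [set: V]).
  rewrite /ok subxx /= setDv cards0 mul0n add0n edge_count_sym // /edge_count.
  by rewrite setCT big_set0 cards0.
case: (arg_minnP (fun S : {set V} * {set V} => #|S.1| + #|S.2|) ok0).
move=> [A' X] /= /andP[/= sA inv] min.
exists A', X; split=> //.
- apply: leq_trans (leq_trans (leq_addr _ _) inv) _.
  by rewrite leq_mul2l max_card orbT.
- move=> x xX; rewrite leqNgt; apply/negP => lt.
  have ok' : ok (A', X :\ x).
    have CE : ~: (X :\ x) = x |: ~: X.
      by apply/setP => y; rewrite !inE negb_and negbK.
    have xC : x \notin ~: X by rewrite inE xX.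
    rewrite /ok sA /= CE cardsU1 xC [edge_count _ _ _]edge_count_sym //.
    rewrite /edge_count big_setU1 //= -/(edge_count e (~: X) A').
    rewrite edge_count_sym //; lia.
  by have := min _ ok'; rewrite /= (cardsD1 x X) xX; lia.
- move=> a aA; rewrite ltnNge; apply/negP => le.
  have ok' : ok (A' :\ a, X).
    rewrite /ok (subset_trans (subsetDl _ _) sA) /=.
    have -> : A :\: (A' :\ a) = a |: (A :\: A').
      apply/setP => y; rewrite !inE negb_and negbK.
      by case: eqP => //= ->; rewrite (subsetP sA).
    rewrite cardsU1 !inE aA /=; move: inv.
    rewrite /edge_count (big_setD1 a) //=; lia.
  by have := min _ ok'; rewrite /= (cardsD1 a A') aA; lia.
Qed.

(** The type of a vertex lists its degrees into the sets [S j], rounded to multiples of [w]. By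
    pigeonhole some pair of types spans many edges, and within a type the degrees agree up to [w];
    this yields the bounds [al] and [be] common to all seeds. Passing to minimum degree and cleaning
    then give the degrees [cap]. *)
Lemma seed_sets (J : finType) (S : J -> {set V}) A0 B0 w q0 cap l' :
  0 < w -> (forall j, #|S j| < q0.+1 * w) ->
  (q0.+1 ^ #|J|) * (q0.+1 ^ #|J|) * (l' * (2 * #|V|)) < edge_count e A0 B0 ->
  cap * #|V| + cap * w <= l' * w ->
  exists A B (al be : J -> nat),
    [/\ A \subset A0 /\ B \subset B0, exists a, a \in A,
        {in A, forall a, cap <= deg_in e a B} /\ {in B, forall b, cap <= deg_in e b A},
        {in A, forall a j,
          al j <= #|[set x | e a x & cap <= deg_in e x A] :&: S j| /\
          deg_in e a (S j) <= al j + 2 * w} &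
        {in B, forall b j, be j <= #|[set x | e b x] :&: S j| /\
          deg_in e b (S j) <= be j + w}].
Proof.
move=> w0 Sw dense hcap.
pose ty x : {ffun J -> 'I_q0.+1} := [ffun j => inord (deg_in e x (S j) %/ w)].
have tyE x j : ty x j = deg_in e x (S j) %/ w :> nat.
  rewrite ffunE inordK // ltn_divLR //.
  exact: leq_ltn_trans (deg_in_card _ _ _) (Sw j).
have [|k1 [k2]] := @dense_fibers _ ty A0 B0 (l' * (2 * #|V|)).
  by rewrite card_ffun card_ord.
set A1 := [set x in A0 | _]; set B1 := [set y in B0 | _] => dense1.
have [|A2 [B2 [sA2 sB2 [_ [b0 b0B]] dA dB]]] := @min_degree_subpair _ e l' A1 B1 e_sym.
  apply: leq_ltn_trans dense1; rewrite leq_mul2l; apply/orP; right.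
  by rewrite mul2n -addnn; apply: leq_add; apply: max_card.
have [A [X [sA cA hX hA]]] := clean_seeds A2 cap w.
have cAl : #|A2 :\: A| + cap <= l'.
  rewrite -(leq_pmul2r w0) mulnDl; apply: leq_trans hcap.
  by rewrite leq_add2r.
have dB' b : b \in B2 -> cap < deg_in e b A.
  move=> bB; have := dB b bB; have := deg_in_card e b (A2 :\: A).
  have := deg_in_leqU e b A (A2 :\: A).
  have -> : A :|: (A2 :\: A) = A2 by rewrite -{2}(setID A2 A) (setIidPr sA).
  by move: cAl; clear; lia.
(* The extra [w] subtracted for [A] pays for the neighbours outside [X], those with too few
   neighbours in [A]. *)
exists A, B2, (fun j => k1 j * w - w), (fun j => k2 j * w); split.
- split; first by apply: subset_trans sA (subset_trans sA2 _); apply/subsetP => x; rewrite inE => /andP[].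
  by apply: subset_trans sB2 _; apply/subsetP => x; rewrite inE => /andP[].
- have : 0 < deg_in e b0 A by apply: leq_ltn_trans (dB' b0 b0B).
  by move=> /card_gt0P[a]; rewrite inE => /andP[aA _]; exists a.
- split=> [a aA|b bB]; last exact: ltnW (dB' b bB).
  by have := dA a (subsetP sA a aA); move: cAl; clear; lia.
- move=> a aA j; have := subsetP sA2 a (subsetP sA a aA).
  rewrite inE => /andP[_ /eqP <-]; rewrite tyE.
  have := divn_eq (deg_in e a (S j)) w; have := ltn_pmod (deg_in e a (S j)) w0.
  have := hA a aA.
  have : deg_in e a (S j) <= #|[set x | e a x & cap <= deg_in e x A] :&: S j| + deg_in e a (~: X).
    apply: leq_trans (leq_card_setU _ _); apply/subset_leq_card/subsetP => x.
    rewrite !inE => /andP[-> ->]; rewrite !andbT.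
    by have [xX|_] := boolP (x \in X); rewrite ?orbT // (hX x xX).
  by move: (_ %/ _) (_ %% _) => t u; clear; nia.
- move=> b bB j; have := subsetP sB2 b bB; rewrite inE => /andP[_ /eqP <-]; rewrite tyE.
  have := divn_eq (deg_in e b (S j)) w; have := ltn_pmod (deg_in e b (S j)) w0.
  have -> : #|[set x | e b x] :&: S j| = deg_in e b (S j).
    by apply: eq_card => x; rewrite !inE andbC.
  by move: (_ %/ _) (_ %% _) => t u; clear; nia.
Qed.

End Seeds.

(** * Matchings in the reduced graph *)

Section Hall.
Variables (I : finType) (h : rel I).
Implicit Types (A B X Y Z : {set I}).

Definition nbs Z := [set y | [exists x in Z, h x y]].

Lemma nbsP Z y : reflect (exists2 x, x \in Z & h x y) (y \in nbs Z).
Proof. by rewrite inE; apply: exists_inP. Qed.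

Lemma nbsU X Y : nbs (X :|: Y) = nbs X :|: nbs Y.
Proof.
apply/setP => y; rewrite in_setU; apply/nbsP/orP => [[x]|].
  by rewrite in_setU => /orP[] xX hxy; [left | right]; apply/nbsP; exists x.
by case=> /nbsP[x xX hxy]; exists x; rewrite // in_setU xX ?orbT.
Qed.

(** Hall's theorem. A tight proper nonempty subset splits the problem in two; if there is none, one
    vertex may be matched arbitrarily, since every other set can spare a target. *)
Lemma hall A B : (forall Z, Z \subset A -> #|Z| <= #|nbs Z :&: B|) ->
  exists f : I -> I, {in A &, injective f} /\
    {in A, forall x, h x (f x) /\ f x \in B}.
Proof.
have [n] := ubnP #|A|; elim: n A B => // n IHn A B ltn hA.
have [A0|[x xA]] := set_0Vmem A.
  by exists id; split=> x; rewrite A0 inE.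
have [/existsP[Z /and4P[sZ nZ0 nZA /eqP tZ]]|notight] := boolP [exists Z : {set I},
  [&& Z \subset A, Z != set0, Z != A & #|nbs Z :&: B| == #|Z|]].
  have pZ : Z \proper A by rewrite properEneq nZA.
  have cA : #|A| = #|Z| + #|A :\: Z| by rewrite -(cardsID Z A) (setIidPr sZ).
  have [|Y sY|f1 [i1 h1]] := IHn Z B.
  - exact: leq_trans (proper_card pZ) ltn.
  - by apply: hA; apply: subset_trans sZ.
  have [|Y sY|f2 [i2 h2]] := IHn (A :\: Z) (B :\: nbs Z).
  - by move: nZ0; rewrite -card_gt0; move: cA ltn; clear; lia.
  - have dYZ : Y :&: Z = set0.
      by apply/eqP; rewrite setI_eq0; apply: disjointWl sY _; rewrite -setI_eq0 setIDAC setDIl setDv setI0.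
    have := hA (Y :|: Z); rewrite subUset sZ (subset_trans sY (subsetDl _ _)) => /(_ isT).
    rewrite cardsU dYZ cards0 subn0 nbsU setIUl.
    have -> : nbs Y :&: B :|: nbs Z :&: B =
        (nbs Y :&: (B :\: nbs Z)) :|: (nbs Z :&: B).
      by apply/setP => y; rewrite !in_setU !in_setI !in_setD; case: (y \in nbs Z); case: (y \in B); rewrite ?andbF ?orbF ?orbT.
    move=> le; have [le' _] := leq_card_setU (nbs Y :&: (B :\: nbs Z)) (nbs Z :&: B).
    by move: le le'; rewrite tZ; clear; lia.
  exists (fun y => if y \in Z then f1 y else f2 y); split.
    move=> y1 y2 y1A y2A /=.
    have [y1Z|y1Z] := boolP (y1 \in Z); have [y2Z|y2Z] := boolP (y2 \in Z).
    - exact: i1.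
    - move=> E; have [hy1 _] := h1 y1 y1Z.
      have [_] := h2 y2 ltac:(by rewrite inE y2Z); rewrite -E in_setD => /andP[/nbsP[]].
      by exists y1.
    - move=> E; have [hy2 _] := h1 y2 y2Z.
      have [_] := h2 y1 ltac:(by rewrite inE y1Z); rewrite E in_setD => /andP[/nbsP[]].
      by exists y2.
    - by apply: i2; rewrite inE ?y1Z ?y2Z.
  move=> y yA; case: ifP => yZ; first exact: h1.
  have [hy] := h2 y ltac:(by rewrite inE yZ).
  by rewrite inE => /andP[_ yB].
have [y] : exists y, y \in nbs [set x] :&: B.
  by apply/card_gt0P; have := hA [set x]; rewrite sub1set xA cards1 => /(_ isT).
rewrite inE => /andP[/nbsP[x' /set1P-> hxy] yB].
have [|Y sY|f [i1 h1]] := IHn (A :\ x) (B :\ y).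
- by move: ltn; rewrite (cardsD1 x A) xA; clear; lia.
- have sYA := subset_trans sY (subsetDl _ _).
  have [->|Y0] := eqVneq Y set0; first by rewrite cards0.
  have nYA : Y != A by apply: contraTneq sY => ->; rewrite subsetD1 xA andbF.
  have lt : #|Y| < #|nbs Y :&: B|.
    rewrite ltn_neqAle hA // andbT eq_sym; apply: contra notight => tY.
    by apply/existsP; exists Y; rewrite sYA Y0 nYA.
  rewrite -ltnS; apply: leq_trans lt _.
  have -> : nbs Y :&: (B :\ y) = (nbs Y :&: B) :\ y by rewrite setIDA.
  by rewrite (cardsD1 y); case: (_ \in _); clear; lia.
exists (fun z => if z == x then y else f z); split.
  move=> z1 z2 z1A z2A /=; case: eqP => [->|/eqP n1]; case: eqP => [->|/eqP n2] //.
  - move=> E; have [_] := h1 z2 ltac:(by rewrite !inE n2).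
    by rewrite -E !inE eqxx.
  - move=> E; have [_] := h1 z1 ltac:(by rewrite !inE n1).
    by rewrite E !inE eqxx.
  - by apply: i1; rewrite !inE ?n1 ?n2.
move=> z zA; case: eqP => [->//|/eqP nz].
have [hz] := h1 z ltac:(by rewrite !inE nz).
by rewrite !inE => /andP[_].
Qed.

Definition independent A := [forall x in A, forall y in A, ~~ h x y].

Lemma independentP A : reflect {in A &, forall x y, ~~ h x y} (independent A).
Proof.
apply: (iffP forall_inP) => [H x y xA yA|H x xA].
  by have /forall_inP := H x xA; apply.
by apply/forall_inP => y yA; apply: H.
Qed.

Hypothesis h_sym : symmetric h.

(* A fractional version of the Gallai-Edmonds decomposition: the independent set
   maximising [#|I0| - #|nbs I0|] satisfies Hall's condition towards its
   neighbourhood, and its complement has a perfect fractional matching. *)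
Lemma independent_decomposition : exists I0 (ps ph : I -> I),
  [/\ independent I0,
      {in nbs I0 &, injective ps} /\ {in nbs I0, forall i, h i (ps i) /\ ps i \in I0} &
      {in ~: (I0 :|: nbs I0) &, injective ph} /\
      {in ~: (I0 :|: nbs I0), forall i, h i (ph i) /\ ph i \in ~: (I0 :|: nbs I0)}].
Proof.
have ind0 : independent set0 by apply/independentP => x y; rewrite inE.
case: (arg_maxnP (fun X : {set I} => #|X| + #|~: nbs X|) ind0) => I0 indI max.
(* For a violating [Y], passing from [I0] to [I0 :\: nbs Y] loses fewer than [#|Y|] vertices, while
   all of [Y] leaves the neighbourhood. *)
have hallN : forall Y, Y \subset nbs I0 -> #|Y| <= #|nbs Y :&: I0|.
  move=> Y sY; rewrite leqNgt; apply/negP => lt.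
  have ind1 : independent (I0 :\: nbs Y).
    apply/independentP => x y; rewrite !in_setD => /andP[_ xI] /andP[_ yI].
    by have /independentP := indI; apply.
  have := max _ ind1; rewrite /= leqNgt => /negP; apply.
  have sub : ~: nbs I0 :|: Y \subset ~: nbs (I0 :\: nbs Y).
    apply/subsetP => y; rewrite in_setU !in_setC => yC; apply/negP => /nbsP[x].
    rewrite in_setD => /andP[/negP xY xI] hxy; case/orP: yC => [/negP[]|yY].
      by apply/nbsP; exists x.
    by apply: xY; apply/nbsP; exists y; rewrite // h_sym.
  have := subset_leq_card sub; rewrite cardsU.
  have -> : ~: nbs I0 :&: Y = set0.
    by apply/eqP; rewrite setI_eq0 disjoint_sym disjoints_subset setCK.
  have := cardsID (nbs Y) I0; rewrite cards0 setIC.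
  by move: lt; clear; lia.
(* For a violating [Z], adding [Z :\: nbs Z] to [I0] keeps it independent. The new neighbours lie in
   [nbs Z] outside [Z], and as [Z :&: nbs Z] cancels, the gain is at least the Hall deficit of
   [Z]. *)
have hallQ : forall Z, Z \subset ~: (I0 :|: nbs I0) ->
    #|Z| <= #|nbs Z :&: ~: (I0 :|: nbs I0)|.
  move=> Z sZ; rewrite leqNgt; apply/negP => lt.
  have ZQ z : z \in Z -> z \notin I0 /\ z \notin nbs I0.
    by move/(subsetP sZ); rewrite in_setC in_setU negb_or => /andP.
  have ind1 : independent (I0 :|: (Z :\: nbs Z)).
    apply/independentP => x y; rewrite !in_setU !in_setD.
    case/orP=> [xI|/andP[xN xZ]]; case/orP=> [yI|/andP[yN yZ]].
    - by have /independentP := indI; apply.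
    - by apply/negP => hxy; have [_ /nbsP[]] := ZQ y yZ; exists x.
    - by apply/negP => hxy; have [_ /nbsP[]] := ZQ x xZ; exists y; rewrite // h_sym.
    - by apply/negP => hxy; case/nbsP: yN; exists x.
  have := max _ ind1; rewrite /= leqNgt => /negP; apply.
  have sub : nbs (I0 :|: (Z :\: nbs Z)) \subset
      nbs I0 :|: ((nbs Z :&: ~: (I0 :|: nbs I0)) :\: Z).
    apply/subsetP => y; rewrite nbsU !in_setU => /orP[->//|/nbsP[z]].
    rewrite in_setD => /andP[zN zZ] hzy; apply/orP.
    have [yN|yN] := boolP (y \in nbs I0); [by left | right].
    have [zI zNI] := ZQ z zZ.
    rewrite in_setD in_setI in_setC in_setU negb_or yN andbT; apply/and3P; split.
    - by apply/negP => yZ; case/nbsP: zN; exists y; rewrite // h_sym.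
    - by apply/nbsP; exists z.
    - by apply/negP => yI; case/nbsP: zNI; exists y; rewrite // h_sym.
  have c1 := subset_leq_card sub.
  have [c2 _] := leq_card_setU (nbs I0) ((nbs Z :&: ~: (I0 :|: nbs I0)) :\: Z).
  have c3 := cardsID Z (nbs Z :&: ~: (I0 :|: nbs I0)).
  have c4 := cardsID (nbs Z) Z.
  have c5 : #|I0 :|: (Z :\: nbs Z)| = #|I0| + #|Z :\: nbs Z|.
    rewrite cardsU; suff -> : I0 :&: (Z :\: nbs Z) = set0 by rewrite cards0 subn0.
    apply/setP => z; rewrite in_set0 in_setI in_setD; apply/negP.
    by case/and3P=> zI _ /ZQ[]; rewrite zI.
  have c6 : nbs Z :&: ~: (I0 :|: nbs I0) :&: Z = Z :&: nbs Z.
    apply/setP => z; rewrite !in_setI andbC; case: (boolP (z \in Z)) => //= zZ.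
    by rewrite (subsetP sZ) // andbT.
  have c7 := cardsC (nbs I0); have c8 := cardsC (nbs (I0 :|: (Z :\: nbs Z))).
  by move: lt c1 c2 c3 c4 c7 c8; rewrite c5 c6; clear; lia.
have [ps [ips hps]] := hall hallN; have [ph [iph hph]] := hall hallQ.
by exists I0, ps, ph.
Qed.

End Hall.

(** * Energy of a partition *)

Section Energy.
Local Open Scope ring_scope.
Variables (R : realFieldType) (T : finType) (F : T -> R).

(** The conditional expectation of [F] given [g]; on an empty fibre it is 0 by the convention for
    division by zero. *)
Definition fiber_mean (K : finType) (g : T -> K) k :=
  (\sum_(t | g t == k) F t) / #|[set t | g t == k]|%:R.

Definition energy (K : finType) (g : T -> K) := \sum_t fiber_mean g (g t) ^+ 2.

(** Functions of [g] do not distinguish [F] from its conditional expectation; this is the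
    orthogonality behind the energy identities. *)
Lemma sum_fiber_mean (K : finType) (g : T -> K) (phi : K -> R) :
  \sum_t fiber_mean g (g t) * phi (g t) = \sum_t F t * phi (g t).
Proof.
rewrite (partition_big g predT) //= [RHS](partition_big g predT) //=.
apply: eq_bigr => k _.
rewrite (eq_bigr (fun=> fiber_mean g k * phi k)); last by move=> t /eqP->.
rewrite [RHS](eq_bigr (fun t => F t * phi k)); last by move=> t /eqP->.
rewrite -[RHS]mulr_suml sumr_const -mulr_natr mulrAC; congr (_ * _).
have -> : #|(fun t => g t == k)| = #|[set t | g t == k]|.
  by apply: eq_card => x; rewrite !inE.
have [E|[t tk]] := set_0Vmem [set t | g t == k].
  rewrite E cards0 mulr0 big_pred0 // => t.
  by move/setP/(_ t): E; rewrite !inE.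
rewrite /fiber_mean divfK // pnatr_eq0 -lt0n.
by apply/card_gt0P; exists t.
Qed.

Lemma energyE (K : finType) (g : T -> K) :
  energy g = \sum_t F t * fiber_mean g (g t).
Proof. by rewrite -sum_fiber_mean; apply: eq_bigr => t _; rewrite expr2. Qed.

(** Pythagoras: the coarse mean is the projection of the fine one, so the mixed term equals
    [energy g]. *)
Lemma energy_increment (K K' : finType) (g : T -> K) (g' : T -> K') (pi : K' -> K) :
  (forall t, g t = pi (g' t)) ->
  energy g' = energy g +
    \sum_t (fiber_mean g' (g' t) - fiber_mean g (g t)) ^+ 2.
Proof.
move=> gE; have cross : \sum_t fiber_mean g' (g' t) * fiber_mean g (g t) = energy g.
  rewrite energyE (eq_bigr (fun t => fiber_mean g' (g' t) * fiber_mean g (pi (g' t)))).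
    rewrite (sum_fiber_mean g' (fun k => fiber_mean g (pi k))).
    by apply: eq_bigr => t _; rewrite gE.
  by move=> t _; rewrite gE.
under [X in _ = _ + X]eq_bigr do rewrite sqrrB.
rewrite big_split sumrB /= -/(energy g') -/(energy g).
by rewrite sumrMnl cross; ring.
Qed.

Lemma energy_mono (K K' : finType) (g : T -> K) (g' : T -> K') (pi : K' -> K) :
  (forall t, g t = pi (g' t)) -> energy g <= energy g'.
Proof.
move=> gE; rewrite (energy_increment gE) lerDl.
by apply: sumr_ge0 => t _; apply: sqr_ge0.
Qed.

Lemma energy_le_card (K : finType) (g : T -> K) :
  (forall t, 0 <= F t <= 1) -> energy g <= #|T|%:R.
Proof.
move=> F01; have mean01 k : 0 <= fiber_mean g k <= 1.
  have s0 : 0 <= \sum_(t | g t == k) F t by apply: sumr_ge0 => t _; case/andP: (F01 t).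
  apply/andP; split; first by rewrite /fiber_mean divr_ge0.
  have [E|[t tk]] := set_0Vmem [set t | g t == k].
    by rewrite /fiber_mean E cards0 invr0 mulr0.
  rewrite /fiber_mean ler_pdivrMr; last by rewrite ltr0n; apply/card_gt0P; exists t.
  rewrite mul1r -sum1_card natr_sum (eq_bigl (fun t => g t == k)); last by move=> x; rewrite inE.
  by apply: ler_sum => x _; case/andP: (F01 x).
rewrite energyE -sum1_card natr_sum; apply: ler_sum => t _.
by rewrite mulr_ile1 //; case/andP: (F01 t) => // _ _; case/andP: (mean01 (g t)).
Qed.

(** Cauchy-Schwarz, from the nonnegativity of a variance. *)
Lemma sum_sqr_ge (S : {set T}) (x : T -> R) :
  (\sum_(t in S) x t) ^+ 2 <= #|S|%:R * \sum_(t in S) x t ^+ 2.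
Proof.
have [->|S0] := eqVneq S set0; first by rewrite !big_set0 cards0 mul0r expr0n.
have n0 : 0 < #|S|%:R :> R by rewrite ltr0n card_gt0.
set n := #|S|%:R in n0 *; set s := \sum_(t in S) x t.
have : 0 <= \sum_(t in S) (x t - s / n) ^+ 2 by apply: sumr_ge0 => t _; apply: sqr_ge0.
under eq_bigr do rewrite sqrrB.
rewrite big_split sumrB /= sumrMnl -mulr_suml -/s sumr_const -[_ *+ #|S|]mulr_natl -/n.
have -> : \sum_(i in S) x i ^+ 2 - s * (s / n) *+ 2 + n * (s / n) ^+ 2 =
  \sum_(i in S) x i ^+ 2 - s ^+ 2 / n by field; rewrite gt_eqF.
by rewrite subr_ge0 ler_pdivrMr // mulrC.
Qed.

(** On a union [S] of fibres of [g'] the fine means add up to the sum of [F]. A deviation of this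
    sum from the coarse mean therefore forces, by Cauchy-Schwarz, an energy increment inside [S]. *)
Lemma increment_on (K K' : finType) (g : T -> K) (g' : T -> K') k
    (S : {set T}) (S' : pred K') :
  (forall t, (t \in S) = S' (g' t)) -> {in S, forall t, g t = k} ->
  (\sum_(t in S) F t - #|S|%:R * fiber_mean g k) ^+ 2 <=
    #|S|%:R * \sum_(t in S) (fiber_mean g' (g' t) - fiber_mean g (g t)) ^+ 2.
Proof.
move=> SE gS; apply: le_trans (sum_sqr_ge _ _).
rewrite le_eqVlt; apply/orP; left; apply/eqP; congr (_ ^+ 2).
rewrite sumrB; congr (_ - _).
  have := sum_fiber_mean g' (fun k' => (S' k')%:R).
  rewrite (eq_bigr (fun t => (if t \in S then fiber_mean g' (g' t) else 0))); last first.
    by move=> t _; rewrite SE; case: (S' _); rewrite (mulr1, mulr0).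
  rewrite -big_mkcond /= => ->; rewrite big_mkcond; apply: eq_bigr => t _.
  by rewrite SE; case: (S' _); rewrite (mulr1, mulr0).
rewrite (eq_bigr (fun=> fiber_mean g k)); last by move=> t /gS->.
by rewrite sumr_const mulr_natl.
Qed.

End Energy.

(** * Regular partitions *)

Lemma sum_setX (R : nmodType) (T1 T2 : finType) (X : {set T1}) (Y : {set T2})
    (f : T1 * T2 -> R) :
  (\sum_(t in setX X Y) f t = \sum_(x in X) \sum_(y in Y) f (x, y))%R.
Proof.
rewrite pair_big /=; apply: eq_big => [[x y]|[x y] _] //=.
by rewrite inE.
Qed.

(** Here [a] and [b] count the edges of a witness and of its pair of parts, [x] and [D] are the
    products of the sizes, and [F] is the regularity parameter. A density drop of [1 / F] gains at
    least [x / F ^ 2], and [x >= D / F ^ 2]. *)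
Lemma gain_arith (R : realFieldType) (a b x D F z : R) :
  (0 < x -> 0 < D -> 0 < F -> (F * a + x) * D < F * b * x -> D <= F * F * x ->
   (a - x * (b / D)) ^+ 2 <= x * z -> D / F ^+ 4 <= z)%R.
Proof.
move=> x0 D0 F0 h1 h2 h3.
have h4 : (x / F <= x * (b / D) - a)%R.
  rewrite lerBrDr; apply: ltW.
  have -> : (x / F + a = (F * a + x) * D / (F * D))%R by field; rewrite !gt_eqF.
  have -> : (x * (b / D) = F * b * x / (F * D))%R by field; rewrite !gt_eqF.
  by rewrite ltr_pM2r // invr_gt0 mulr_gt0.
have h5 : (x ^+ 2 / F ^+ 2 <= x * z)%R.
  apply: le_trans h3; rewrite -expr_div_n -(sqrrN (a - _)%R) opprB.
  by rewrite ler_sqr ?nnegrE // ?(le_trans _ h4) // divr_ge0 // ltW.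
have h6 : (x / F ^+ 2 <= z)%R.
  by rewrite -(ler_pM2l x0) mulrA -expr2.
apply: le_trans h6.
have -> : (x / F ^+ 2 = F * F * x / F ^+ 4)%R by field; rewrite gt_eqF.
by rewrite ler_pM2r // invr_gt0 exprn_gt0.
Qed.

Section Refinement.
Variables (V : finType) (e : rel V).
Implicit Types (X Y : {set V}).

Definition part (I : finType) (c : V -> I) i := [set v | c v == i].

Definition adj_val (R : realFieldType) (t : V * V) : R := ((e t.1 t.2)%:R)%R.

Definition on_pairs (I : finType) (c : V -> I) (t : V * V) := (c t.1, c t.2).

Definition pair_energy (R : realFieldType) (I : finType) (c : V -> I) : R :=
  energy (adj_val R) (on_pairs c).

Lemma sum_adj_val R X Y :
  (\sum_(t in setX X Y) adj_val R t = (edge_count e X Y)%:R)%R.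
Proof.
rewrite sum_setX /edge_count natr_sum; apply: eq_bigr => x _.
by rewrite deg_inE natr_sum.
Qed.

Lemma pair_mean R (I : finType) (c : V -> I) i j :
  (fiber_mean (adj_val R) (on_pairs c) (i, j) =
    (edge_count e (part c i) (part c j))%:R / (#|part c i| * #|part c j|)%:R)%R.
Proof.
rewrite /fiber_mean -sum_adj_val -cardsX; congr (_ / _%:R)%R.
  by apply: eq_bigl => -[u v]; rewrite !inE /on_pairs xpair_eqE.
by apply: eq_card => -[u v]; rewrite !inE /on_pairs xpair_eqE.
Qed.

Variable E : nat.
Hypothesis E_gt0 : 0 < E.

(* The last condition says, with denominators cleared, that the density of the
   pair [S] is below the density of the two parts by more than [1 / E]. *)
Definition irregular_witness (I : finType) (c : V -> I) i j (S : {set V} * {set V}) :=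
  [&& S.1 \subset part c i, S.2 \subset part c j,
      #|part c i| <= E * #|S.1|, #|part c j| <= E * #|S.2| &
      (E * edge_count e S.1 S.2 + #|S.1| * #|S.2|) * (#|part c i| * #|part c j|)
      < E * edge_count e (part c i) (part c j) * (#|S.1| * #|S.2|)].

Definition irregular (I : finType) (c : V -> I) i j :=
  [exists S, irregular_witness c i j S].

Definition irregular_mass (I : finType) (c : V -> I) :=
  \sum_i \sum_(j | irregular c i j) #|part c i| * #|part c j|.

(** For a regular pair the default is a pair of empty sets, which cuts nothing. *)
Definition witness (I : finType) (c : V -> I) (ij : I * I) : {set V} * {set V} :=
  odflt (set0, set0) [pick S | irregular_witness c ij.1 ij.2 S].

Definition refine_by_witnesses (I : finType) (c : V -> I) v :
    I * {ffun I * I -> bool * bool} :=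
  (c v, [ffun ij => (v \in (witness c ij).1, v \in (witness c ij).2)]).

Lemma witnessP (I : finType) (c : V -> I) i j : irregular c i j ->
  irregular_witness c i j (witness c (i, j)).
Proof.
by move=> /existsP[S hS]; rewrite /witness; case: pickP => //= /(_ S); rewrite hS.
Qed.

Lemma irregular_gain (R : realFieldType) (I : finType) (c : V -> I) i j :
  irregular c i j ->
  ((#|part c i| * #|part c j|)%:R / E%:R ^+ 4 <=
   \sum_(t in setX (witness c (i, j)).1 (witness c (i, j)).2)
     (fiber_mean (adj_val R) (on_pairs (refine_by_witnesses c))
        (on_pairs (refine_by_witnesses c) t)
      - fiber_mean (adj_val R) (on_pairs c) (on_pairs c t)) ^+ 2)%R.
Proof.
move=> irr; have := witnessP irr; set S := witness c (i, j).
case/and5P=> s1 s2 c1 c2 drop.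
set SX := setX S.1 S.2; set sum := (\sum_(t in _) _)%R.
set x := #|S.1| * #|S.2| in drop *; set D := #|part c i| * #|part c j| in drop *.
have hle : (((edge_count e S.1 S.2)%:R - x%:R *
    ((edge_count e (part c i) (part c j))%:R / D%:R)) ^+ 2 <= x%:R * sum)%R.
  have <- := sum_adj_val R S.1 S.2; have <- := pair_mean R c i j.
  rewrite /x -cardsX.
  apply: (@increment_on R _ (adj_val R) _ _ (on_pairs c)
    (on_pairs (refine_by_witnesses c)) (i, j) (setX S.1 S.2)
    (fun k => [&& k.1.1 == i, k.2.1 == j, (k.1.2 (i, j)).1 & (k.2.2 (i, j)).2])).
    move=> [u v]; rewrite inE /on_pairs /refine_by_witnesses /= !ffunE /= -/S.
    apply/andP/and4P => [[uS vS]|[_ _ uS vS]]; split=> //.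
      by have := subsetP s1 u uS; rewrite inE.
    by have := subsetP s2 v vS; rewrite inE.
  move=> [u v]; rewrite inE /= => /andP[uS vS]; rewrite /on_pairs /=.
  have := subsetP s1 u uS; have := subsetP s2 v vS.
  by rewrite !inE => /eqP-> /eqP->.
have x0 : 0 < x by move: drop; case: (x) => //; rewrite muln0.
have D0 : 0 < D.
  move: x0; rewrite /x /D !muln_gt0 => /andP[h1 h2].
  by rewrite (leq_trans h1 (subset_leq_card s1)) (leq_trans h2 (subset_leq_card s2)).
have DE : D <= E * E * x.
  by rewrite /D /x mulnACA; apply: leq_mul.
apply: (@gain_arith R (edge_count e S.1 S.2)%:R
  (edge_count e (part c i) (part c j))%:R x%:R) => //; rewrite ?ltr0n //.
  by rewrite -!natrM -natrD -natrM ltr_nat.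
by rewrite -!natrM ler_nat.
Qed.

(** The witnesses of different irregular pairs lie in different blocks of [V * V], so their gains
    add up to at least the irregular mass divided by [E ^ 4]. *)
Lemma energy_gain (R : realFieldType) (I : finType) (c : V -> I) :
  #|V| ^ 2 < E * irregular_mass c ->
  (pair_energy R c + (#|V| ^ 2)%:R / E%:R ^+ 5 <=
   pair_energy R (refine_by_witnesses c))%R.
Proof.
move=> lt; rewrite /pair_energy.
rewrite (@energy_increment R _ (adj_val R) _ _ (on_pairs c)
  (on_pairs (refine_by_witnesses c)) (fun k => (k.1.1, k.2.1))) // lerD2l.
rewrite (partition_big (on_pairs c) predT) //=.
apply: (@le_trans _ _ (\sum_(k : I * I | irregular c k.1 k.2)
    (#|part c k.1| * #|part c k.2|)%:R / E%:R ^+ 4)%R).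
  rewrite -mulr_suml -natr_sum.
  have -> : \sum_(k | irregular c k.1 k.2) #|part c k.1| * #|part c k.2| = irregular_mass c.
    rewrite /irregular_mass pair_big_dep /=.
    by apply: eq_big => [[]|[]].
  have E0 : (0 < E%:R :> R)%R by rewrite ltr0n.
  rewrite exprS invfM mulrA ler_pM2r ?invr_gt0 ?exprn_gt0 // ler_pdivrMr //.
  by rewrite -natrM ler_nat mulnC ltnW.
rewrite big_mkcond /=; apply: ler_sum => -[i j] _ /=.
case: ifP => [irr|_]; last by apply: sumr_ge0 => t _; apply: sqr_ge0.
apply: le_trans (irregular_gain R irr) _; rewrite big_mkcond [leRHS]big_mkcond.
apply: ler_sum => -[u v] _; case: ifP => [|_]; last by case: ifP => // _; apply: sqr_ge0.
rewrite inE /= => /andP[uS vS]; have /and5P[s1 s2 _ _ _] := witnessP irr.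
have := subsetP s1 u uS; have := subsetP s2 v vS.
by rewrite !inE /on_pairs => /eqP-> /eqP->; rewrite eqxx.
Qed.

Lemma pair_energy_le (R : realFieldType) (I : finType) (c : V -> I) :
  (pair_energy R c <= (#|V| ^ 2)%:R)%R.
Proof.
apply: le_trans (energy_le_card _ _) _; last by rewrite card_prod mulnn.
by move=> t; rewrite /adj_val; case: (e _ _); rewrite ?lexx ?ler01.
Qed.

Lemma pair_energy_mono (R : realFieldType) (I I' : finType) (c : V -> I) (c' : V -> I')
  (pi : I' -> I) : (forall v, c v = pi (c' v)) ->
  (pair_energy R c <= pair_energy R c')%R.
Proof.
move=> cE; apply: (@energy_mono _ _ _ _ _ _ _ (fun k => (pi k.1, pi k.2))) => t.
by rewrite /on_pairs !cE.
Qed.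

End Refinement.

Lemma sum_index (V : eqType) (L : seq V) (F : nat -> nat) : uniq L ->
  \sum_(v <- L) F (index v L) = \sum_(r < size L) F r.
Proof.
case: L => [|x L] uL; first by rewrite big_nil big_ord0.
rewrite (big_nth x) big_mkord; apply: eq_bigr => r _.
by rewrite index_uniq.
Qed.

Lemma count_quotient N m q : 0 < m ->
  \sum_(r < N) (r %/ m == q) = minn N (q.+1 * m) - minn N (q * m).
Proof.
move=> m0; elim: N => [|N IHN]; first by rewrite big_ord0 !min0n.
rewrite big_ord_recr /= IHN eqn_leq -ltnS ltn_divLR // leq_divRL //.
have : q * m <= q.+1 * m by rewrite leq_mul2r leqnSn orbT.
by move: (q * m) (q.+1 * m) => a b; case: leqP; case: ltnP; rewrite /=; lia.
Qed.

(** * Equalising the cluster sizes *)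

Section Chop.
Variables (V : finType).

Definition chop (I : finType) (c : V -> I) m v : I * 'I_(#|V| %/ m).+1 :=
  (c v, inord (index v (enum (part c (c v))) %/ m)).

Lemma chop_card (I : finType) (c : V -> I) m i (q : 'I_(#|V| %/ m).+1) : 0 < m ->
  #|part (chop c m) (i, q)| =
  minn #|part c i| (q.+1 * m) - minn #|part c i| (q * m).
Proof.
move=> m0; rewrite -count_quotient //.
have := sum_index (fun r => r %/ m == q :> nat) (enum_uniq (part c i)).
rewrite -cardE => <-; rewrite big_enum /= -sum1_card -big_mkcondr /=.
apply: eq_bigl => v; rewrite /chop !inE xpair_eqE.
have [cv|] := eqVneq (c v) i; last by [].
rewrite /= cv -val_eqE /= inordK // ltnS leq_div2r //.
by apply: leq_trans (index_size _ _) _; rewrite -cardE max_card.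
Qed.

(** In a class of size [N] only the block with index [N %/ m] can be neither full nor empty. *)
Lemma chop_leftovers (I : finType) (c : V -> I) m : 0 < m ->
  \sum_(k | #|part (chop c m) k| != m) #|part (chop c m) k| <= #|I| * m.
Proof.
move=> m0; rewrite big_mkcond /=.
have -> : \sum_k (if #|part (chop c m) k| != m then #|part (chop c m) k| else 0) =
    \sum_i \sum_q (if #|part (chop c m) (i, q)| != m then #|part (chop c m) (i, q)| else 0).
  by rewrite pair_big /=; apply: eq_bigr => -[].
rewrite -sum_nat_const; apply: leq_sum => i _.
set N := #|part c i|; have hN : N %/ m < (#|V| %/ m).+1 by rewrite ltnS leq_div2r // max_card.
apply: (@leq_trans (\sum_(q < (#|V| %/ m).+1) (q == Ordinal hN) * m)).
  apply: leq_sum => q _; rewrite chop_card // -/N.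
  have qq : q * m <= q.+1 * m by rewrite leq_mul2r leqnSn orbT.
  have [eq|nq] := eqVneq q (Ordinal hN).
    rewrite mul1n; case: ifP => // _; rewrite mulSn in qq *.
    by move: (q * m) qq => a; case: leqP; case: leqP; lia.
  case: ifP => // nm; rewrite leqn0; apply: contraT => nz; case/negP: nq.
  rewrite -val_eqE /= eq_sym eqn_leq -ltnS ltn_divLR // leq_divRL //.
  move: nm nz; rewrite mulSn in qq *.
  by move: (q * m) qq => a; case: leqP; case: leqP; lia.
rewrite -big_distrl /= (bigD1 (Ordinal hN)) //= eqxx big1 ?addn0 ?mul1n //.
by move=> q /negPf->.
Qed.

(** Parts of size other than [2 * s] are leftovers, which stay in the partition but have no edges in
    the reduced graph. [M] bounds both the number of parts and [#|V| / s]. *)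
Record nice_partition E M (I : finType) (c : V -> I) s : Prop := NicePartition {
  np_pos : 0 < s;
  np_size : forall i, #|part c i| <= 2 * s;
  np_leftover : E * \sum_(i | #|part c i| != 2 * s) #|part c i| <= #|V|;
  np_small : 2 * s * E <= #|V|;
  np_large : #|V| <= M * s;
  np_card : #|I| <= M }.

(** The value of [s] makes [K] leftovers of size at most [2 * s] have total size at most
    [#|V| / E]. *)
Lemma chop_nice (I : finType) (c : V -> I) E K :
  0 < E -> 0 < K -> #|I| <= K -> 2 * K * E <= #|V| ->
  let s := #|V| %/ (2 * K * E) in
  nice_partition E (K * (2 * K * E).+1 + 4 * K * E) (chop c (2 * s)) s.
Proof.
move=> E0 K0 IK le s; have d0 : 0 < 2 * K * E by rewrite !muln_gt0 K0 E0.
have s0 : 0 < s by rewrite divn_gt0.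
have hs : s * (2 * K * E) <= #|V| by apply: leq_trunc_div.
have hs' : #|V| < (s.+1) * (2 * K * E) by rewrite -ltn_divLR.
have m0 : 0 < 2 * s by lia.
have sle : #|V| <= s * (4 * K * E).
  apply: leq_trans (ltnW hs') _; rewrite -!mulnA.
  by move: (K * E) => x; nia.
split=> //.
- move=> [i q]; rewrite chop_card //.
  by rewrite [q.+1 * _]mulSn; move: (q * _) => a; case: leqP; case: leqP; lia.
- apply: leq_trans hs; apply: (@leq_trans (E * (#|I| * (2 * s)))).
    by rewrite leq_mul2l chop_leftovers ?orbT.
  apply: (@leq_trans (E * (K * (2 * s)))).
    by rewrite leq_mul2l leq_mul2r IK !orbT.
  by apply: eq_leq; ring.
- apply: leq_trans hs; have : 2 * s * E * 1 <= 2 * s * E * K by rewrite leq_mul2l K0 orbT.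
  by move/leq_trans; rewrite muln1; apply; apply: eq_leq; ring.
- by apply: leq_trans sle _; rewrite mulnC leq_mul2r leq_addl orbT.
rewrite card_prod card_ord; apply: leq_trans (leq_addr _ _); apply: leq_mul => //.
rewrite ltnS; apply: leq_trans (leq_div2r _ sle) _.
have -> : s * (4 * K * E) = 2 * K * E * (2 * s) by ring.
by rewrite mulnK.
Qed.

End Chop.

(** * Iterating the refinement *)

Section Regularity.
Variable E : nat.
Hypothesis E_gt0 : 0 < E.

(** An irregular partition is refined by its witnesses, which raises the energy by
    [#|V| ^ 2 / E ^ 5], and then chopped again, which cannot lower it. Starting from [lab0] keeps
    every cluster inside one label class. *)
Lemma regular_or_energetic (R : realFieldType) j : exists M n0,
  forall (V : finType) (e : rel V) (lab0 : V -> bool), n0 <= #|V| ->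
  exists (I : finType) (c : V -> I) (lab : I -> bool) s,
    [/\ nice_partition E M c s, forall v, lab (c v) = lab0 v &
        E * irregular_mass e E c <= #|V| ^ 2 \/
        ((j * #|V| ^ 2)%:R / E%:R ^+ 5 <= pair_energy e R c)%R].
Proof.
elim: j => [|j [M [n0 IHj]]].
  exists (2 * (2 * 2 * E).+1 + 4 * 2 * E), (2 * 2 * E) => V e lab0 hn.
  have c2 : #|{: bool}| <= 2 by rewrite card_bool.
  have nc := chop_nice lab0 E_gt0 (isT : 0 < 2) c2 hn.
  exists _, (chop lab0 (2 * (#|V| %/ (2 * 2 * E)))), fst, (#|V| %/ (2 * 2 * E)).
  split=> //; right; rewrite mul0n mul0r.
  by apply: sumr_ge0 => t _; apply: sqr_ge0.
pose K := (M * 4 ^ (M * M)).+1.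
exists (M + (K * (2 * K * E).+1 + 4 * K * E)), (n0 + 2 * K * E) => V e lab0 hn.
have [|I [c [lab [s [nc labE reg]]]]] := IHj V e lab0; first by lia.
have [le|lt] := leqP (E * irregular_mass e E c) (#|V| ^ 2).
  exists I, c, lab, s; split=> //; last by left.
  case: nc => h1 h2 h3 h4 h5 h6; split=> //; last by lia.
  by apply: leq_trans h5 _; rewrite leq_mul2r leq_addr orbT.
have {}reg : ((j * #|V| ^ 2)%:R / E%:R ^+ 5 <= pair_energy e R c)%R.
  by case: reg => //; rewrite leqNgt lt.
pose c1 := refine_by_witnesses e E c.
have cI : #|{: I * {ffun I * I -> bool * bool}}| <= K.
  rewrite card_prod card_ffun !card_prod card_bool; apply: leqW.
  have hI := np_card nc; apply: leq_mul => //.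
  by apply: leq_pexp2l => //; apply: leq_mul.
have hn2 : 2 * K * E <= #|V| by apply: leq_trans hn; apply: leq_addl.
have nc1 := chop_nice c1 E_gt0 (ltn0Sn _) cI hn2.
move: nc1; set s1 := _ %/ _ => nc1.
exists _, (chop c1 (2 * s1)), (fun k => lab k.1.1), s1; split.
- case: nc1 => h1 h2 h3 h4 h5 h6; split=> //; last by apply: leq_trans h6 _; apply: leq_addl.
  by apply: leq_trans h5 _; rewrite leq_mul2r leq_addl orbT.
- by move=> v; rewrite -labE.
right; apply: (@le_trans _ _ (pair_energy e R c1)); last first.
  exact: (pair_energy_mono e R (pi := fst)).
apply: le_trans (energy_gain E_gt0 R lt).
by rewrite mulSn addnC natrD mulrDl lerD2r.
Qed.

Lemma regular_partition : exists M n0,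
  forall (V : finType) (e : rel V) (lab0 : V -> bool), n0 <= #|V| ->
  exists (I : finType) (c : V -> I) (lab : I -> bool) s,
    [/\ nice_partition E M c s, forall v, lab (c v) = lab0 v &
        E * irregular_mass e E c <= #|V| ^ 2].
Proof.
(* The energy is at most [#|V| ^ 2], so the energetic alternative is impossible for [E ^ 5 + 1]. The
   threshold [n0.+1] makes [V] nonempty, so that the comparison is strict. *)
have [M [n0 H]] := regular_or_energetic rat (E ^ 5).+1.
exists M, n0.+1 => V e lab0 hn.
have [I [c [lab [s [h1 h2 [h3|h3]]]]]] := H V e lab0 (ltnW hn).
  by exists I, c, lab, s.
have := le_trans h3 (pair_energy_le _ _ _).
have E0 : (0 < E%:R ^+ 5 :> rat)%R by rewrite exprn_gt0 // ltr0n.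
rewrite ler_pdivrMr // -natrX -natrM ler_nat mulnC leq_mul2l ltnn orbF expn_eq0.
by move: hn; case: #|V|.
Qed.

End Regularity.

(** * The reduced graph *)

Section Reduced.
Variables (V : finType) (e : rel V) (I : finType) (c : V -> I).
Hypothesis e_sym : symmetric e.
Implicit Types (u v : V) (i j : I).

Lemma sum_parts (F : V -> nat) : \sum_v F v = \sum_i \sum_(v in part c i) F v.
Proof.
rewrite (partition_big c predT) //=; apply: eq_bigr => i _.
by apply: eq_bigl => v; rewrite inE.
Qed.

Lemma card_parts : \sum_i #|part c i| = #|V|.
Proof.
rewrite -sum1_card sum_parts; apply: eq_bigr => i _.
by rewrite sum1_card.
Qed.

Lemma card_by_parts (A : {set V}) : #|A| = \sum_i #|part c i :&: A|.
Proof.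
rewrite -sum1_card big_mkcond sum_parts; apply: eq_bigr => i _.
rewrite -big_mkcondr -sum1_card; apply: eq_bigl => v.
by rewrite [in RHS]inE.
Qed.

Lemma deg_in_parts u (P : pred I) :
  #|[set v | e u v && P (c v)]| = \sum_(j | P j) deg_in e u (part c j).
Proof.
rewrite -sum1_card (eq_bigl (fun v => e u v && P (c v))); last by move=> v; rewrite inE.
rewrite (partition_big c P) /=; last by move=> v /andP[].
apply: eq_bigr => j Pj; rewrite /deg_in -sum1_card; apply: eq_bigl => v; rewrite !inE.
by have [->|] := eqVneq (c v) j; rewrite ?andbF // Pj !andbT.
Qed.

Variables (E M s : nat) (lab : I -> bool) (lab0 : V -> bool).
Hypothesis E_gt0 : 0 < E.
Hypothesis np : nice_partition E M c s.
Hypothesis labE : forall v, lab (c v) = lab0 v.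
Hypothesis reg : E * irregular_mass e E c <= #|V| ^ 2.

(** Edges between two clusters of small degree are left out: losses are counted only at vertices of
    large degree, and the structure argument relies on every edge having an end of large degree. *)
Definition dense_regular i j :=
  [&& i != j, #|part c i| == 2 * s, #|part c j| == 2 * s, lab i || lab j,
      ~~ irregular e E c i j, ~~ irregular e E c j i &
      2 * (#|part c i| * #|part c j|) <= E * edge_count e (part c i) (part c j)].

Lemma dense_regular_sym : symmetric dense_regular.
Proof.
move=> i j; rewrite /dense_regular eq_sym [lab i || _]orbC edge_count_sym // [#|part c i| * _]mulnC.
by case: (_ == _) => //=; case: (_ == _); case: (_ == _); case: (_ || _); case: irregular; case: irregular.
Qed.

(** Density at least [2 / E], minus a drop of at most [1 / E], leaves density [1 / E] on large
    subpairs. *)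
Lemma dense_regular_edges i j (X Y : {set V}) : dense_regular i j ->
  X \subset part c i -> Y \subset part c j -> 2 * s <= E * #|X| -> 2 * s <= E * #|Y| ->
  #|X| * #|Y| <= E * edge_count e X Y.
Proof.
case/and5P=> _ /eqP ci /eqP cj _ /and3P[irr _ dens] sX sY cX cY.
rewrite leqNgt; apply/negP => lt; case/negP: irr; apply/existsP; exists (X, Y).
rewrite /irregular_witness /= sX sY ci cj cX cY /=.
rewrite ci cj in dens; have s0 := np_pos np.
have xy0 : 0 < #|X| * #|Y| by apply: leq_ltn_trans lt.
apply: (@leq_trans (2 * (2 * s * (2 * s)) * (#|X| * #|Y|))); last by rewrite leq_pmul2r.
by rewrite [X in _ < X]mulnAC ltn_pmul2r //; lia.
Qed.

Definition loss (h : rel I) u := #|[set v | e u v && ~~ h (c u) (c v)]|.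

Lemma total_loss : E * \sum_(u | lab0 u) loss dense_regular u <= 7 * #|V| ^ 2.
Proof.
pose D i j := #|part c i| * #|part c j|.
have sD : \sum_i \sum_j D i j = #|V| ^ 2.
  rewrite -mulnn -{1}card_parts big_distrl /=; apply: eq_bigr => i _.
  by rewrite -big_distrr /= card_parts.
have le1 : \sum_(u | lab0 u) loss dense_regular u <=
    \sum_i \sum_j (if lab i && ~~ dense_regular i j
                   then edge_count e (part c i) (part c j) else 0).
  rewrite big_mkcond sum_parts; apply: leq_sum => i _.
  rewrite (eq_bigr (fun u => \sum_j (if lab i && ~~ dense_regular i j
                   then deg_in e u (part c j) else 0))); last first.
    move=> u; rewrite inE => /eqP cu; rewrite -labE cu.
    case: (lab i) => /=; last by rewrite big1.
    by rewrite /loss cu (deg_in_parts u (fun j => ~~ dense_regular i j)) big_mkcond.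
  rewrite exchange_big /=; apply: leq_sum => j _.
  by case: ifP => _ //; rewrite big1.
apply: leq_trans (leq_mul (leqnn E) le1) _.
(* One term for each reason why a pair is not [dense_regular]: equality, a leftover on either side,
   irregularity in either order, low density. The first five cost at most [#|V| ^ 2] each and the
   last one twice that, hence the constant 7. *)
pose G i j := (if i == j then E * D i j else 0)
  + (if #|part c i| != 2 * s then E * D i j else 0)
  + (if #|part c j| != 2 * s then E * D i j else 0)
  + (if irregular e E c i j then E * D i j else 0)
  + (if irregular e E c j i then E * D i j else 0) + 2 * D i j.
apply: (@leq_trans (\sum_i \sum_j G i j)).
  rewrite big_distrr /=; apply: leq_sum => i _.
  rewrite big_distrr /=; apply: leq_sum => j _.
  have eD := edge_count_card e (part c i) (part c j); rewrite -/(D i j) in eD.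
  case: ifP => [/andP[li]|_]; last by rewrite muln0.
  rewrite /dense_regular li /= /G -/(D i j).
  have {}eD : E * edge_count e (part c i) (part c j) <= E * D i j by rewrite leq_mul2l eD orbT.
  case: eqP => _ /=; first by move: eD; clear; lia.
  case: eqP => _ /=; last by move: eD; clear; lia.
  case: eqP => _ /=; last by move: eD; clear; lia.
  case: irregular => /=; first by move: eD; clear; lia.
  case: irregular => /=; first by move: eD; clear; lia.
  by rewrite -ltnNge => /ltnW; clear; lia.
have p1 : \sum_i \sum_j (if i == j then E * D i j else 0) <= #|V| ^ 2.
  apply: (@leq_trans (\sum_i E * (2 * s) * #|part c i|)).
    apply: leq_sum => i _; rewrite (bigD1 i) //= eqxx big1 ?addn0; last first.
      by move=> j /negPf; rewrite eq_sym => ->.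
    by rewrite /D mulnA leq_mul2r leq_mul2l (np_size np) !orbT.
  by rewrite -big_distrr /= card_parts -mulnn leq_mul2r mulnC (np_small np) orbT.
have p2 : \sum_i \sum_j (if #|part c i| != 2 * s then E * D i j else 0) <= #|V| ^ 2.
  rewrite (eq_bigr (fun i => (if #|part c i| != 2 * s then E * #|part c i| else 0) * #|V|)).
    rewrite -big_distrl /= -big_mkcond /= -big_distrr /= -mulnn leq_mul2r.
    by rewrite (np_leftover np) orbT.
  move=> i _; case: ifP => _; last by rewrite mul0n big1.
  by rewrite -card_parts big_distrr /=; apply: eq_bigr => j _; rewrite /D mulnA.
have p3 : \sum_i \sum_j (if #|part c j| != 2 * s then E * D i j else 0) <= #|V| ^ 2.
  rewrite exchange_big /=; apply: leq_trans p2; apply: leq_sum => i _.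
  by apply: leq_sum => j _; rewrite /D [_ * #|part c i|]mulnC.
have p4 : \sum_i \sum_j (if irregular e E c i j then E * D i j else 0) <= #|V| ^ 2.
  apply: leq_trans reg; rewrite /irregular_mass big_distrr /=; apply: leq_sum => i _.
  by rewrite -big_mkcond big_distrr.
have p5 : \sum_i \sum_j (if irregular e E c j i then E * D i j else 0) <= #|V| ^ 2.
  rewrite exchange_big /=; apply: leq_trans p4; apply: leq_sum => i _.
  by apply: leq_sum => j _; rewrite /D [_ * #|part c i|]mulnC.
have -> : \sum_i \sum_j G i j = \sum_i \sum_j (if i == j then E * D i j else 0)
  + \sum_i \sum_j (if #|part c i| != 2 * s then E * D i j else 0)
  + \sum_i \sum_j (if #|part c j| != 2 * s then E * D i j else 0)
  + \sum_i \sum_j (if irregular e E c i j then E * D i j else 0)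
  + \sum_i \sum_j (if irregular e E c j i then E * D i j else 0)
  + \sum_i \sum_j 2 * D i j.
  by rewrite -!big_split /=; apply: eq_bigr => i _; rewrite -!big_split.
have -> : \sum_i \sum_j 2 * D i j = 2 * #|V| ^ 2.
  by rewrite -sD big_distrr /=; apply: eq_bigr => i _; rewrite big_distrr.
by move: p1 p2 p3 p4 p5; clear; lia.
Qed.

Variable S : nat.
Hypotheses (S_gt0 : 0 < S) (SE : 7 * S * S <= E).

Definition atypical := [set u | lab0 u && (#|V| < S * loss dense_regular u)].

(** Markov's inequality for [total_loss]; the requirement [7 * S * S <= E] stems from here. *)
Lemma card_atypical : S * #|atypical| <= #|V|.
Proof.
have [V0|V0] := posnP #|V|.
  by have := max_card (mem atypical); rewrite V0 leqn0 => /eqP ->; rewrite muln0.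
have le : #|V| * #|atypical| <= S * \sum_(u | lab0 u) loss dense_regular u.
  rewrite mulnC -sum_nat_const big_distrr /=.
  rewrite (eq_bigl (fun u => lab0 u && (#|V| < S * loss dense_regular u))); last first.
    by move=> u; rewrite inE.
  rewrite big_mkcondr /=; apply: leq_sum => u _.
  by case: ltnP => // /ltnW.
have : 7 * S * (S * #|atypical|) * #|V| <= 7 * S * #|V| * #|V|.
  have h1 : E * (#|V| * #|atypical|) <= S * (7 * #|V| ^ 2).
    apply: leq_trans (leq_mul (leqnn E) le) _.
    by rewrite mulnCA leq_mul2l total_loss orbT.
  have h2 : 7 * S * S * (#|V| * #|atypical|) <= E * (#|V| * #|atypical|).
    by rewrite leq_mul2r SE orbT.
  have h3 := leq_trans h2 h1.
  have -> : 7 * S * (S * #|atypical|) * #|V| = 7 * S * S * (#|V| * #|atypical|) by ring.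
  by apply: leq_trans h3 _; apply: eq_leq; rewrite -mulnn; ring.
rewrite leq_pmul2r // leq_pmul2l //.
by rewrite muln_gt0 S_gt0.
Qed.

(** Giving up these clusters ensures that every full cluster of large degree that is kept has at
    least [s] typical vertices from which seeds can be chosen. *)
Definition dead i := lab i && (s < #|part c i :&: atypical|).

Definition reduced i j := [&& dense_regular i j, ~~ dead i & ~~ dead j].

Definition typical := [set u | [&& lab0 u, u \notin atypical & ~~ dead (c u)]].

Lemma card_dead : S * #|[set v | dead (c v)]| <= 2 * #|V|.
Proof.
have : #|[set v | dead (c v)]| <= 2 * #|atypical|.
  rewrite [#|[set v | _]|]card_by_parts [#|atypical|]card_by_parts big_distrr /=.
  apply: leq_sum => i _; have [di|ndi] := boolP (dead i).
    apply: leq_trans (subset_leq_card (subsetIl _ _)) _.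
    by apply: leq_trans (np_size np i) _; case/andP: di => _ /ltnW; rewrite leq_mul2l.
  rewrite (_ : _ :&: _ = set0) ?cards0 //; apply/setP => v; rewrite !inE.
  by case: eqP => //= ->; rewrite (negPf ndi).
by have := card_atypical; nia.
Qed.

Lemma card_not_typical : S * #|[set v | lab0 v && (v \notin typical)]| <= 3 * #|V|.
Proof.
have : #|[set v | lab0 v && (v \notin typical)]| <= #|atypical| + #|[set v | dead (c v)]|.
  apply: leq_trans (leq_card_setU _ _); apply/subset_leq_card/subsetP => v.
  by rewrite !inE; case: (lab0 v) => //=; rewrite negb_and !negbK.
by have := card_atypical; have := card_dead; nia.
Qed.

Lemma typical_loss u : u \in typical -> S * loss reduced u <= 3 * #|V|.
Proof.
rewrite inE => /and3P[lu ua du].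
have : loss reduced u <= loss dense_regular u + #|[set v | dead (c v)]|.
  apply: leq_trans (leq_card_setU _ _); apply/subset_leq_card/subsetP => v.
  rewrite !inE /reduced du /=; case: (e u v) => //=; rewrite negb_and negbK.
  by case: dense_regular.
move=> h; apply: leq_trans (leq_mul (leqnn S) h) _; rewrite mulnDr.
move: ua; rewrite inE lu /= -leqNgt; have := card_dead.
by move: (S * _) (S * _) #|V| => x y n; lia.
Qed.

Lemma reduced_typical i j : reduced i j -> lab i -> s <= #|part c i :&: typical|.
Proof.
case/and3P=> /and5P[_ /eqP ci _ _ _] di _ li; move: (di); rewrite /dead li /= -leqNgt.
have -> : part c i :&: typical = part c i :\: atypical.
  apply/setP => v; rewrite !in_setI in_setD [v \in typical]inE andbC.
  have [/[!inE]/eqP cv|] := boolP (v \in part c i); last by rewrite !andbF.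
  by rewrite -labE cv li di !andbT.
by rewrite cardsD ci; lia.
Qed.

End Reduced.

(** * The structure of the reduced graph *)

(** Up to small errors the first two hypotheses say [2 (LI - SN) <= W] and [W (D + tau) <= 2 D u],
    where [u <= LI - SN]. Because of the surplus [tau] they are compatible only if [W] is tiny, and
    then so are [LI - SN] and [x]. *)
Lemma uncovered_bound S S0 D tau n LI SN W u x :
  S * (2 * (D * LI)) <= S * (2 * (D * SN) + D * W) + 20 * (n * n) ->
  W * (D + tau) <= 2 * (D * u) -> u + SN <= LI -> x + 2 * SN <= 2 * LI ->
  n <= S0 * D -> n <= 16 * S0 * tau -> D <= n -> 0 < tau -> 0 < S0 -> 0 < D ->
  11 * (1000 * (S0 * S0)) <= S -> 2 * x <= tau.
Proof.
move=> h1 h2 h3 h4 nD nt Dn t0 S00 D0 hS.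
have [y yE] : exists y, LI = SN + y by exists (LI - SN); lia.
have uy : u <= y by lia.
have xy : x <= 2 * y by lia.
have {}h1 : S * (2 * (D * y)) <= S * (D * W) + 20 * (n * n).
  by move: h1; rewrite yE !mulnDr; lia.
have h5 : S * (W * tau) <= 20 * (n * n).
  have : S * (W * (D + tau)) <= S * (2 * (D * y)).
    by rewrite leq_mul2l; apply/orP; right; apply: leq_trans h2 _; rewrite !leq_mul2l uy !orbT.
  by rewrite !mulnDr [W * D]mulnC; lia.
have h6 : S * W <= 320 * (S0 * n).
  rewrite -(leq_pmul2r t0) -mulnA; apply: leq_trans h5 _.
  have -> : 320 * (S0 * n) * tau = 20 * (n * (16 * S0 * tau)) by ring.
  by rewrite !leq_mul2l nt !orbT.
have h7 : 2 * (S * y) <= 340 * (S0 * n).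
  rewrite -(leq_pmul2r D0).
  have -> : 2 * (S * y) * D = S * (2 * (D * y)) by ring.
  apply: leq_trans h1 _.
  have : S * (D * W) <= D * (320 * (S0 * n)) by rewrite mulnCA leq_mul2l h6 orbT.
  have : n * n <= n * (S0 * D) by rewrite leq_mul2l nD orbT.
  have -> : n * (S0 * D) = D * (S0 * n) by ring.
  have -> : 340 * (S0 * n) * D = 340 * (D * (S0 * n)) by ring.
  have -> : D * (320 * (S0 * n)) = 320 * (D * (S0 * n)) by ring.
  by move: (S * (D * W)) (n * n) (D * (S0 * n)); lia.
have h8 : S * x <= 16 * 340 * (S0 * S0 * tau).
  have : S * x <= 2 * (S * y) by rewrite mulnCA leq_mul2l xy orbT.
  have : S0 * n <= S0 * (16 * S0 * tau) by rewrite leq_mul2l nt orbT.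
  have -> : S0 * (16 * S0 * tau) = 16 * (S0 * S0 * tau) by ring.
  by move: h7; move: (S * x) (S * y) (S0 * n) (S0 * S0 * tau); clear; lia.
have h9 : 11 * (1000 * (S0 * S0)) * x <= 16 * 340 * (S0 * S0 * tau).
  by apply: leq_trans h8; rewrite leq_mul2r hS orbT.
have q0 : 0 < S0 * S0 by rewrite muln_gt0 S00.
rewrite -(leq_pmul2l q0); move: h9.
have -> : 11 * (1000 * (S0 * S0)) * x = 11 * 500 * (S0 * S0 * (2 * x)) by ring.
by move: (S0 * S0 * _) (S0 * S0 * _); lia.
Qed.

(** [L] vertices send about [D] edges each to a set of [L'] vertices, of which all but [O] take at
    most [D - tau]. With [L' <= L] this makes [L'] small, and then [L] as well, against
    [n <= 2 * L]. *)
Lemma bipartite_contradiction S S0 D tau n L L' O :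
  S * (D * L) + S * (tau * (L' - O)) <= S * (D * L') + 6 * (n * n) ->
  S * O <= n -> n <= 2 * L -> L' <= L ->
  n <= S0 * D -> n <= 16 * S0 * tau -> 0 < tau -> 0 < S0 -> 0 < D -> 0 < n ->
  11 * (1000 * (S0 * S0)) <= S -> False.
Proof.
move=> h1 h2 h3 h4 nD nt t0 S00 D0 n0 hS.
have nn : n * n <= n * (S0 * D) by rewrite leq_mul2l nD orbT.
have h5 : S * L <= S * L' + 6 * (S0 * n).
  rewrite -(leq_pmul2r D0).
  have -> : (S * L' + 6 * (S0 * n)) * D = S * (D * L') + 6 * (n * (S0 * D)) by ring.
  have -> : S * L * D = S * (D * L) by ring.
  by move: h1 nn; move: (S * (D * L)) (S * (tau * _)) (S * (D * L')) (n * n) (n * (S0 * D)); lia.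
have h6 : S * L' <= 96 * (S0 * n) + S * O.
  rewrite -(leq_pmul2r t0).
  have -> : (96 * (S0 * n) + S * O) * tau = 6 * (n * (16 * S0 * tau)) + S * O * tau by ring.
  have nt' : n * n <= n * (16 * S0 * tau) by rewrite leq_mul2l nt orbT.
  have h7 : S * (D * L') <= S * (D * L) by rewrite !leq_mul2l h4 !orbT.
  have h8 : S * L' * tau <= S * (tau * (L' - O)) + S * O * tau.
    rewrite [tau * _]mulnC mulnA -mulnDl leq_mul2r -mulnDr leq_mul2l.
    by apply/orP; right; apply/orP; right; lia.
  by move: h1 nt' h7 h8; move: (S * (D * L)) (S * (tau * _)) (S * (D * L')) (n * n)
    (n * (16 * S0 * tau)) (S * L' * tau) (S * O * tau); lia.
have h9 : S * n <= 206 * (S0 * n).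
  have : S * n <= S * (2 * L) by rewrite leq_mul2l h3 orbT.
  have : n <= S0 * n by rewrite leq_pmull.
  rewrite [S * (2 * L)]mulnCA; move: h5 h6 h2.
  by move: (S * n) (S * L) (S * L') (S * O) (S0 * n); lia.
rewrite mulnA leq_pmul2r // in h9.
have : S0 <= S0 * S0 by rewrite leq_pmull.
by move: hS h9; move: (S0 * S0); lia.
Qed.

Section Structure.
Variables (V : finType) (e : rel V) (I : finType) (c : V -> I) (h : rel I).
Variables (lab : I -> bool) (lab0 : V -> bool) (typ : {set V}).
Variables (s E S S0 D tau : nat).
Hypotheses (e_sym : symmetric e) (h_sym : symmetric h) (s_gt0 : 0 < s).
Hypothesis h_size : forall i j, h i j -> #|part c i| = 2 * s.
Hypothesis h_lab : forall i j, h i j -> lab i || lab j.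
Hypothesis labE : forall v, lab (c v) = lab0 v.
Hypothesis lab0E : forall v, lab0 v = (D <= deg_in e v setT).
Hypothesis typ_lab : {in typ, forall v, lab0 v}.
Hypothesis typ_loss : {in typ, forall v, S * loss e c h v <= 3 * #|V|}.
Hypothesis few_atypical : S * #|[set v | lab0 v && (v \notin typ)]| <= 3 * #|V|.
Hypothesis h_typ : forall i j, h i j -> lab i -> s <= #|part c i :&: typ|.
Hypothesis half : #|V| <= 2 * #|[set v | lab0 v]|.
Hypotheses (DV : D <= #|V|) (VD : #|V| <= S0 * D).
Hypotheses (tauV : 8 * S0 * tau <= #|V|) (Vtau : #|V| <= 16 * S0 * tau).
Hypotheses (S0_gt0 : 0 < S0) (SE : 11 * (1000 * (S0 * S0)) <= S) (ES : S <= E).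
Hypothesis tau_gt0 : 0 < tau.
Implicit Types (u v : V) (i j : I) (X : {set I}).

Let n := #|V|.
Let K := D - 2 * tau.

Definition verts X := [set v | c v \in X].

Definition red_adj u v := e u v && h (c u) (c v).
Local Notation e' := red_adj.

(* [ph] is a perfect fractional matching of [Cov], and both ends of a dense pair
   have large degree into [Cov]. *)
Definition covered_case := exists (Cov : {set I}) (ph : I -> I) i0 j0 (A B : {set V}),
  [/\ {in Cov &, injective ph}, {in Cov, forall i, ph i \in Cov /\ h i (ph i)},
      h i0 j0 /\ A \subset part c i0 /\ B \subset part c j0,
      2 * s <= E * #|A| /\ 2 * s <= E * #|B| &
      {in A :|: B, forall a, K <= deg_in e a (verts Cov)}].

(** [A] has its room on the ends in [N] of the matching edges; [B] has half as much, counted on both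
    ends and in [La]. The degree bound for the clusters of [La] provides the second side for pieces
    that start there. *)
Definition one_sided_case := exists (N La : {set I}) (ps : I -> I) i0 j0 (A B : {set V}),
  [/\ {in N &, injective ps} /\ {in N, forall i, ps i \notin N /\ h i (ps i)},
      {in La, forall j, [/\ j \notin N, j \notin ps @: N &
                            K <= 2 * s * #|[set i | h j i]|]},
      h i0 j0 /\ A \subset part c i0 /\ B \subset part c j0,
      2 * s <= E * #|A| /\ 2 * s <= E * #|B| &
      {in A, forall a, K <= deg_in e a (verts N)} /\
      {in B, forall b, K <= 2 * deg_in e b (verts (N :|: ps @: N :|: La))}].

Lemma red_adj_sym : symmetric e'.
Proof. by move=> u v; rewrite /red_adj e_sym h_sym. Qed.

Lemma deg_red_loss v : deg_in e v setT = deg_in e' v setT + loss e c h v.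
Proof.
rewrite /deg_in -(cardsID [set w | h (c v) (c w)]); congr (_ + _).
  by apply: eq_card => w; rewrite !inE.
by apply: eq_card => w; rewrite !inE andbC.
Qed.

Lemma deg_red_le v (X : {set V}) : deg_in e' v X <= deg_in e v X.
Proof.
apply/subset_leq_card/subsetP => w; rewrite !inE => /andP[-> /andP[-> _]].
by [].
Qed.

Lemma typ_deg v : v \in typ -> D <= deg_in e' v setT + loss e c h v /\ 2 * loss e c h v <= tau.
Proof.
move=> vt; split; first by rewrite -deg_red_loss -lab0E typ_lab.
have h1 := typ_loss vt; move: (loss _ _ _ _) h1 => x h1.
have h3 : 48 * S0 * (2 * x) <= 48 * S0 * tau.
  have -> : 48 * S0 * tau = 3 * (16 * S0 * tau) by ring.
  apply: leq_trans (leq_mul (leqnn 3) Vtau); apply: leq_trans h1.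
  apply: leq_trans (leq_mul SE (leqnn x)).
  have -> : 48 * S0 * (2 * x) = 96 * (S0 * x) by ring.
  have -> : 11 * (1000 * (S0 * S0)) * x = 11 * 1000 * (S0 * (S0 * x)) by ring.
  by apply: leq_mul => //; apply: leq_pmull.
by rewrite leq_pmul2l in h3; [exact: h3 | rewrite muln_gt0].
Qed.

Lemma K_gt0 : 0 < K.
Proof.
have : 8 * S0 * tau <= S0 * D by apply: leq_trans tauV VD.
by rewrite -mulnA mulnCA leq_pmul2l // /K; lia.
Qed.

Lemma deg_red_verts v X : (forall j, h (c v) j -> j \in X) ->
  deg_in e' v (verts X) = deg_in e' v setT.
Proof.
move=> hX; apply: eq_card => w; rewrite !inE /=; apply/andP/idP => [[]//|hw].
by have /andP[_ hvw] := hw; split=> //; apply: hX.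
Qed.

Lemma typ_deg_verts v X : v \in typ -> (forall j, h (c v) j -> j \in X) ->
  K <= deg_in e v (verts X).
Proof.
move=> vt hX; have [h1 h2] := typ_deg vt.
apply: leq_trans (deg_red_le v (verts X)); rewrite deg_red_verts // /K.
by move: h1 h2; clear; lia.
Qed.

Lemma E_big : 2 <= E.
Proof.
apply: leq_trans ES; apply: leq_trans SE.
have : 0 < S0 * S0 by rewrite muln_gt0 S0_gt0.
by move: (S0 * S0) => x; lia.
Qed.

Lemma typ_big i j : h i j -> lab i -> 2 * s <= E * #|part c i :&: typ|.
Proof. by move=> hij li; apply: leq_mul; [apply: E_big | apply: h_typ hij li]. Qed.

Lemma part_inP i v : v \in part c i -> c v = i.
Proof. by rewrite inE => /eqP. Qed.

(** A matching becomes a permutation by exchanging the ends of its edges, and this is glued to [ph]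
    on [Q]. *)
Lemma matching_perm (N Q : {set I}) (ps ph : I -> I) :
  {in N &, injective ps} -> {in N, forall i, ps i \notin N /\ h i (ps i)} ->
  {in Q &, injective ph} -> {in Q, forall i, ph i \in Q /\ h i (ph i)} ->
  [disjoint Q & N :|: ps @: N] ->
  exists f, {in N :|: ps @: N :|: Q &, injective f} /\
    {in N :|: ps @: N :|: Q, forall i, f i \in N :|: ps @: N :|: Q /\ h i (f i)}.
Proof.
move=> ips hps iph hph dQ.
pose inv j := odflt j [pick i in N | ps i == j].
have invK j : j \in ps @: N -> inv j \in N /\ ps (inv j) = j.
  move=> /imsetP[i iN ->]; rewrite /inv; case: pickP => [k /andP[kN /eqP E']|/(_ i)] //=.
  by rewrite iN eqxx.
have nN j : j \in ps @: N -> j \notin N by move=> /imsetP[i iN ->]; case: (hps i iN).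
have nQ j : j \in Q -> j \notin N /\ j \notin ps @: N.
  by move=> jQ; have := disjointFr dQ jQ; rewrite in_setU => /negbT; rewrite negb_or => /andP.
pose f i := if i \in Q then ph i else if i \in N then ps i else inv i.
have fQ i : i \in Q -> f i = ph i by rewrite /f => ->.
have fN i : i \in N -> f i = ps i.
  by move=> iN; rewrite /f iN; case: ifP => // /nQ[]; rewrite iN.
have fI i : i \in ps @: N -> f i = inv i.
  by move=> iI; rewrite /f (negPf (nN i iI)); case: ifP => // /nQ[_]; rewrite iI.
have hf i : i \in N :|: ps @: N :|: Q -> h i (f i) /\
    [\/ i \in N /\ f i \in ps @: N, i \in ps @: N /\ f i \in N | i \in Q /\ f i \in Q].
  rewrite !in_setU => /orP[/orP[iN|iI]|iQ].
  - by rewrite fN //; case: (hps i iN) => _ ->; split=> //; constructor 1; rewrite imset_f.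
  - rewrite fI //; have [iN E'] := invK i iI; split; last by constructor 2.
    by rewrite h_sym -{2}E'; case: (hps _ iN).
  - by rewrite fQ //; case: (hph i iQ) => -> ->; split=> //; constructor 3.
exists f; split; last first.
  move=> i iC; have [hi cases] := hf i iC; split=> //; rewrite !in_setU.
  by case: cases => -[_ ->]; rewrite ?orbT.
move=> i j iC jC E'; have [_ ci] := hf i iC; have [_ cj] := hf j jC.
case: ci => -[ii fi]; case: cj => -[jj fj].
- by move: E'; rewrite !fN //; apply: ips.
- by rewrite -E' in fj; have := nN _ fi; rewrite fj.
- by rewrite -E' in fj; have [_] := nQ _ fj; rewrite fi.
- by rewrite E' in fi; have := nN _ fj; rewrite fi.
- move: E'; rewrite !fI // => E'; have [_ <-] := invK i ii; have [_ <-] := invK j jj.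
  by rewrite E'.
- by rewrite -E' in fj; have [] := nQ _ fj; rewrite fi.
- by rewrite E' in fi; have [_] := nQ _ fi; rewrite fj.
- by rewrite E' in fi; have [] := nQ _ fi; rewrite fj.
- by move: E'; rewrite !fQ //; apply: iph.
Qed.

(* Either there is an edge between two clusters of large degree inside the part
   with a perfect fractional matching, or the rest of the reduced graph is
   bipartite with one side matched into the other. *)
Lemma covered_or_bipartite : covered_case \/
  exists (N : {set I}) (ps : I -> I), [/\ {in ~: N &, forall i j, ~~ h i j},
    {in N &, injective ps} & {in N, forall i, ps i \notin N /\ h i (ps i)}].
Proof.
have [I0 [ps [ph [/independentP indI [ips hps] [iph hph]]]]] := independent_decomposition h_sym.
set N := nbs h I0 in ips hps iph hph; set Q := ~: (I0 :|: N) in iph hph.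
have IN i : i \in I0 -> i \notin N.
  by move=> iI; apply/negP => /nbsP[j jI hji]; have := indI j i jI iI; rewrite hji.
have QE i : i \in Q = (i \notin I0) && (i \notin N) by rewrite in_setC in_setU negb_or.
have Qnb i j : i \in Q -> h i j -> j \in N :|: ps @: N :|: Q.
  rewrite QE => /andP[iI iN] hij; have jI : j \notin I0.
    by apply: contra iN => jI; apply/nbsP; exists j; rewrite // h_sym.
  by rewrite !in_setU QE jI /=; case: (j \in N); rewrite ?orbT.
have [/existsP[i /existsP[j /and5P[iQ jQ hij li lj]]]|noLL] := boolP [exists i, exists j,
    [&& i \in Q, j \in Q, h i j, lab i & lab j]].
  left; have [//||//|||f [fi hf]] := @matching_perm N Q ps ph.
  - by move=> k kN; have [hk kI] := hps k kN; split=> //; apply: IN.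
  - by move=> k kQ; have [] := hph k kQ.
  - rewrite -setI_eq0; apply/eqP/setP => k; rewrite in_set0 in_setI QE in_setU.
    apply/negP => /andP[/andP[kI kN] /orP[kN'|/imsetP[k' k'N ek]]].
      by rewrite kN' in kN.
    by have [_] := hps k' k'N; rewrite -ek (negPf kI).
  exists (N :|: ps @: N :|: Q), f, i, j, (part c i :&: typ), (part c j :&: typ); split=> //.
  - by split=> //; rewrite !subsetIl.
  - by split; [apply: typ_big hij li | apply: typ_big lj; rewrite h_sym; exact: hij].
  - move=> a; rewrite -setIUl inE => /andP[aij at_]; apply: typ_deg_verts => // k.
    move: aij; rewrite in_setU => /orP[] /part_inP ->; exact: Qnb.
(* The small clusters of [Q] join [N]. Their images under [ph] are large, as no edge joins two small
   clusters, and the large clusters of [Q] are independent by [noLL]. *)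
right; exists (N :|: [set i in Q | ~~ lab i]), (fun i => if i \in N then ps i else ph i).
have CE i : i \notin N :|: [set i in Q | ~~ lab i] -> i \in I0 \/ i \in Q /\ lab i.
  rewrite in_setU inE QE negb_or => /andP[iN]; rewrite iN andbT negb_and !negbK.
  by case/orP=> [|li]; [left | case: (boolP (i \in I0)) => iI; [left | right]].
have ind i j : i \in I0 -> j \in Q -> ~~ h i j.
  by rewrite QE => iI /andP[_]; apply: contra => hij; apply/nbsP; exists i.
have QQ i j : i \in Q -> j \in Q -> lab i -> lab j -> ~~ h i j.
  move=> iQ jQ li lj; apply: contra noLL => hij.
  by apply/existsP; exists i; apply/existsP; exists j; rewrite iQ jQ hij li lj.
have SQ i : i \in N :|: [set i in Q | ~~ lab i] -> i \notin N ->
    [/\ i \in Q, ~~ lab i & lab (ph i)].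
  rewrite in_setU => /orP[->//|]; rewrite inE => /andP[iQ li] _; split=> //.
  by have [hi _] := hph i iQ; have := h_lab hi; rewrite (negPf li).
split.
- move=> i j; rewrite !in_setC => /CE ci /CE cj.
  case: ci => [iI|[iQ li]]; case: cj => [jI|[jQ lj]].
  + exact: indI.
  + exact: ind.
  + by rewrite h_sym; apply: ind.
  + exact: QQ.
- move=> i j iN jN /=; case: ifPn => iN'; case: ifPn => jN'.
  + exact: ips.
  + have [jQ _ _] := SQ j jN jN'; have [_] := hph j jQ; rewrite QE => /andP[nI _] E'.
    by have [_] := hps i iN'; rewrite E' (negPf nI).
  + have [iQ _ _] := SQ i iN iN'; have [_] := hph i iQ; rewrite QE => /andP[nI _] E'.
    by have [_] := hps j jN'; rewrite -E' (negPf nI).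
  + by have [iQ _ _] := SQ i iN iN'; have [jQ _ _] := SQ j jN jN'; apply: iph.
- move=> i iN /=; rewrite in_setU inE negb_or negb_and negbK; case: ifPn => iN'.
    have [hi pI] := hps i iN'; split=> //; rewrite IN //= QE pI //.
  have [iQ li lp] := SQ i iN iN'; have [hi pQ] := hph i iQ.
  by rewrite lp orbT andbT; move: pQ; rewrite QE => /andP[_ ->].
Qed.

Lemma card_verts X : #|verts X| = \sum_(i in X) #|part c i|.
Proof.
rewrite (card_by_parts c) [RHS]big_mkcond /=; apply: eq_bigr => i _; case: ifP => iX.
  by apply: eq_card => v; rewrite !inE; case: eqP => // ->; rewrite iX.
rewrite (_ : _ :&: _ = set0) ?cards0 //; apply/setP => v; rewrite !inE.
by case: eqP => //= ->; rewrite iX.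
Qed.

Lemma card_verts_full X : {in X, forall i, #|part c i| = 2 * s} ->
  #|verts X| = #|X| * (2 * s).
Proof. by move=> hX; rewrite card_verts (eq_bigr _ hX) sum_nat_const. Qed.

Lemma light_deg v (X : {set V}) : ~~ lab0 v -> deg_in e' v X <= D.
Proof.
rewrite lab0E -ltnNge => lt; apply: leq_trans (ltnW lt).
by apply: leq_trans (deg_red_le _ _) (deg_in_sub _ _ (subsetT _)).
Qed.

Lemma K_tau : K + 2 * tau = D.
Proof. by have := K_gt0; rewrite /K; lia. Qed.

(** A typical vertex loses at most [3 n / S] of its degree, and at most [3 n / S] vertices of [X]
    are atypical; together this is the error [6 n ^ 2 / S]. *)
Lemma typical_edges (X Y : {set V}) :
  {in X, forall v, lab0 v} -> {in X, forall v w, e' v w -> w \in Y} ->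
  S * (D * #|X|) <= S * edge_count e' (X :&: typ) Y + 6 * (n * n).
Proof.
move=> lX XY.
have c1 : S * #|X :\: typ| <= 3 * n.
  apply: leq_trans few_atypical; rewrite leq_mul2l; apply/orP; right.
  apply/subset_leq_card/subsetP => v; rewrite in_setD inE => /andP[vt vX].
  by rewrite vt lX.
have c2 : S * (D * #|X :&: typ|) <= S * edge_count e' (X :&: typ) Y + 3 * (n * n).
  apply: (@leq_trans (\sum_(v in X :&: typ) (S * deg_in e' v Y + 3 * n))).
    rewrite mulnA mulnC -sum_nat_const; apply: leq_sum => v; rewrite inE => /andP[vX vt].
    have -> : deg_in e' v Y = deg_in e' v setT.
      by apply: eq_card => w; rewrite !inE andb_idl // => /(XY v vX).
    have [h1 _] := typ_deg vt; have h2 := typ_loss vt.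
    have : S * D <= S * (deg_in e' v setT + loss e c h v) by rewrite leq_mul2l h1 orbT.
    rewrite mulnDr => /leq_trans; apply; rewrite leq_add2l; exact: h2.
  rewrite big_split /= -big_distrr /= sum_nat_const leq_add2l mulnCA leq_mul2l /=.
  by rewrite leq_mul2r max_card orbT.
have c3 : S * (D * #|X :\: typ|) <= 3 * (n * n).
  by rewrite mulnCA mulnA [D * _]mulnC -mulnA mulnCA; apply: leq_trans (leq_mul DV c1) _; apply: eq_leq; rewrite -/n; ring.
have -> : #|X| = #|X :&: typ| + #|X :\: typ| by rewrite cardsID.
rewrite !mulnDr; move: c2 c3.
by move: (S * (D * #|X :&: typ|)) (S * (D * #|X :\: typ|)) (S * edge_count _ _ _) (n * n); lia.
Qed.

(* Take the matching that covers as many clusters of small degree as possible. *)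
Lemma best_matching (N : {set I}) (ps0 : I -> I) :
  {in N &, injective ps0} -> {in N, forall i, ps0 i \notin N /\ h i (ps0 i)} ->
  exists ps : I -> I, [/\ {in N &, injective ps},
    {in N, forall i, ps i \notin N /\ h i (ps i)} &
    {in N, forall j k, lab (ps j) -> ~~ lab k -> k \notin N -> k \notin ps @: N -> ~~ h j k}].
Proof.
move=> i0 h0.
pose ok (f : {ffun I -> I}) := [forall i in N, (f i \notin N) && h i (f i)] &&
  [forall i in N, forall j in N, (f i == f j) ==> (i == j)].
have okP (f : {ffun I -> I}) : {in N &, injective f} ->
    {in N, forall i, f i \notin N /\ h i (f i)} -> ok f.
  move=> fi fh; apply/andP; split; apply/forall_inP => i iN.
    by have [-> ->] := fh i iN.
  by apply/forall_inP => j jN; apply/implyP => /eqP /(fi i j iN jN) ->.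
have ok0 : ok [ffun i => ps0 i].
  by apply: okP => [i j iN jN|i iN]; rewrite !ffunE; [apply: i0 | apply: h0].
case: (arg_maxnP (fun f : {ffun I -> I} => #|[set i in N | ~~ lab (f i)]|) ok0).
move=> ps okps max.
have ips : {in N &, injective ps}.
  move=> i j iN jN E'; case/andP: okps => _ /forall_inP /(_ i iN) /forall_inP /(_ j jN).
  by rewrite E' eqxx => /eqP.
have hps : {in N, forall i, ps i \notin N /\ h i (ps i)}.
  by move=> i iN; case/andP: okps => /forall_inP /(_ i iN) /andP.
exists ps; split=> // j jN u lj lu uN uI; apply/negP => hju.
(* Exchanging the large partner of [j] for the uncovered small cluster [u] would increase the number
   of small partners. *)
pose f := [ffun i => if i == j then u else ps i].
have okf : ok f.
  apply: okP => [i k iN kN|i iN]; rewrite !ffunE.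
    case: eqP => [->|_]; case: eqP => [->|_] //.
    - by move=> E'; case/negP: uI; rewrite E' imset_f.
    - by move=> E'; case/negP: uI; rewrite -E' imset_f.
    - exact: ips.
  by case: eqP => [->|_]; [split | apply: hps].
have := max _ okf; rewrite /= leqNgt => /negP; apply.
apply: (@proper_card _ (mem [set i in N | ~~ lab (ps i)])); apply/properP; split.
  apply/subsetP => i; rewrite !inE ffunE => /andP[-> li] /=.
  by case: eqP => // E'; rewrite -E' lj in li.
by exists j; rewrite !inE ?ffunE ?eqxx jN ?lj // lu.
Qed.

(** * The case of a reduced graph with an independent side matched from [N] *)

Section Bipartite.
Variables (N : {set I}) (ps : I -> I).
Hypothesis indN : {in ~: N &, forall i j, ~~ h i j}.
Hypothesis ips : {in N &, injective ps}.
Hypothesis hps : {in N, forall i, ps i \notin N /\ h i (ps i)}.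
Hypothesis best : {in N, forall j k, lab (ps j) -> ~~ lab k -> k \notin N ->
  k \notin ps @: N -> ~~ h j k}.

(** [U] collects the small clusters that the matching leaves uncovered. In the names of the vertex
    sets, [L] and [S] stand for large and small degree, and the last letter tells whether the
    cluster lies in the independent side [I] or in [N]. *)
Let U := [set k | [&& k \notin N, ~~ lab k & k \notin ps @: N]].
Let LI := verts [set i | (i \notin N) && lab i].
Let SI := verts [set i | (i \notin N) && ~~ lab i].
Let LN := verts [set i in N | lab i].
Let SN := verts [set i in N | ~~ lab i].

(** The candidates for [B] in the one-sided case: at least [K / 2] of the degree avoids the
    uncovered small clusters. *)
Definition second_seeds j := [set b in part c j :&: typ |
  K <= 2 * deg_in e' b (~: verts U)].

Lemma psN i : i \in N -> ps i \notin N. Proof. by case/hps. Qed.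
Lemma psh i : i \in N -> h i (ps i). Proof. by case/hps. Qed.

Lemma nb_in_N i j : i \notin N -> h i j -> j \in N.
Proof. by move=> iN; apply: contraLR => jN; apply: indN; rewrite inE. Qed.

(** All neighbours of [i] lie in [N], as the outside of [N] is independent. A neighbour of a second
    seed outside [verts U] lies in [N], in [ps @: N] or in an uncovered large cluster; the latter
    form [La]. *)
Lemma one_sided_found i j : i \notin N -> lab i -> lab j -> h i j ->
  2 * s <= E * #|second_seeds j| -> one_sided_case.
Proof.
move=> iN li lj hij hb.
pose La := [set k | [&& k \notin N, k \notin ps @: N, lab k & [exists k', h k k']]].
exists N, La, ps, i, j, (part c i :&: typ), (second_seeds j); split=> //.
- move=> k; rewrite inE => /and4P[kN kI lk /existsP[k' hk]]; split=> //.
  have /card_gt0P[v] : 0 < #|part c k :&: typ| by apply: leq_trans (h_typ hk lk).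
  rewrite inE => /andP[/part_inP cv vt].
  apply: (@leq_trans (deg_in e v (verts [set k' | h k k']))).
    by apply: typ_deg_verts => // k1; rewrite cv inE.
  apply: leq_trans (deg_in_card _ _ _) _; rewrite mulnC card_verts_full //.
  by move=> k1; rewrite inE => hk1; apply: (@h_size k1 k); rewrite h_sym.
- split=> //; split; first exact: subsetIl.
  by apply/subsetP => b; rewrite inE => /andP[]; rewrite inE => /andP[].
- by split=> //; apply: typ_big hij li.
split=> [a|b].
  rewrite inE => /andP[/part_inP ca at_]; apply: typ_deg_verts => // k.
  by rewrite ca; apply: nb_in_N.
rewrite inE => /andP[bt] Kb; apply: leq_trans Kb _; rewrite leq_mul2l /=.
apply: leq_trans (deg_red_le b _); apply/subset_leq_card/subsetP => w.
rewrite !inE => /andP[cw hbw]; rewrite hbw andbT; case/andP: hbw => _ hcw.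
have [//|wN] := boolP (c w \in N); have [//|wI] := boolP (c w \in ps @: N).
move: cw; rewrite wN wI /= andbT negbK => -> /=.
by apply/existsP; exists (c b); rewrite h_sym.
Qed.

Hypothesis few_seeds : forall i j, i \notin N -> lab i -> lab j -> h i j ->
  E * #|second_seeds j| < 2 * s.

(** If both ends were large, the choice of the matching would leave [j] without neighbours in [U].
    All typical vertices of [j] would then be second seeds, while [j] is adjacent to the large
    cluster [ps j] outside [N]. *)
Lemma light_match j : j \in N -> lab j -> ~~ lab (ps j).
Proof.
move=> jN lj; apply/negP => lp; have hj := psh jN.
have := few_seeds (psN jN) lp lj; rewrite h_sym => /(_ hj).
rewrite ltnNge => /negP; apply; apply: leq_trans (typ_big hj lj) _.
rewrite leq_mul2l; apply/orP; right; apply/subset_leq_card/subsetP => b bt.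
rewrite inE bt /=; move: bt; rewrite inE => /andP[/part_inP cb bt].
have -> : deg_in e' b (~: verts U) = deg_in e' b setT.
  apply: eq_card => w; rewrite [in LHS]inE [in RHS]inE in_setC in_setT /=.
  rewrite andb_idl // => /andP[_]; rewrite cb => hjw; rewrite !inE.
  apply/negP => /and3P[wN wl wI].
  by case/negP: (best jN lp wl wN wI).
have [h1 h2] := typ_deg bt; rewrite /K; lia.
Qed.

Lemma vol_N (X : {set I}) : X \subset N -> #|verts X| = #|X| * (2 * s).
Proof.
move=> sX; apply: card_verts_full => i /(subsetP sX) iN; exact: h_size (psh iN).
Qed.

Lemma vol_psN (X : {set I}) : X \subset N -> #|verts (ps @: X)| = #|X| * (2 * s).
Proof.
move=> sX; rewrite card_verts_full.
  by congr (_ * _); apply: card_in_imset => i j /(subsetP sX) iN /(subsetP sX) jN; apply: ips.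
move=> k /imsetP[i /(subsetP sX) iN ->]; apply: (@h_size _ i).
by rewrite h_sym; apply: psh.
Qed.

Lemma vertsU (X Y : {set I}) : [disjoint X & Y] ->
  #|verts (X :|: Y)| = #|verts X| + #|verts Y|.
Proof. by move=> dXY; rewrite !card_verts -bigU //; apply: eq_bigl => i; rewrite inE. Qed.

(** The partners of the large clusters of [N] are small clusters outside [N], disjoint from [U] and
    of the same total size. *)
Lemma vol_light : #|verts U| + #|LN| <= #|SI|.
Proof.
pose X := [set j in N | ~~ lab (ps j)].
have sX : X \subset N by apply/subsetP => j; rewrite inE => /andP[].
have le : #|LN| <= #|verts (ps @: X)|.
  rewrite vol_psN // /LN vol_N; last by apply/subsetP => j; rewrite inE => /andP[].
  rewrite leq_mul2r; apply/orP; right; apply/subset_leq_card/subsetP => j.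
  by rewrite !inE => /andP[jN lj]; rewrite jN light_match.
apply: leq_trans (leq_add (leqnn _) le) _; rewrite -vertsU.
  apply/subset_leq_card/subsetP => v; rewrite !inE => /orP[/and3P[-> ->]//|].
  by move=> /imsetP[j]; rewrite inE => /andP[jN lj] ->; rewrite lj psN.
rewrite -setI_eq0; apply/eqP/setP => k; rewrite !inE; apply/negP.
move=> /andP[/and3P[_ _ /negP kI] /imsetP[j]]; rewrite inE => /andP[jN _] E'.
by apply: kI; rewrite E' imset_f.
Qed.

Lemma vol_halves : [/\ #|LI| + #|SI| + #|LN| + #|SN| = n,
  #|LI| + #|LN| = #|[set v | lab0 v]| & #|SI| + #|SN| <= #|LI| + #|LN|].
Proof.
have L : #|LI| + #|LN| = #|[set v | lab0 v]|.
  rewrite -(cardsID (verts N) [set v | lab0 v]) addnC.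
  by congr (_ + _); apply: eq_card => v; rewrite !inE labE //; rewrite andbC.
have S' : #|SI| + #|SN| = #|~: [set v | lab0 v]|.
  rewrite -(cardsID (verts N) (~: [set v | lab0 v])) addnC.
  by congr (_ + _); apply: eq_card => v; rewrite !inE labE //; rewrite andbC.
have C := cardsC [set v | lab0 v]; move: half; rewrite /n; move: C; rewrite -L -S'.
by move=> <- hf; split=> //; move: hf; clear; lia.
Qed.

(** Double counting. The large vertices outside [N] send about [D] edges each into [N], where the
    vertices of [W] take less than [D / 2] each, those of [SN] at most [D], and all others few in
    total. The vertices of [W] send more than half of their degree to [U], which is too small to
    absorb this unless [LI] hardly exceeds [SN]; twice that excess bounds the uncovered volume. *)
Lemma uncovered_few : 2 * #|~: verts (N :|: ps @: N)| <= tau.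
Proof.
have [tot LE SL] := vol_halves; have UL := vol_light.
have D0 : 0 < D by have := K_tau; have := K_gt0; lia.
pose W := [set b in LN :&: typ | 2 * deg_in e' b (~: verts U) < K].
have cov : #|~: verts (N :|: ps @: N)| + 2 * (#|LN| + #|SN|) = n.
  have dN : [disjoint N & ps @: N].
    rewrite -setI_eq0; apply/eqP/setP => k; rewrite !inE; apply/negP => /andP[kN].
    by move=> /imsetP[j jN E']; have := psN jN; rewrite -E' kN.
  have -> : #|LN| + #|SN| = #|verts N|.
    rewrite -vertsU; last first.
      by rewrite -setI_eq0; apply/eqP/setP => k; rewrite !inE; case: (lab k); rewrite !andbF.
    by apply: eq_card => v; rewrite !inE; case: (lab _); rewrite !andbT !andbF ?orbF.
  have C := cardsC (verts (N :|: ps @: N)).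
  by rewrite /n -C vertsU // vol_psN // vol_N //; lia.
(* The constant is [20 = 2 * 6 + 2 * 3 + 2 * 1]: from [typical_edges], from the atypical vertices of
   [LN], and from the exceptional set [G]. *)
have edgesLI : S * (2 * (D * #|LI|)) <= S * (2 * (D * #|SN|) + D * #|W|) + 20 * (n * n).
  have h1 : S * (D * #|LI|) <= S * edge_count e' (LI :&: typ) (verts N) + 6 * (n * n).
    apply: typical_edges => v; rewrite inE inE => /andP[vN lv]; first by rewrite -labE.
    by move=> w /andP[_ hvw]; rewrite inE; apply: nb_in_N hvw.
  (* Such vertices outside [W] are second seeds of a cluster adjacent to a large cluster outside
     [N], and by [few_seeds] there are few of them. *)
  pose G := [set b in LN :&: typ :\: W | [exists i, [&& i \notin N, lab i & h (c b) i]]].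
  have cG : E * #|G| <= n.
    rewrite (card_by_parts c) big_distrr /= /n -(card_parts c); apply: leq_sum => j _.
    have [->|[b]] := set_0Vmem (part c j :&: G); first by rewrite cards0 muln0.
    rewrite in_setI => /andP[/part_inP cb]; rewrite inE => /andP[_ /existsP[i /and3P[iN li]]].
    rewrite cb => hji; rewrite (h_size hji).
    have [lj|lj] := boolP (lab j).
      have hij : h i j by rewrite h_sym.
      apply: ltnW; apply: leq_ltn_trans (few_seeds iN li lj hij).
      rewrite leq_mul2l; apply/orP; right; apply/subset_leq_card/subsetP => w.
      rewrite in_setI [w \in G]inE !in_setD !in_setI => /andP[wj /andP[/andP[wW /andP[wLN wt]] _]].
      rewrite inE in_setI wj wt /= leqNgt; apply: contra wW => lt.
      by rewrite inE in_setI wLN wt.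
    rewrite (_ : part c j :&: G = set0) ?cards0 ?muln0 //; apply/setP => w.
    rewrite in_set0 in_setI; apply/negP => /andP[/part_inP cw].
    rewrite inE in_setD in_setI => /andP[/andP[_ /andP[wLN _]] _].
    by move: wLN; rewrite !inE cw (negPf lj) andbF.
  have SG : S * #|G| <= n by apply: leq_trans cG; rewrite leq_mul2r ES orbT.
  have ct : S * #|LN :\: typ| <= 3 * n.
    apply: leq_trans few_atypical; rewrite leq_mul2l; apply/orP; right.
    apply/subset_leq_card/subsetP => v; rewrite !inE => /and3P[-> vN lv].
    by rewrite -labE lv.
  have h2 : 2 * edge_count e' (LI :&: typ) (verts N) <=
      2 * D * #|SN| + D * #|W| + 2 * n * #|LN :\: typ| + 2 * n * #|G|.
    rewrite edge_count_sym; last exact: red_adj_sym.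
    apply: (@leq_trans (\sum_(b in verts N) (2 * D * (b \in SN) + D * (b \in W) +
        2 * n * (b \in LN :\: typ) + 2 * n * (b \in G)))); last first.
      have ind k (X : {set V}) : \sum_(b in verts N) k * (b \in X) <= k * #|X|.
        rewrite -big_distrr /= leq_mul2l; apply/orP; right.
        rewrite -big_mkcondr /= sum1_card; apply/subset_leq_card/subsetP => b.
        by rewrite unfold_in => /andP[].
      by rewrite !big_split /= !leq_add.
    rewrite /edge_count big_distrr /=; apply: leq_sum => b; rewrite inE => bN.
    have dn : deg_in e' b (LI :&: typ) <= n by apply: leq_trans (deg_in_card _ _ _) (max_card _).
    have [lb|lb] := boolP (lab (c b)); last first.
      have -> : b \in SN by rewrite !inE bN.
      have := @light_deg b (LI :&: typ); rewrite -labE => /(_ lb); rewrite muln1; lia.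
    have bLN : b \in LN by rewrite !inE bN.
    have [bt|bt] := boolP (b \in typ); last first.
      have -> : b \in LN :\: typ by rewrite in_setD bt.
      by rewrite muln1; lia.
    have [bW|bW] := boolP (b \in W).
      have := bW; rewrite inE => /andP[_].
      have : deg_in e' b (LI :&: typ) <= deg_in e' b (~: verts U).
        apply/deg_in_sub/subsetP => w; rewrite in_setI => /andP[wLI _].
        move: wLI; rewrite !inE => /andP[_ ->].
        by rewrite andbF.
      by have := K_tau; lia.
    have [bG|bG] := boolP (b \in G); first by rewrite muln1; lia.
    suff -> : deg_in e' b (LI :&: typ) = 0 by [].
    apply/eqP; rewrite cards_eq0; apply/eqP/setP => w; rewrite in_set0.
    apply/negP; rewrite inE in_setI => /andP[/andP[wLI _] /andP[_ hbw]].
    case/negP: bG; rewrite inE in_setD bW in_setI bLN bt /=; apply/existsP; exists (c w).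
    by move: wLI; rewrite hbw !inE andbT.
  have h3 : S * (2 * (D * #|LI|)) <= S * (2 * edge_count e' (LI :&: typ) (verts N)) + 12 * (n * n).
    by rewrite ![S * (2 * _)]mulnCA; move: h1; move: (S * _) (S * _) (n * n); lia.
  have h4 : S * (2 * edge_count e' (LI :&: typ) (verts N)) <=
      S * (2 * (D * #|SN|) + D * #|W|) + 2 * (n * (S * #|LN :\: typ|)) + 2 * (n * (S * #|G|)).
    apply: leq_trans (leq_mul (leqnn S) h2) _; apply: eq_leq; ring.
  have h5 : n * (S * #|LN :\: typ|) <= 3 * (n * n).
    by rewrite [3 * _]mulnCA leq_mul2l ct orbT.
  have h6 : n * (S * #|G|) <= n * n by rewrite leq_mul2l SG orbT.
  move: h3 h4 h5 h6; move: (S * (2 * (D * #|LI|))) (S * (2 * edge_count _ _ _))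
    (S * (_ + _)) (n * (S * #|G|)) (n * (S * _)) (n * n); clear; lia.
have edgesW : #|W| * (D + tau) <= 2 * (D * #|verts U|).
  apply: (@leq_trans (2 * edge_count e' W (verts U))); last first.
    rewrite leq_mul2l /= edge_count_sym; last exact: red_adj_sym.
    rewrite mulnC -sum_nat_const; apply: leq_sum => v; rewrite !inE => /and3P[_ lv _].
    by apply: light_deg; rewrite -labE.
  rewrite -sum_nat_const /edge_count big_distrr /=; apply: leq_sum => b.
  rewrite inE in_setI => /andP[/andP[bLN bt] lt]; have [d1 d2] := typ_deg bt.
  have := deg_in_leqU e' b (verts U) (~: verts U); rewrite setUCr.
  by have := K_tau; lia.
have xL : #|~: verts (N :|: ps @: N)| + 2 * #|SN| <= 2 * #|LI|.
  by move: cov tot SL; clear; lia.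
have uL : #|verts U| + #|SN| <= #|LI| by move: UL SL; clear; lia.
exact: (uncovered_bound edgesLI edgesW uL xL VD Vtau DV tau_gt0 S0_gt0 D0 SE).
Qed.

Lemma covered_deg (v : V) : D <= deg_in e' v setT + tau ->
  K <= deg_in e v (verts (N :|: ps @: N)).
Proof.
move=> hv; have := uncovered_few.
have := deg_in_leqU e' v (verts (N :|: ps @: N)) (~: verts (N :|: ps @: N)).
rewrite setUCr; have := deg_in_card e' v (~: verts (N :|: ps @: N)).
have := deg_red_le v (verts (N :|: ps @: N)); have := K_tau.
by move: hv; rewrite -/n; move: #|~: _|; lia.
Qed.

(** The matching covers almost everything, so it remains to find a dense pair whose vertices all
    have reduced degree at least [D - tau]: an edge between large clusters, or an edge at a small
    cluster with many such vertices. Without either, all reduced edges at large vertices end in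
    small vertices, which with few exceptions have smaller degree and are too few to take them
    all. *)
Lemma covered_found : covered_case.
Proof.
have [f [fi hf]] : exists f, {in N :|: ps @: N :|: set0 &, injective f} /\
    {in N :|: ps @: N :|: set0, forall i, f i \in N :|: ps @: N :|: set0 /\ h i (f i)}.
  have d0 : [disjoint set0 & N :|: ps @: N] by rewrite -setI_eq0 set0I.
  by apply: (matching_perm (ph := id) ips hps _ _ d0) => i; rewrite inE.
rewrite setU0 in fi hf.
have [/existsP[i /existsP[j /and3P[hij li lj]]]|noLL] := boolP [exists i, exists j,
    [&& h i j, lab i & lab j]].
  exists (N :|: ps @: N), f, i, j, (part c i :&: typ), (part c j :&: typ); split=> //.
  - by split=> //; rewrite !subsetIl.
  - by split; [apply: typ_big hij li | apply: typ_big lj; rewrite h_sym; exact: hij].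
  - move=> a; rewrite -setIUl inE => /andP[_ at_]; apply: covered_deg.
    by have [h1 h2] := typ_deg at_; lia.
pose Sg := [set v | ~~ lab0 v && (D <= deg_in e' v setT + tau)].
have D_tau : tau < D by have := K_tau; have := K_gt0; have := tau_gt0; lia.
have nbS v : v \in Sg -> exists2 i, h (c v) i & lab i.
  rewrite inE => /andP[lv dv].
  have /card_gt0P[w] : 0 < deg_in e' v setT by lia.
  rewrite inE => /andP[_ /andP[_ hvw]]; exists (c w) => //.
  by have := h_lab hvw; rewrite labE (negPf lv).
have [/existsP[j /andP[lj cj]]|noS] := boolP [exists j,
    ~~ lab j && (2 * s <= E * #|part c j :&: Sg|)].
  have /card_gt0P[v] : 0 < #|part c j :&: Sg|.
    by move: cj; case: #|_| => //; rewrite muln0; lia.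
  rewrite inE => /andP[/part_inP cv vS]; have [i hvi li] := nbS v vS.
  rewrite cv in hvi; have hij : h i j by rewrite h_sym.
  exists (N :|: ps @: N), f, i, j, (part c i :&: typ), (part c j :&: Sg); split=> //.
  - by split=> //; rewrite !subsetIl.
  - by split=> //; apply: typ_big hij li.
  - move=> a; rewrite in_setU !in_setI => /orP[/andP[_ at_]|/andP[_ aS]]; apply: covered_deg.
      by have [h1 h2] := typ_deg at_; lia.
    by move: aS; rewrite inE => /andP[].
exfalso.
have cS : S * #|Sg| <= n.
  apply: (@leq_trans (E * #|Sg|)); first by rewrite leq_mul2r ES orbT.
  rewrite (card_by_parts c) big_distrr /= /n -(card_parts c); apply: leq_sum => j _.
  have [->|[v]] := set_0Vmem (part c j :&: Sg); first by rewrite cards0 muln0.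
  rewrite in_setI => /andP[/part_inP cv vS]; have [i hvi li] := nbS v vS.
  rewrite cv in hvi; rewrite (h_size hvi) ltnW // ltnNge.
  apply: contra noS => hj; apply/existsP; exists j; rewrite hj andbT.
  by move: vS; rewrite inE -labE cv => /andP[].
pose Ls := [set v | lab0 v]; pose Ss := ~: Ls.
have LLE v w : lab0 v -> e' v w -> w \in Ss.
  move=> lv /andP[_ hvw]; rewrite !inE; apply: contra noLL => lw.
  by apply/existsP; exists (c v); apply/existsP; exists (c w); rewrite hvw !labE lv lw.
have t1 : S * (D * #|Ls|) <= S * edge_count e' (Ls :&: typ) Ss + 6 * (n * n).
  by apply: typical_edges => v; rewrite inE // => lv w; apply: LLE.
have t2 : edge_count e' (Ls :&: typ) Ss + tau * (#|Ss| - #|Sg|) <= D * #|Ss|.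
  rewrite edge_count_sym; last exact: red_adj_sym.
  apply: (@leq_trans (\sum_(v in Ss) (deg_in e' v (Ls :&: typ) + tau * (v \notin Sg)))).
    rewrite big_split /= leq_add2l -big_distrr leq_mul2l /=; apply/orP; right.
    apply: (@leq_trans #|Ss :\: Sg|).
      by rewrite cardsD leq_sub2l // subset_leq_card ?subsetIr.
    rewrite -big_mkcondr /= -sum1_card; apply: eq_leq; apply: eq_bigl => v.
    by rewrite inE andbC.
  rewrite mulnC -sum_nat_const; apply: leq_sum => v vS.
  have lv : ~~ lab0 v by move: vS; rewrite !inE.
  have := @light_deg v (Ls :&: typ) lv; have := deg_in_sub e' v (subsetT (Ls :&: typ)).
  by rewrite inE lv /=; case: leqP; rewrite ?muln0 ?muln1; lia.
have CL := cardsC Ls.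
have t3 : S * (D * #|Ls|) + S * (tau * (#|Ss| - #|Sg|)) <= S * (D * #|Ss|) + 6 * (n * n).
  have : S * (edge_count e' (Ls :&: typ) Ss + tau * (#|Ss| - #|Sg|)) <= S * (D * #|Ss|).
    by rewrite leq_mul2l t2 orbT.
  by rewrite mulnDr; move: t1; move: (S * edge_count _ _ _) (S * (tau * _)) (S * (D * #|Ss|)) (S * _) (n * n); lia.
have D0 : 0 < D by lia.
apply: (bipartite_contradiction t3 cS half _ VD Vtau tau_gt0 S0_gt0 D0 _ SE).
  by move: half CL; rewrite -/n -/Ls -/Ss; lia.
exact: leq_trans D0 DV.
Qed.

End Bipartite.

Theorem reduced_structure : covered_case \/ one_sided_case.
Proof.
have [|[N [ps0 [ind i0 h0]]]] := covered_or_bipartite; first by left.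
have [ps [ips hps best]] := best_matching i0 h0.
have [/existsP[i /existsP[j /and5P[iN li lj hij hb]]]|no] := boolP [exists i, exists j,
    [&& i \notin N, lab i, lab j, h i j & 2 * s <= E * #|second_seeds N ps j|]].
  by right; apply: one_sided_found hij hb.
left; apply: (@covered_found N ps) => // i j iN li lj hij; rewrite ltnNge.
apply: contra no => hb; apply/existsP; exists i; apply/existsP; exists j.
by rewrite iN li lj hij hb.
Qed.

End Structure.

(** * Embedding into the reduced graph *)

Section Assembly.
Variables (V : finType) (e : rel V) (I : finType) (c : V -> I) (h : rel I).
Variables (s E D tau k l om cap l' M : nat).
Hypotheses (e_sym : symmetric e) (h_sym : symmetric h).
Hypothesis h_neq : forall i j, h i j -> i != j.
Hypothesis h_size : forall i j, h i j -> #|part c i| = 2 * s.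
Hypothesis h_dense : forall i j, h i j -> dense_pair e l om (part c i) (part c j).
Hypothesis part_size : forall i, #|part c i| <= 2 * s.
Hypothesis I_M : #|I| <= M.
Hypothesis budget : forall X : {set I}, {in X, forall i, #|part c i| = 2 * s} ->
  100 * (#|X| * om) <= tau.
Hypotheses (s_tau : 100 * s <= tau) (tau_big : 100 <= tau).
Hypotheses (l_gt0 : 0 < l) (l_om : l <= om) (E_gt0 : 0 < E) (om_E : 2 * s < E * om).
Hypothesis D_k : k + 8 * tau <= D.
Hypothesis cap_w : cap * #|V| + cap * om <= l' * om.
Hypothesis seeds_room : forall i j (A B : {set V}), h i j ->
  A \subset part c i -> B \subset part c j -> 2 * s <= E * #|A| -> 2 * s <= E * #|B| ->
  E ^ (2 * M) * E ^ (2 * M) * (l' * (2 * #|V|)) < edge_count e A B.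
Variables (T : finType) (r : T) (p : T -> T) (d : T -> nat).
Hypotheses (pr : p r = r) (dr : d r = 0).
Hypothesis dp : forall x, x != r -> d x = (d (p x)).+1.
Hypotheses (T_k : #|T| <= k.+1) (cap_T : 3 * (#|T| + l) <= cap * l).
Implicit Types (A B X Y : {set V}) (i j : I).

Let K := D - 2 * tau.

Lemma choose_seeds (J : finType) (Sj : J -> {set V}) i j A0 B0 :
  h i j -> A0 \subset part c i -> B0 \subset part c j ->
  2 * s <= E * #|A0| -> 2 * s <= E * #|B0| -> #|J| <= 2 * M ->
  (forall k, #|Sj k| <= 2 * s) ->
  exists A B (al be : J -> nat),
    [/\ A \subset A0 /\ B \subset B0, exists a, a \in A,
        {in A, forall a, cap <= deg_in e a B} /\ {in B, forall b, cap <= deg_in e b A},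
        {in A, forall a k,
          al k <= #|[set x | e a x & cap <= deg_in e x A] :&: Sj k| /\
          deg_in e a (Sj k) <= al k + 2 * om} &
        {in B, forall b k, be k <= #|[set x | e b x] :&: Sj k| /\
          deg_in e b (Sj k) <= be k + om}].
Proof.
move=> hij sA sB cA cB cJ cS.
have om0 : 0 < om by case: (om) om_E => //; rewrite muln0.
apply: (@seed_sets _ e e_sym J Sj A0 B0 om E.-1 cap l') => //.
- by move=> k'; rewrite prednK //; apply: leq_ltn_trans (cS k') om_E.
- rewrite prednK //; apply: leq_ltn_trans (seeds_room hij sA sB cA cB).
  by rewrite leq_mul // leq_mul // leq_pexp2l.
Qed.

Lemma disjoint_parts i j A B : i != j -> A \subset part c i -> B \subset part c j ->
  [disjoint A & B].
Proof.
move=> nij /subsetP sA /subsetP sB; rewrite -setI_eq0; apply/eqP/setP => x.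
rewrite !inE; apply/negP => /andP[/sA xA /sB xB]; case/negP: nij.
by move: xA xB; rewrite !inE => /eqP-> /eqP->.
Qed.

Lemma disjoint_setUr (A B X : {set V}) : [disjoint X & A] -> [disjoint X & B] ->
  [disjoint X & A :|: B].
Proof. by move=> dA dB; rewrite disjoint_sym disjoint_setUl ![[disjoint _ & X]]disjoint_sym dA. Qed.

Lemma sum_deg_verts (X : {set I}) v :
  deg_in e v (verts c X) = \sum_(i in X) deg_in e v (part c i).
Proof.
rewrite -(deg_in_parts e c v (mem X)); apply: eq_card => w.
by rewrite !inE andbC.
Qed.

(** Pairs that touch the two seed clusters are given up, so that pieces avoid the seeds. *)
Lemma card_exceptional (N : {set I}) (f : I -> I) i0 j0 : {in N &, injective f} ->
  #|[set i in N | (i \in [set i0; j0]) || (f i \in [set i0; j0])]| <= 4.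
Proof.
move=> fi; have c2 : #|[set i0; j0]| <= 2 by rewrite cards2; case: (_ != _).
have c1 : #|[set i in N | i \in [set i0; j0]]| <= 2.
  by apply: leq_trans c2; apply/subset_leq_card/subsetP => i; rewrite inE => /andP[].
have c3 : #|[set i in N | f i \in [set i0; j0]]| <= 2.
  apply: leq_trans c2; rewrite -(@card_in_imset _ _ f); last first.
    by move=> i j; rewrite !inE => /andP[iN _] /andP[jN _]; apply: fi.
  by apply/subset_leq_card/subsetP => j /imsetP[i]; rewrite inE => /andP[_ fE] ->.
apply: (leq_trans _ (leq_add c1 c3)); apply: leq_trans (leq_card_setU _ _).
by apply/subset_leq_card/subsetP => i; rewrite !inE -andb_orr.
Qed.

(** [ph] need not be an involution, so its edges need not form a matching. Pairing one half of each
    cluster [i] with the other half of [ph i] gives disjoint pairs that together cover [Cov]; hence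
    the even cluster size [2 * s]. *)
Definition half_part i b :=
  [set v in part c i | (index v (enum (part c i)) < s) == b].

Lemma card_half i b : #|part c i| = 2 * s -> #|half_part i b| = s.
Proof.
move=> ci; have ht : #|half_part i true| = s.
  have := sum_index (fun q => (q < s : nat)) (enum_uniq (part c i)).
  rewrite -cardE ci big_enum /= => hs.
  have -> : #|half_part i true| = \sum_(v in part c i) (index v (enum (part c i)) < s).
    rewrite -sum1_card -big_mkcondr /=; apply: eq_bigl => v.
    by rewrite inE eqb_id.
  rewrite hs; have : forall m, \sum_(q < m) (q < s) = minn m s.
    elim=> [|m IHm]; first by rewrite big_ord0 min0n.
    by rewrite big_ord_recr /= IHm; case: leqP; case: leqP; lia.
  by move=> ->; apply/minn_idPr; lia.
case: b => //.
have : #|part c i| = #|half_part i true| + #|half_part i false|.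
  rewrite -(cardsID (half_part i true) (part c i)); congr (_ + _).
    by apply: eq_card => v; rewrite !inE andbA andbb.
  by apply: eq_card => v; rewrite !inE; case: (c v == i); case: (_ < s).
by rewrite ci ht; lia.
Qed.

Lemma half_sub i b : half_part i b \subset part c i.
Proof. by apply/subsetP => v; rewrite inE => /andP[]. Qed.

Lemma deg_halves v i :
  deg_in e v (part c i) = deg_in e v (half_part i true) + deg_in e v (half_part i false).
Proof.
rewrite -deg_inU; last first.
  rewrite -setI_eq0; apply/eqP/setP => x; rewrite !inE.
  by case: (_ < s); rewrite ?andbF.
by congr deg_in; apply/setP => x; rewrite !inE; case: (_ < s); rewrite ?andbT ?andbF ?orbF.
Qed.

Lemma disjoint_halves i j b b' : (i, b) != (j, b') ->
  [disjoint half_part i b & half_part j b'].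
Proof.
move=> ne; rewrite -setI_eq0; apply/eqP/setP => x; rewrite !inE; apply/negP.
case/andP=> /andP[/eqP ci /eqP bi] /andP[/eqP cj /eqP bj].
by case/negP: ne; rewrite -bi -bj -ci -cj.
Qed.

Lemma dense_pair_sub C C' X Y : dense_pair e l om C C' -> X \subset C -> Y \subset C' ->
  dense_pair e l om X Y.
Proof.
move=> den sX sY X' Y' sX' sY'; apply: den.
  exact: subset_trans sX' sX.
exact: subset_trans sY' sY.
Qed.

Lemma embed_covered : covered_case e c h s E D tau ->
  exists f : T -> V, injective f /\ forall u, u != r -> e (f (p u)) (f u).
Proof.
move=> [Cov [ph [i0 [j0 [A0 [B0 [iph hph [hij [sA0 sB0]] [cA0 cB0] dAB]]]]]]].
have [||A [B [al [be [[sA sB] aA [dA dB] hA hB]]]]] := @choose_seeds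
  [the finType of (I * bool)%type] (fun ib => half_part ib.1 ib.2) i0 j0 A0 B0 hij sA0 sB0 cA0 cB0.
- by rewrite card_prod card_bool mulnC leq_mul2l I_M orbT.
- by move=> [i b]; apply: leq_trans (subset_leq_card (half_sub i b)) (part_size i).
pose ex := [set i in Cov | (i \in [set i0; j0]) || (ph i \in [set i0; j0])].
pose PS := Cov :\: ex.
pose side i b := if b then half_part i true else half_part (ph i) false.
have PSP i : i \in PS -> [/\ i \in Cov, i \notin [set i0; j0] & ph i \notin [set i0; j0]].
  rewrite in_setD inE => /andP[+ iC]; rewrite iC /= negb_or => /andP[h1 h2].
  by split.
have full i : i \in Cov -> #|part c i| = 2 * s.
  by case/hph => _; apply: h_size.
have sAi := subset_trans sA sA0; have sBj := subset_trans sB sB0.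
have outF i X : i \notin [set i0; j0] -> X \subset part c i -> [disjoint X & A :|: B].
  rewrite !inE negb_or => /andP[n1 n2] sX; apply: disjoint_setUr.
    exact: disjoint_parts sX sAi.
  exact: disjoint_parts sX sBj.
have cPS : #|PS| <= #|Cov| by apply/subset_leq_card/subsetDl.
have bC := budget full.
have cex : #|ex| <= 4 by apply: card_exceptional.
(* [8 * s] bounds the degree into at most four exceptional pairs of size [2 * s]; [4 * om] per pair
   is the rounding error of the two halves. *)
have degCov (g : I * bool -> nat) y : (forall ib, deg_in e y (half_part ib.1 ib.2) <= g ib + 2 * om) ->
    K <= deg_in e y (verts c Cov) ->
    K - (8 * s + 4 * (#|Cov| * om)) <= \sum_(i in PS) (g (i, true) + g (ph i, false)).
  move=> hg hK; have : deg_in e y (verts c Cov) =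
      \sum_(i in Cov) (deg_in e y (half_part i true) + deg_in e y (half_part (ph i) false)).
    rewrite sum_deg_verts (eq_bigr _ (fun i _ => deg_halves y i)) !big_split /=; congr (_ + _).
    have imC : Cov = ph @: Cov.
      apply/esym/eqP; rewrite eqEcard card_in_imset // leqnn andbT.
      by apply/subsetP => j /imsetP[i iC ->]; case: (hph i iC).
    by rewrite {1}imC big_imset.
  rewrite (big_setID ex) /=; have -> : Cov :&: ex = ex.
    by apply/setIidPr/subsetP => i; rewrite inE => /andP[].
  rewrite -/PS => eqd.
  have e1 : \sum_(i in ex) (deg_in e y (half_part i true) + deg_in e y (half_part (ph i) false))
      <= 8 * s.
    apply: (@leq_trans (\sum_(i in ex) 2 * s)).
      apply: leq_sum => i; rewrite inE => /andP[iC _]; have [pC _] := hph i iC.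
      have := deg_in_card e y (half_part i true); have := deg_in_card e y (half_part (ph i) false).
      by rewrite !card_half ?full //; lia.
    by rewrite sum_nat_const mulnCA mulnA leq_mul2r; apply/orP; right; lia.
  have e2 : \sum_(i in PS) (deg_in e y (half_part i true) + deg_in e y (half_part (ph i) false))
      <= \sum_(i in PS) (g (i, true) + g (ph i, false)) + #|PS| * (4 * om).
    rewrite -sum_nat_const -big_split /=; apply: leq_sum => i _.
    by have := hg (i, true); have := hg (ph i, false); rewrite /=; lia.
  have e3 : #|PS| * (4 * om) <= 4 * (#|Cov| * om) by rewrite mulnCA leq_mul2l leq_mul2r cPS !orbT.
  by move: hK; rewrite eqd; move: e1 e2 e3; clear; lia.
have PSD : #|PS| * (2 * om + l) <= 3 * (#|Cov| * om).
  apply: (@leq_trans (#|Cov| * (3 * om))); last by rewrite mulnCA.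
  by apply: leq_mul => //; lia.
apply: (embed_tree pr dr dp e_sym l_gt0 cap_T aA dA dB) => t0 t1 t2 ht _.
apply: (strategy_covered (side := side) (s := s)
  (al := fun i b => al (if b then i else ph i, b))
  (be := fun i b => be (if b then i else ph i, b))
  (K := K - (8 * s + 4 * (#|Cov| * om))) (m := #|T|) _ _ _ _ aA PSD) => //.
- move=> i /PSP[iC _ _] b; have [pC _] := hph i iC.
  by rewrite /side; case: b; rewrite card_half ?full.
- move=> i j /PSP[iC _ _] /PSP[jC _ _] b b' ne; rewrite /side.
  have ne' : (ph i == ph j) = (i == j) by apply/eqP/eqP => [/iph|->] //; apply.
  case: b b' ne => -[] ne; apply: disjoint_halves; rewrite ?xpair_eqE ?andbF //.
  by move: ne; rewrite !xpair_eqE ne'.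
- move=> i /PSP[iC ni npi] b; rewrite /side; case: b.
    exact: outF ni (half_sub _ _).
  exact: outF npi (half_sub _ _).
- move=> i /PSP[iC _ _] b; have [pC hi] := hph i iC; rewrite /side; case: b => /=.
    by apply: dense_pair_sub (h_dense hi) _ _; apply: half_sub.
  by apply: (@dense_pair_sub (part c (ph i)) (part c i)); [by apply: h_dense; rewrite h_sym | |]; apply: half_sub.
- move=> a aA' i iP b; have [h1 _] := hA a aA' (if b then i else ph i, b).
  by move: h1; rewrite /side; case: b.
- move=> b bB i iP b'; have [h1 _] := hB b bB (if b' then i else ph i, b').
  by move: h1; rewrite /side; case: b'.
- have [a aA'] := aA; apply: (degCov al a).
    by move=> ib; case: (hA a aA' ib).
  by apply: dAB; rewrite in_setU (subsetP sA).
- have [b bB] : exists b, b \in B.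
    have [a aA'] := aA; have : 0 < deg_in e a B.
      apply: leq_trans (dA a aA'); rewrite lt0n; apply: contraTneq cap_T => ->.
      by rewrite mul0n -ltnNge; lia.
    by move=> /card_gt0P[b]; rewrite inE => /andP[bB _]; exists b.
  apply: (degCov be b).
    move=> ib; case: (hB b bB ib) => _ /leq_trans; apply.
    by rewrite leq_add2l leq_pmull.
  by apply: dAB; rewrite in_setU (subsetP sB) // orbT.
- by move: bC s_tau tau_big T_k D_k; rewrite /K; move: (#|Cov| * om); clear; lia.
Qed.

Lemma deg_vertsU (X1 X2 : {set I}) v :
  deg_in e v (verts c (X1 :|: X2)) <= deg_in e v (verts c X1) + deg_in e v (verts c X2).
Proof.
apply: leq_trans (deg_in_leqU e v _ _); apply: deg_in_sub.
by apply/subsetP => w; rewrite !inE.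
Qed.

Lemma embed_one_sided : one_sided_case e c h s E D tau ->
  exists f : T -> V, injective f /\ forall u, u != r -> e (f (p u)) (f u).
Proof.
move=> [N [La [ps [i0 [j0 [A0 [B0 [[ips hps] hLa [hij [sA0 sB0]] [cA0 cB0] [dAN dBG]]]]]]]]].
have IM2 : #|I| <= 2 * M by apply: leq_trans I_M _; rewrite leq_pmull.
have [A [B [al [be [[sA sB] aA [dA dB] hA hB]]]]] :=
  choose_seeds hij sA0 sB0 cA0 cB0 IM2 part_size.
have K0 : 0 < K by rewrite /K; lia.
pose ex := [set i in N | (i \in [set i0; j0]) || (ps i \in [set i0; j0])].
pose PS := N :\: ex; pose ES := La :\: [set i0; j0].
pose side i b := if b then part c i else part c (ps i).
have PSP i : i \in PS -> [/\ i \in N, i \notin [set i0; j0] & ps i \notin [set i0; j0]].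
  rewrite in_setD inE => /andP[+ iC]; rewrite iC /= negb_or => /andP[h1 h2].
  by split.
have full i : i \in N -> #|part c i| = 2 * s by case/hps => _; apply: h_size.
have fullp i : i \in N -> #|part c (ps i)| = 2 * s.
  by case/hps => _ hi; apply: (@h_size _ i); rewrite h_sym.
have fullL j : j \in La -> #|part c j| = 2 * s.
  move=> jL; have [_ _ hK] := hLa j jL.
  have /card_gt0P[i] : 0 < #|[set i | h j i]|.
    by move: hK K0; case: #|_| => //; rewrite muln0; lia.
  by rewrite inE; apply: h_size.
have sAi := subset_trans sA sA0; have sBj := subset_trans sB sB0.
have outF i X : i \notin [set i0; j0] -> X \subset part c i -> [disjoint X & A :|: B].
  rewrite !inE negb_or => /andP[n1 n2] sX; apply: disjoint_setUr.
    exact: disjoint_parts sX sAi.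
  exact: disjoint_parts sX sBj.
have cPS : #|PS| <= #|N| by apply/subset_leq_card/subsetDl.
have cES : #|ES| <= #|La| by apply/subset_leq_card/subsetDl.
have bN := budget full; have bL := budget fullL.
have cex : #|ex| <= 4 by apply: card_exceptional.
have exN : N :&: ex = ex by apply/setIidPr/subsetP => i; rewrite inE => /andP[].
have sumN (F g : I -> nat) m m' : {in N, forall i, F i <= m} -> (forall i, F i <= g i + m') ->
    \sum_(i in N) F i <= \sum_(i in PS) g i + 4 * m + #|N| * m'.
  move=> Fm Fg; rewrite (big_setID ex) /= exN -/PS.
  have e1 : \sum_(i in ex) F i <= 4 * m.
    apply: (@leq_trans (\sum_(i in ex) m)); last by rewrite sum_nat_const leq_mul2r cex orbT.
    by apply: leq_sum => i; rewrite inE => /andP[iN _]; apply: Fm.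
  have e2 : \sum_(i in PS) F i <= \sum_(i in PS) g i + #|PS| * m'.
    by rewrite -sum_nat_const -big_split /=; apply: leq_sum => i _.
  have e3 : #|PS| * m' <= #|N| * m' by rewrite leq_mul2r cPS orbT.
  by move: e1 e2 e3; clear; lia.
have degS v i : deg_in e v (part c i) <= 2 * s.
  exact: leq_trans (deg_in_card _ _ _) (part_size i).
have PSD : #|PS| * (2 * om + l) <= 3 * (#|N| * om).
  apply: (@leq_trans (#|N| * (3 * om))); last by rewrite mulnCA.
  by apply: leq_mul => //; lia.
have cES' : #|ES| * om <= #|La| * om by rewrite leq_mul2r cES orbT.
(* The reduced neighbours of [j] other than the seed clusters have total size at least [K - 4 * s].
   This exceeds [#|U|] by more than [om] per cluster, so one of them has [om] free vertices. *)
have room j (U : {set V}) : j \in ES -> #|U| <= #|T| -> exists Y,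
    [/\ [disjoint Y & U :|: (A :|: B)], [disjoint part c j & Y] &
      forall X, X \subset part c j -> om <= #|X| -> l * (#|X| + #|Y|) < edge_count e X Y].
  rewrite in_setD => /andP[_ jL] cU; have [_ _ hK] := hLa j jL.
  pose nb := [set i | h j i] :\: [set i0; j0].
  have nbf : {in nb, forall i, #|part c i| = 2 * s}.
    move=> i; rewrite in_setD inE => /andP[_ hji]; apply: (@h_size i j).
    by rewrite h_sym.
  have bnb := budget nbf.
  have [i iX hi] : exists2 i, i \in nb & om <= #|part c i :\: U|.
    apply/exists_inP; rewrite -[X in is_true X]negbK; apply/negP => /exists_inPn H.
    have le1 : \sum_(i in nb) #|part c i| <= \sum_(i in nb) (#|U :&: part c i| + om).
      apply: leq_sum => i iX; have := H i iX; rewrite -ltnNge -(cardsID U (part c i)) setIC.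
      by move=> /ltnW h1; rewrite leq_add2l.
    have le2 : \sum_(i in nb) #|U :&: part c i| <= #|U|.
      apply: sum_setI_le => i i' _ _ nii.
      exact: disjoint_parts nii (subxx _) (subxx _).
    move: le1; rewrite big_split /= !sum_nat_const (eq_bigr _ nbf) sum_nat_const => le1.
    have c2 : #|[set i | h j i]| <= #|nb| + 2.
      rewrite -(cardsID [set i0; j0] [set i | h j i]) addnC leq_add2l.
      apply: leq_trans (subset_leq_card (subsetIr _ _)) _.
      by rewrite cards2; case: (_ != _).
    have le3 : 2 * s * #|[set i | h j i]| <= #|nb| * (2 * s) + 4 * s.
      apply: (@leq_trans (2 * s * (#|nb| + 2))); first by rewrite leq_mul2l c2 orbT.
      by rewrite mulnDr mulnC; apply: eq_leq; congr (_ + _); ring.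
    have K6 : k + 6 * tau <= K by rewrite /K; move: D_k; clear; lia.
    move: le1 le2 le3 bnb hK cU T_k K6 s_tau tau_big.
    move: (#|nb| * om) (#|nb| * (2 * s)) (2 * s * #|_|); clear; lia.
  exists (part c i :\: U); move: iX; rewrite in_setD inE => /andP[ni hji]; split.
  - apply: disjoint_setUr; last by apply: outF ni _; apply: subsetDl.
    by rewrite -setI_eq0; apply/eqP/setP => x; rewrite !inE; case: (x \in U); rewrite ?andbF.
  - exact: disjoint_parts (h_neq hji) (subxx _) (subsetDl _ _).
  - by move=> X sX cX; apply: (h_dense hji) => //; apply: subsetDl.
apply: (embed_tree pr dr dp e_sym l_gt0 cap_T aA dA dB) => t0 t1 t2 ht ht'.
(* The room of [B] decides the loss: [8 * s] for exceptional pairs on each end and [4 * s] in [La],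
   doubled because [B] is counted twice, give [40 * s]. The multiples of [om] arise likewise. *)
apply: (strategy_one_sided (side := side) (s := 2 * s) (al := al)
  (be := fun i b => be (if b then i else ps i)) (ES := ES) (E := part c) (gE := be)
  (K := K - (40 * s + 4 * (#|N| * om) + 2 * (#|La| * om))) (m := #|T|)
  _ _ _ _ aA PSD) => //.
- by move=> i /PSP[iN _ _] b; rewrite /side; case: b; [apply: full | apply: fullp].
- move=> i j /PSP[iN _ _] /PSP[jN _ _] b b' ne; rewrite /side.
  have ne' : (ps i == ps j) = (i == j) by apply/eqP/eqP => [/ips|->] //; apply.
  have nN i' j' : i' \in N -> j' \in N -> i' != ps j'.
    by move=> iN' jN'; apply: contraTneq iN' => ->; case: (hps j' jN').
  case: b b' ne => -[] ne; apply: disjoint_parts (subxx _) (subxx _) => //.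
  + by move: ne; rewrite xpair_eqE andbT.
  + exact: nN.
  + by rewrite eq_sym nN.
  + by move: ne; rewrite ne' xpair_eqE andbT.
- move=> i /PSP[iN ni npi] b; rewrite /side; case: b.
    exact: outF ni (subxx _).
  exact: outF npi (subxx _).
- move=> i /PSP[iN _ _] b; have [_ hi] := hps i iN; rewrite /side; case: b => /=.
    exact: h_dense.
  by apply: h_dense; rewrite h_sym.
- by move=> a aA' i iP; have [h1 _] := hA a aA' i.
- move=> b bB i iP b'; have [h1 _] := hB b bB (if b' then i else ps i).
  by move: h1; rewrite /side; case: b'.
- by move=> b bB j jE; have [] := hB b bB j.
- by move=> i j _ _ nij; apply: disjoint_parts nij (subxx _) (subxx _).
- move=> j i; rewrite in_setD => /andP[_ jL] /PSP[iN _ _] b; have [jN jp _] := hLa j jL.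
  rewrite /side; case: b; apply: disjoint_parts (subxx _) (subxx _).
    by apply: contraNneq jN => ->.
  by apply: contraNneq jp => ->; apply: imset_f.
- by move=> j; rewrite in_setD => /andP[nj _]; apply: outF nj (subxx _).
- by move=> j jE U cU; apply: room.
- have [a aA'] := aA; have := dAN a (subsetP sA a aA'); rewrite sum_deg_verts -/K.
  have ha i : deg_in e a (part c i) <= al i + 2 * om by case: (hA a aA' i).
  have := sumN (fun i => deg_in e a (part c i)) al (2 * s) (2 * om) (fun i _ => degS a i) ha.
  by rewrite [#|N| * (2 * om)]mulnCA; move: (\sum_(i in N) _) (#|N| * om) (#|La| * om); clear; lia.
- have [b bB] : exists b, b \in B.
    have [a aA'] := aA; have : 0 < deg_in e a B.
      apply: leq_trans (dA a aA'); rewrite lt0n; apply: contraTneq cap_T => ->.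
      by rewrite mul0n -ltnNge; lia.
    by move=> /card_gt0P[b]; rewrite inE => /andP[bB _]; exists b.
  have d1 := deg_vertsU (N :|: ps @: N) La b; have d2 := deg_vertsU N (ps @: N) b.
  have hb i : deg_in e b (part c i) <= be i + om by case: (hB b bB i).
  have s1 := sumN (fun i => deg_in e b (part c i)) be (2 * s) om (fun i _ => degS b i) hb.
  have s2 := sumN (fun i => deg_in e b (part c (ps i))) (fun i => be (ps i)) (2 * s) om
    (fun i _ => degS b (ps i)) (fun i => hb (ps i)).
  have s3 : \sum_(j in La) deg_in e b (part c j) <= \sum_(j in ES) be j + 2 * (2 * s) + #|La| * om.
    rewrite (big_setID [set i0; j0]) /= -/ES.
    have e1 : \sum_(j in La :&: [set i0; j0]) deg_in e b (part c j) <= 2 * (2 * s).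
      apply: (@leq_trans (\sum_(j in La :&: [set i0; j0]) 2 * s)); first by apply: leq_sum => j _.
      rewrite sum_nat_const leq_mul2r; apply/orP; right.
      apply: leq_trans (subset_leq_card (subsetIr _ _)) _.
      by rewrite cards2; case: (_ != _).
    have e2 : \sum_(j in ES) deg_in e b (part c j) <= \sum_(j in ES) be j + #|ES| * om.
      by rewrite -sum_nat_const -big_split /=; apply: leq_sum => j _.
    by move: e1 e2 cES'; clear; lia.
  have := dBG b (subsetP sB b bB); rewrite -/K.
  move: d1 d2 s1 s2 s3; rewrite !sum_deg_verts big_imset //= big_split /=.
  by move: (#|N| * om) (#|La| * om); clear; lia.
- have K6 : k + 6 * tau <= K by rewrite /K; move: D_k; clear; lia.
  move: bN bL cES' s_tau tau_big T_k K6.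
  by move: (#|N| * om) (#|La| * om) (#|ES| * om); clear; lia.
Qed.

End Assembly.

(** * Choice of the constants *)

(** Two sets of at least [2 s / E] vertices in a dense pair span at least [(2 s) ^ 2 / E ^ 3] edges,
    quadratic in [n], while the number required is linear in [n]. *)
Lemma seeds_edges E M s n th l' a b ec :
  2 * s <= E * a -> 2 * s <= E * b -> a * b <= E * ec -> n <= M * s -> 0 < n ->
  M * M * (E * E * E) * (th * l') < 2 * n -> th * (l' * (2 * n)) < ec.
Proof.
move=> ha hb hab nM n0 big; rewrite ltnNge; apply/negP => le.
have h1 : 2 * s * (2 * s) <= E * E * E * ec.
  apply: leq_trans (leq_mul ha hb) _.
  by rewrite mulnACA -[E * E * E * ec]mulnA leq_mul2l hab orbT.
have h2 : 2 * n * (2 * n) <= M * M * (2 * s * (2 * s)).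
  apply: (@leq_trans (2 * (M * s) * (2 * (M * s)))); last by apply: eq_leq; ring.
  have nM2 : 2 * n <= 2 * (M * s) by rewrite leq_mul2l nM orbT.
  exact: (leq_mul nM2 nM2).
have h3 : 2 * n * (2 * n) <= M * M * (E * E * E) * (th * l') * (2 * n).
  apply: leq_trans h2 _; rewrite -!(mulnA (M * M)) leq_mul2l; apply/orP; right.
  apply: leq_trans h1 _; rewrite -!(mulnA (E * E * E)) leq_mul2l; apply/orP; right.
  by rewrite -mulnA.
have n2 : 0 < 2 * n by rewrite muln_gt0 n0.
by move: h3; rewrite (leq_pmul2r n2) leqNgt big.
Qed.

Lemma quotient_scale d n : 0 < d -> d <= n ->
  let q := n %/ d in d * q <= n /\ n <= 2 * d * q.
Proof.
move=> d0 dn q; have q0 : 0 < q by rewrite divn_gt0.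
split; first by rewrite mulnC leq_trunc_div.
apply: ltnW; apply: leq_trans (ltn_ceil n d0) _.
by rewrite -/q mulnC -mulnA mulnCA leq_mul2l; apply/orP; right; move: q0; clear; lia.
Qed.

Lemma embed_rooted_tree S0 : 0 < S0 -> exists n0, forall (V : finType) (e : rel V) D k,
  symmetric e -> n0 <= #|V| -> S0 * k + #|V| <= S0 * D ->
  #|V| <= 2 * #|[set v | D <= deg_in e v setT]| ->
  forall (T : finType) (r : T) (p : T -> T) (d : T -> nat),
    p r = r -> d r = 0 -> (forall x, x != r -> d x = (d (p x)).+1) -> #|T| <= k.+1 ->
  exists f : T -> V, injective f /\ forall u, u != r -> e (f (p u)) (f u).
Proof.
move=> S00; have q0 : 0 < S0 * S0 by rewrite muln_gt0 S00.
have [S [S_gt0 SS S0S]] : exists S, [/\ 0 < S, 11 * (1000 * (S0 * S0)) <= S & 11 * 1000 * S0 <= S].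
  exists (11 * (1000 * (S0 * S0))); split => //; last by rewrite -!mulnA !leq_mul2l leq_pmulr ?orbT.
  by move: q0; clear; lia.
have [E [E_gt0 ES SE]] : exists E, [/\ 0 < E, 7 * S * S <= E & S <= E].
  exists (7 * S * S); split => //; move: S_gt0; clear; nia.
have [M [nr reg]] := regular_partition E_gt0.
(* [cap] exceeds the number of seeds, as [#|T| <= 2 n <= 4 M E ^ 2 l]. [l'] satisfies
   [cap * n + cap * om <= l' * om] because [n <= M * E * om]. [th] bounds the number of pairs of
   vertex types: [E] values for each of at most [2 * M] clusters or halves. *)
pose cap := 3 * (4 * M * (E * E) + 1); pose l' := cap * (M * E + 1).
pose th := E ^ (2 * M) * E ^ (2 * M).
exists (nr + 8 * S0 * (100 + 200 * M) + M * (E * E) + M * M * (E * E * E) * (th * l') + 1).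
move=> V e D k e_sym hn hD half T r p d pr dr dp cT.
have [hn1 hn2 hn3 hn4] : [/\ nr < #|V|, 8 * S0 * (100 + 200 * M) <= #|V|,
    M * (E * E) <= #|V| & M * M * (E * E * E) * (th * l') < #|V|].
  split; apply: leq_trans hn.
  - by rewrite addn1 ltnS -!addnA leq_addr.
  - by rewrite -!addnA addnCA leq_addr.
  - by rewrite -addnA addnAC leq_addl.
  - by rewrite addn1 ltnS leq_addl.
have n0 : 0 < #|V| by apply: leq_trans hn1.
have [|I [c [lab [s [np labE rg]]]]] := reg V e (fun v => D <= deg_in e v setT); first by apply: ltnW.
pose h := reduced e c E s lab (fun v => D <= deg_in e v setT) S.
have h_sym : symmetric h.
  by move=> i j; rewrite /h /reduced dense_regular_sym // [~~ dead _ _ _ _ _ _ _ i && _]andbC.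
have hd i j : h i j -> dense_regular e c E s lab i j by case/and3P.
have h_size i j : h i j -> #|part c i| = 2 * s by move/hd => /and5P[_ /eqP].
have h_neq i j : h i j -> i != j by move/hd => /and5P[].
have h_lab i j : h i j -> lab i || lab j by move/hd => /and5P[].
have s_gt0 := np_pos np; have nM := np_large np.
have dS0 : 8 * S0 <= #|V| by move: hn2; clear; nia.
have [tauV Vtau] := @quotient_scale (8 * S0) #|V| (ltac:(by rewrite muln_gt0)) dS0.
set tau := #|V| %/ (8 * S0) in tauV Vtau.
have {}Vtau : #|V| <= 16 * S0 * tau by move: Vtau; rewrite !mulnA.
have tau_big : 100 + 200 * M <= tau.
  by rewrite leq_divRL ?muln_gt0 ?S00 // mulnC.
have VD : #|V| <= S0 * D by lia.
have DV : D <= #|V|.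
  have [L0|[v]] := set_0Vmem [set v | D <= deg_in e v setT].
    by move: half; rewrite L0 cards0; lia.
  by rewrite inE => /leq_trans; apply; apply: leq_trans (deg_in_card _ _ _) (max_card _).
have D_k : k + 8 * tau <= D.
  rewrite -(leq_pmul2l S00); apply: leq_trans hD; rewrite mulnDr leq_add2l.
  by apply: leq_trans tauV; apply: eq_leq; ring.
(* [om] is the least size to which regularity applies. [l] is so small that [2 E l < om], hence
   [E l (x + y) < x y] whenever [x, y >= om]: density [1 / E] suffices for a site. *)
pose om := (2 * s) %/ E + 1; pose l := s %/ (E * E).
have EE : 0 < E * E by rewrite muln_gt0 E_gt0.
have om_E : 2 * s < E * om by apply: leq_trans (ltn_ceil (2 * s) E_gt0) _; rewrite mulnC /om addn1.
have om_le : E * om <= 2 * s + E.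
  by rewrite /om mulnDr muln1 leq_add2r mulnC leq_trunc_div.
have sEE : E * E <= s.
  case: (posnP M) nM => [->|M0 nM]; first by rewrite mul0n; lia.
  by rewrite -(leq_pmul2l M0); apply: leq_trans nM; lia.
have [lE sl] := quotient_scale EE sEE.
rewrite -/l in lE sl.
have l_gt0 : 0 < l by rewrite divn_gt0.
have lEom : 2 * (E * l) < om.
  by rewrite -(ltn_pmul2l E_gt0); apply: leq_ltn_trans om_E; rewrite mulnCA leq_mul2l mulnA lE.
have l_om : l <= om.
  apply: ltnW; apply: leq_ltn_trans lEom; rewrite mulnA leq_pmull //.
  by rewrite muln_gt0 E_gt0.
have h_dense i j : h i j -> dense_pair e l om (part c i) (part c j).
  move=> hij X Y sX sY cX cY.
  have big x : om <= x -> 2 * s <= E * x.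
    by move=> hx; apply: leq_trans (ltnW om_E) _; rewrite leq_mul2l hx orbT.
  have := dense_regular_edges E_gt0 np rg (hd i j hij) sX sY (big _ cX) (big _ cY).
  move=> le; rewrite -(ltn_pmul2l E_gt0); apply: leq_trans le.
  rewrite mulnA; move: (E * l) lEom => y hy.
  have h1 : y.*2 < #|X| by rewrite -mul2n; apply: leq_trans hy cX.
  have h2 : y.*2 < #|Y| by rewrite -mul2n; apply: leq_trans hy cY.
  by move: #|X| #|Y| h1 h2; clear; nia.
have budget (X : {set I}) : {in X, forall i, #|part c i| = 2 * s} -> 100 * (#|X| * om) <= tau.
  move=> fX; have vX : #|X| * (2 * s) <= #|V|.
    by rewrite -(card_verts_full (c := c)) //; apply: max_card.
  have XM : #|X| <= M by apply: leq_trans (max_card _) (np_card np).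
  rewrite -(leq_pmul2l E_gt0).
  have h1 : E * (#|X| * om) <= #|V| + M * E.
    rewrite mulnCA; apply: leq_trans (leq_mul (leqnn _) om_le) _.
    by rewrite mulnDr leq_add // leq_mul2r XM orbT.
  have h2 : 3200 * (S0 * tau) <= E * tau.
    by rewrite mulnA leq_mul2r; apply/orP; right; move: S0S SE; clear; lia.
  have h3 : E * (200 * M) <= E * tau by rewrite leq_mul2l; apply/orP; right; lia.
  rewrite mulnCA; move: h1 h2 h3 Vtau; rewrite -[16 * S0 * tau]mulnA [M * E]mulnC ![E * (200 * M)]mulnCA.
  by move: (E * (#|X| * om)) (S0 * tau) (E * tau) (E * M); clear; lia.
have s_tau : 100 * s <= tau.
  have h1 := np_small np.
  have h2 : 100 * (8 * S0 * s) <= 8 * S0 * tau.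
    apply: (@leq_trans (E * s)).
      by rewrite !mulnA leq_mul2r; apply/orP; right; move: S0S SE; clear; lia.
    move: h1 Vtau; rewrite -[2 * s * E]mulnA [s * E]mulnC -[16 * S0 * tau]mulnA -[8 * S0 * tau]mulnA.
    by move: (E * s) (S0 * tau); clear; lia.
  by move: h2; rewrite mulnCA leq_pmul2l // muln_gt0 S00.
have cap_w : cap * #|V| + cap * om <= l' * om.
  rewrite /l' -mulnDr -mulnA leq_mul2l; apply/orP; right.
  rewrite mulnDl mul1n leq_add2r; apply: leq_trans nM _; rewrite -mulnA leq_mul2l.
  by apply/orP; right; move: om_E; clear; lia.
have kV : k <= #|V|.
  by apply: leq_trans DV; move: D_k; clear; lia.
have cap_T : 3 * (#|T| + l) <= cap * l.
  rewrite /cap -mulnA leq_mul2l /= mulnDl mul1n leq_add2r.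
  have h1 : #|V| <= M * (2 * (E * E) * l) by apply: leq_trans nM _; rewrite leq_mul2l sl orbT.
  have -> : 4 * M * (E * E) * l = 2 * (M * (2 * (E * E) * l)) by ring.
  apply: leq_trans cT _; apply: (@leq_trans (2 * #|V|)); last by rewrite leq_mul2l h1 orbT.
  by rewrite mul2n -addnn -addn1 leq_add.
have seeds_room i j (A B : {set V}) : h i j ->
    A \subset part c i -> B \subset part c j -> 2 * s <= E * #|A| -> 2 * s <= E * #|B| ->
    E ^ (2 * M) * E ^ (2 * M) * (l' * (2 * #|V|)) < edge_count e A B.
  move=> hij sA sB cA cB.
  have dens := dense_regular_edges E_gt0 np rg (hd i j hij) sA sB cA cB.
  apply: (seeds_edges cA cB dens nM n0); rewrite -/th; move: hn4.
  by move: (M * M * _ * _); clear; lia.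
have tau99 : 99 < tau by move: tau_big; clear; lia.
have tau_gt0 : 0 < tau by apply: leq_trans tau99.
pose typ := typical e c E s lab (fun v => D <= deg_in e v setT) S.
have typ_lab : {in typ, forall v, D <= deg_in e v setT} by move=> v; rewrite inE => /and3P[].
have typ_loss : {in typ, forall v, S * loss e c h v <= 3 * #|V|}.
  by move=> v; apply: (typical_loss E_gt0 np labE rg S_gt0 ES).
have few_atypical := card_not_typical E_gt0 np labE rg S_gt0 ES.
have h_typ i j : h i j -> lab i -> s <= #|part c i :&: typ|.
  exact: (reduced_typical E_gt0 labE rg S_gt0 ES).
have part_le := np_size np; have I_M := np_card np.
case: (reduced_structure e_sym h_sym s_gt0 h_size h_lab labE (fun=> erefl) typ_lab
  typ_loss few_atypical h_typ half DV VD tauV Vtau S00 SS SE tau_gt0).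
- exact: (embed_covered e_sym h_sym h_size h_dense part_le I_M
    budget s_tau tau99 l_gt0 l_om E_gt0 om_E D_k cap_w seeds_room pr dr dp cT cap_T).
- exact: (embed_one_sided e_sym h_sym h_neq h_size h_dense part_le I_M
    budget s_tau tau99 l_gt0 l_om E_gt0 om_E D_k cap_w seeds_room pr dr dp cT cap_T).
Qed.

(** * From real parameters to integers *)

Local Open Scope ring_scope.

Theorem theorem2 (R : realType) (eta q : R) (eta_gt0 : 0 < eta) (q_gt0 : 0 < q) :
  exists n0 : nat,
    forall (G : sgraph) (k : nat),
      (n0 <= #|G|)%N ->
      q * #|G|%:R <= k%:R ->
      #|G|%:R / 2%:R <=
        #|[set v : G | (1 + eta) * k%:R <= (degree v)%:R]|%:R :> R ->
      forall T : sgraph,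
        is_tree T -> (#|edges T| <= k)%N -> contains_subgraph G T.
Proof.
have eq_gt0 : 0 < eta * q by rewrite mulr_gt0.
(* The degree slack is [eta * k >= eta * q * n >= n / S0]. *)
pose S0 := Num.bound (eta * q)^-1.
have S0_ge : 1 <= S0%:R * (eta * q).
  have inv_ge0 : 0 <= (eta * q)^-1 by rewrite invr_ge0 ltW.
  by rewrite -ler_pdivrMr // mul1r ltW // archi_boundP.
have S0_gt0 : (0 < S0)%N.
  by case: (posnP S0) S0_ge => // ->; rewrite mul0r ler10.
have [n0 emb] := embed_rooted_tree S0_gt0; exists n0 => G k hn hq half T treeT eT.
have k_ge0 : 0 <= (1 + eta) * k%:R by rewrite mulr_ge0 // addr_ge0 // ltW.
(* The least such [m] is the ceiling of [(1 + eta) k]; comparing degrees with it is equivalent to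
   the real inequality. *)
have exD : exists m : nat, (1 + eta) * k%:R <= m%:R :> R.
  by exists (Num.bound ((1 + eta) * k%:R)); apply/ltW/archi_boundP.
have [D hD minD] := ex_minnP exD.
have degE (v : G) : ((1 + eta) * k%:R <= (degree v)%:R) = (D <= deg_in (@adj G) v setT)%N.
  have -> : degree v = deg_in (@adj G) v setT.
    by apply: eq_card => w; rewrite !inE.
  apply/idP/idP => [/minD//|le]; apply: le_trans hD _; by rewrite ler_nat.
have hSD : (S0 * k + #|G| <= S0 * D)%N.
  rewrite -(ler_nat R) natrD !natrM; have : S0%:R * ((1 + eta) * k%:R) <= S0%:R * D%:R :> R.
    by rewrite ler_wpM2l.
  apply: le_trans; rewrite mulrDl mul1r mulrDr lerD2l.
  apply: (@le_trans _ _ (S0%:R * (eta * q) * #|G|%:R)).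
    by rewrite -[X in X <= _]mul1r ler_wpM2r.
  by rewrite -!mulrA !ler_wpM2l // ltW.
have half' : (#|G| <= 2 * #|[set v : G | D <= deg_in (@adj G) v setT]|)%N.
  rewrite -(ler_nat R) natrM mulrC -ler_pdivrMr ?ltr0n //; apply: le_trans half _.
  by rewrite ler_nat subset_leq_card //; apply/subsetP => v; rewrite !inE degE.
have [r [p [d rt]]] := tree_parent treeT.
have [[_ pr dr] step par] := rt.
have cT : (#|T| <= k.+1)%N by apply: leq_trans (rooted_card rt) _.
have [|f [f_inj fe]] := emb G (@adj G) D k (@adj_sym G) hn hSD half' T r p d pr dr _ cT.
  by move=> x xr; case: (step x (in_setT x) xr).
exists f; split=> // x y xy.
have [[xr <-]|[yr <-]] := par x y (in_setT x) (in_setT y) xy; last exact: fe.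
by rewrite adj_sym; apply: fe.
Qed.
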